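(* Let $\ell\in\mathbb{N}_0$. Then $$\sum_{n_1,n_2\le x} A_\ell((n_1,n_2)) = x^2 \log \log x + \overline{D}_{A_\ell,2}\, x^2 + O\left(\frac{x^2}{\log x}\right),$$ and for every integer $k\ge 3$, $$\sum_{n_1,\ldots,n_k\le x} A_\ell((n_1,\ldots,n_k)) = \overline{D}_{A_\ell,k}\, x^k + \begin{cases} O(x^{k-1}), & \text{if } k\ge 4,\\ O(x^2\log \log x), & \text{if } k=3,\end{cases}$$ with the constants $$\overline{D}_{A_{\ell},2} = \gamma + \sum_p \left( \log \left(1 -\frac1{p}\right) + \frac1{p} \left(1-\frac1{p^2}\right)^{-\ell} \sum_{\nu=0}^{\ell -1} \frac{\left\langle {\ell \atop \nu} \right\rangle}{p^{2\nu}} \right),$$ $$\overline{D}_{A_{\ell},k} = \sum_p \frac1{p^{k-1}} \left(1-\frac1{p^k}\right)^{-\ell} \sum_{\nu=0}^{\ell -1} \frac{\left\langle {\ell \atop \nu} \right\rangle}{p^{\nu k}} \quad (k\ge 3),$$ the inner sums being considered $1$ if $\ell=0$. In particular, these estimates hold for the function $A(n)=A_1(n)$ with $$\overline{D}_{A,2} = \gamma + \sum_p \left( \log \left(1 -\frac1{p}\right) + \frac{p}{p^2-1} \right)\approx 0.4971, \qquad \overline{D}_{A,k} = \sum_p \frac{p}{p^k-1} \quad (k\ge 3),$$ and they hold for the function $A^*(n)=A_0(n)$ with $\overline{D}_{A^*,2}=M$, the Mertens constant, and $\overline{D}_{A^*,k} = \sum_p \frac1{p^{k-1}}$ ($k\ge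 3$).
   Context: $\mathbb{N}_0=\{0,1,2,\ldots\}$. $(n_1,\ldots,n_k)$ as an argument of a function denotes the greatest common divisor; the sums run over all tuples of positive integers not exceeding $x$. For $\ell\in\mathbb{N}_0$, $A_\ell(n)=\sum_{p^\nu\| n}\nu^\ell p$, the sum being over the prime powers $p^\nu$ ($\nu\ge1$) exactly dividing $n$; thus $A(n)=A_1(n)=\sum_{p^\nu\|n}\nu p$ and $A^*(n)=A_0(n)=\sum_{p\mid n}p$. $\left\langle {n \atop k} \right\rangle$ are the (classical) Eulerian numbers: the number of permutations $h\in S_n$ with exactly $k$ descents, a descent being an index $i$ with $h(i)>h(i+1)$. $\gamma$ is Euler's constant, and the Mertens constant is $M=\gamma+\sum_p\left(\log\left(1-\frac1p\right)+\frac1p\right)$; $\sum_p$ runs over all primes. The asymptotic formulas are for real $x\to\infty$; the implied constants may depend on $k$ and $\ell$.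
   Formalization: The printed value 0.4971 for the constant D_{A,2} is incorrect: the formula γ + Σ_p (log(1−1/p) + p/(p²−1)) equals about 0.48296, and the formal theorem proves |D_{A,2} − 0.4830| ≤ 0.00005 instead. *)

(* Defs.v *)
From mathcomp Require Export all_boot all_order perm all_algebra.
From mathcomp Require Export all_classical all_reals all_analysis.
Set Implicit Arguments.
Unset Strict Implicit.
Unset Printing Implicit Defensive.
Export Order.TTheory GRing.Theory Num.Theory.
Export numFieldNormedType.Exports.

Local Open Scope ring_scope.
Local Open Scope classical_set_scope.

(* For n > 0, [primes n] lists the p dividing n and [logn p n] is the nu >= 1
   with p^nu || n; hence no 0 ^ 0 term appears when l = 0. *)
Definition A_ell (l n : nat) : nat :=
  (\sum_(p <- primes n) logn p n ^ l * p)%N.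

Definition A_mult (n : nat) : nat := (\sum_(p <- primes n) logn p n * p)%N.

Definition A_star (n : nat) : nat := (\sum_(p <- primes n) p)%N.

Lemma A_ell1 : A_ell 1 = A_mult.
Proof. by apply/funext => n; apply: eq_bigr => p _; rewrite expn1. Qed.

Lemma A_ell0 : A_ell 0 = A_star.
Proof. by apply/funext => n; apply: eq_bigr => p _; rewrite expn0 mul1n. Qed.

Definition descents (n : nat) (h : 'S_n) : nat :=
  #|[set i : 'I_n |
      [exists j : 'I_n, (j == i.+1 :> nat) && (h j < h i)%N]]|%SET.

Definition eulerian (n k : nat) : nat :=
  #|[set h : 'S_n | descents h == k]|%SET.

Definition gcd_sum {R : realType} (f : nat -> nat) (k : nat) (x : R) : R :=
  (\sum_(n : {ffun 'I_k -> 'I_(Num.truncn x).+1} | [forall i, 0 < n i])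
     f (\big[gcdn/0]_(i < k) n i))%N%:R.

Definition prime_partial_sum {R : realType} (f : nat -> R) : R^nat :=
  fun n => \sum_(0 <= p < n | prime p) f p.

(* [limn] is total: this is the value of the series only when
   [cvgn (prime_partial_sum f)] holds. *)
Definition prime_sum {R : realType} (f : nat -> R) : R :=
  limn (prime_partial_sum f).

Definition euler_gamma (R : realType) : R :=
  limn (fun n : nat => \sum_(1 <= i < n.+1) i%:R^-1 - ln n%:R).

Definition mertens (R : realType) : R :=
  euler_gamma R + prime_sum (fun p => ln (1 - p%:R^-1) + p%:R^-1).

Definition eulerian_sum {R : realType} (l k p : nat) : R :=
  if l == 0%N then 1
  else \sum_(0 <= nu < l) (eulerian l nu)%:R / p%:R ^+ (nu * k).

Definition D2_term {R : realType} (l p : nat) : R :=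
  ln (1 - p%:R^-1)
  + p%:R^-1 * (1 - (p%:R ^+ 2)^-1) ^- l * eulerian_sum l 2 p.

Definition D_term {R : realType} (l k p : nat) : R :=
  (p%:R ^+ (k - 1))^-1 * (1 - (p%:R ^+ k)^-1) ^- l * eulerian_sum l k p.

Definition Dbar2 (R : realType) (l : nat) : R :=
  euler_gamma R + prime_sum (D2_term l).

Definition Dbar (R : realType) (l k : nat) : R := prime_sum (D_term l k).

Canonical pinfty_filter_on (R : realType) : filter_on R :=
  FilterType (pinfty_nbhs R) _.

Definition gcd_sum_estimates {R : realType} (f : nat -> nat)
    (D2 : R) (D : nat -> R) : Prop :=
  (fun x : R => gcd_sum f 2 x - (x ^+ 2 * ln (ln x) + D2 * x ^+ 2))
    =O_ (+oo_R) (fun x : R => x ^+ 2 / ln x)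
  /\ forall k : nat, (3 <= k)%N ->
     (fun x : R => gcd_sum f k x - D k * x ^+ k)
       =O_ (+oo_R) (fun x : R =>
         if (4 <= k)%N then x ^+ (k - 1) else x ^+ 2 * ln (ln x)).

(* Main.v *)
Require Import Defs.
From mathcomp Require Import ring lra zify.
From Stdlib Require BinNat Nnat.

(** Let c_j = j^l - (j-1)^l for j >= 2 and c_1 = 1.  Since c_1 + ... + c_v = v^l,
    one has A_l(n) = sum of c_j p over the prime powers p^j dividing n (j >= 1).
    A tuple has a gcd divisible by q exactly when all its entries are multiples
    of q, so the sum over the tuples is the sum over the primes p of the share
    p (sum over j of c_j floor(x/p^j)^k) ([gcd_sum_prime_shares]).

    Without the floors, the share of p becomes x^k p f(p^-k), where f(y) is the
    power series with coefficients c_j.  Worpitzky's identity writes j^l as a sum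
    of binomial coefficients indexed by the permutations of S_l, and with the
    negative binomial series it gives f(y) = y (1-y)^-l (sum of <l,i> y^i): the
    p-term D_k(p) of the announced constant is p f(p^-k) ([jump_series_cvg],
    [D_termE]).  Restoring the floors costs little: 0 <= t^k - floor(t)^k <=
    k t^(k-1), and this bound has the same form as the main term with k lowered
    by one, so that the error in the share of p is at most k x^(k-1) D_(k-1)(p)
    ([prime_share_error]).

    It remains to sum over p <= x, where D_m(p) is of the order of p^(1-m).  For
    k >= 4 the error terms D_(k-1)(p) have a convergent sum; for k = 3 they add up
    to O(sum of 1/p) = O(log log x); for k = 2 they are bounded, so that they add
    up to O(pi(x)) = O(x / log x) by Chebyshev's bound.  For k >= 3 the main terms
    make up a convergent series whose tail is O(1/x).  For k = 2, D_2(p) differs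
    from 1/p by the term of such a series, and the sum of 1/p is given by Mertens'
    second theorem with error O(1 / log x) ([mertens_second_explicit]).

    The elementary proof of Mertens' theorem yields some constant B; the statement
    needs B = gamma - K, where K is the sum of -log(1-1/p) - 1/p.  The proof
    ([mertens_constant_eq]) compares Euler's product for zeta(1+d) with the
    sum of p^-(1+d) as d tends to 0.  With the primes grouped in dyadic blocks,
    that sum is a power series in z = 2^-d up to a factor between 1 and 1/z; its
    coefficients W_m are close to 1/m, and Abel's theorem applied to the series of
    W_m - 1/m, whose sum is B + log log 2 - gamma, together with
    zeta(1+d) (1 - 2^-d) -> log 2 leaves only the wanted relation.

    The numerical value of the constant for l = 1 comes from splitting
    p/(p^2-1) + log(1-1/p) into a gap of order p^-3 and -1/2 times the logarithm
    of the Euler factor of zeta(2).  The constant is then gamma - (log zeta(2))/2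
    plus a series with a tail at 200 below 51 millionths, and certified integer
    arithmetic bounds the remaining finite expression. *)

Set Implicit Arguments.
Unset Strict Implicit.
Unset Printing Implicit Defensive.
Local Open Scope ring_scope.
Local Open Scope classical_set_scope.

(** * Real sequences and sums *)

Lemma cvgn_eps (R : realType) (u : R^nat) (l : R) :
  u @ \oo --> l <->
  forall e : R, 0 < e -> exists N, forall n, (N <= n)%N -> `|u n - l| <= e.
Proof.
split=> [/cvgrPdist_le h e e0|h].
  by have [N _ hN] := h e e0; exists N => n Nn; rewrite distrC; exact: hN.
apply/cvgrPdist_le => e e0; have [N hN] := h e e0.
by exists N => // n /= Nn; rewrite distrC; exact: hN.
Qed.

Lemma cvgn_le (R : realType) (u : R^nat) (l b : R) (N : nat) :
  u @ \oo --> l -> (forall n, (N <= n)%N -> u n <= b) -> l <= b.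
Proof.
move=> ul h; apply: (ler_cvg_to ul (cvg_cst b)).
by exists N => // n /= Nn; exact: h.
Qed.

Lemma cvgn_ge (R : realType) (u : R^nat) (l b : R) (N : nat) :
  u @ \oo --> l -> (forall n, (N <= n)%N -> b <= u n) -> b <= l.
Proof.
move=> ul h; apply: (ler_cvg_to (cvg_cst b) ul).
by exists N => // n /= Nn; exact: h.
Qed.

Lemma cvgn_unique (R : realType) (u : R^nat) (l l' : R) :
  u @ \oo --> l -> u @ \oo --> l' -> l = l'.
Proof. by move=> ul ul'; exact: (cvg_unique _ ul ul'). Qed.

Lemma cvgn_lim (R : realType) (u : R^nat) (l : R) : u @ \oo --> l -> limn u = l.
Proof. by move=> ul; exact: cvg_lim. Qed.

Lemma nondecreasing_bounded_cvgn (R : realType) (u : R^nat) (b : R) :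
  (forall n, u n <= u n.+1) -> (forall n, u n <= b) -> cvgn u.
Proof.
move=> h1 h2; apply: nondecreasing_is_cvgn.
  exact/nondecreasing_seqP.
by exists b => _ [n _ <-].
Qed.

Lemma cvgn_ext (R : realType) (u v : R^nat) (l : R) :
  u =1 v -> u @ \oo --> l -> v @ \oo --> l.
Proof. by move=> /funext ->. Qed.

Lemma ler_sum_nat_widen (R : realType) (f : nat -> R) (P : pred nat) (a m n : nat) :
  (m <= n)%N -> (forall i, (m <= i)%N -> P i -> 0 <= f i) ->
  \sum_(a <= i < m | P i) f i <= \sum_(a <= i < n | P i) f i.
Proof.
move=> mn h; have [am|ma] := leqP a m.
  rewrite (@big_cat_nat _ _ _ m a n) //= lerDl big_nat_cond.
  by apply: sumr_ge0 => i /andP[/andP[mi _] Pi]; exact: h.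
rewrite big_geq ?(ltnW ma) // big_nat_cond; apply: sumr_ge0 => i /andP[/andP[ai _] Pi].
by apply: h => //; lia.
Qed.

Lemma cvgn_of_shift (R : realType) (d : nat) (u : R^nat) (l : R) :
  (fun n => u (n + d)%N) @ \oo --> l -> u @ \oo --> l.
Proof. by move=> h; rewrite -(cvg_shiftn d). Qed.

Lemma cvgn_shift (R : realType) (d : nat) (u : R^nat) (l : R) :
  u @ \oo --> l -> (fun n => u (n + d)%N) @ \oo --> l.
Proof. by move=> h; rewrite -(cvg_shiftn d) in h. Qed.

Lemma cvgn_scale (R : realType) (a : R) (u : R^nat) (l : R) :
  u @ \oo --> l -> (fun n => a * u n) @ \oo --> a * l.
Proof. by move=> h; exact: cvgMl_tmp. Qed.

(** Every explicit tail estimate below comes from this comparison: a function f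
    with an explicit formula whose decrements dominate the summands. *)
Lemma ler_sum_telescope (R : realType) (f g : nat -> R) (a b : nat) : (a <= b)%N ->
  (forall i, (a <= i < b)%N -> g i <= f i - f i.+1) ->
  \sum_(a <= i < b) g i <= f a - f b.
Proof.
move=> ab h; rewrite -opprB -(telescope_sumr _ ab) -sumrN.
rewrite big_nat_cond [leRHS]big_nat_cond; apply: ler_sum => i /andP[hi _].
by rewrite opprB h.
Qed.

Lemma big_prime_recr (R : realType) (f : nat -> R) (n : nat) :
  \sum_(0 <= p < n.+1 | prime p) f p =
  \sum_(0 <= p < n | prime p) f p + (if prime n then f n else 0).
Proof. by rewrite big_mkcond big_nat_recr //= -big_mkcond. Qed.

Lemma ln_leB1 (R : realType) (x : R) : 0 < x -> ln x <= x - 1.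
Proof. by move=> x0; rewrite -{1}[x](subrKC 1) le_ln1Dx //; lra. Qed.

Lemma ler_sum_prime (R : realType) (f g : nat -> R) (a b : nat) :
  (forall p, (a <= p < b)%N -> prime p -> f p <= g p) ->
  \sum_(a <= p < b | prime p) f p <= \sum_(a <= p < b | prime p) g p.
Proof.
move=> h; rewrite big_nat_cond [leRHS]big_nat_cond.
by apply: ler_sum => p /andP[]; exact: h.
Qed.

(** * Eulerian numbers and Worpitzky's identity *)

(** Indexing the possible descents by natural numbers rather than by ordinals
    lets the sums over positions be cut and shifted when a letter is
    inserted. *)
Definition descent_at n (h : 'S_n) (a : nat) : bool :=
  [exists i : 'I_n, exists j : 'I_n,
     [&& i == a :> nat, j == a.+1 :> nat & (h j < h i)%N]].

Lemma descent_atE n (h : 'S_n) (a : nat) (ha : (a < n)%N) (hb : (a.+1 < n)%N) :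
  descent_at h a = (h (Ordinal hb) < h (Ordinal ha))%N.
Proof.
apply/idP/idP.
  case/existsP=> i /existsP[j /and3P[/eqP hi /eqP hj]].
  have -> : Ordinal hb = j by exact: val_inj.
  by have -> : Ordinal ha = i by exact: val_inj.
by move=> h1; apply/existsP; exists (Ordinal ha); apply/existsP;
  exists (Ordinal hb); rewrite /= !eqxx.
Qed.

Lemma descent_at_big n (h : 'S_n) (a : nat) : (n <= a.+1)%N -> descent_at h a = false.
Proof.
move=> na; apply/negbTE/negP => /existsP[i /existsP[j /and3P[_ /eqP hj _]]].
by have := ltn_ord j; rewrite hj ltnNge na.
Qed.

Lemma descentsE n (h : 'S_n) : descents h = (\sum_(0 <= a < n) descent_at h a)%N.
Proof.
rewrite big_mkord /descents -sum1_card big_mkcond /=.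
apply: eq_bigr => i _; rewrite inE; congr (nat_of_bool _).
apply/idP/idP.
  case/existsP=> j /andP[hj hh]; apply/existsP; exists i; apply/existsP.
  by exists j; rewrite eqxx hj.
case/existsP=> i' /existsP[j /and3P[/eqP/val_inj -> hj hh]].
by apply/existsP; exists j; rewrite hj.
Qed.

Lemma descents_le n (h : 'S_n) : (descents h <= n.-1)%N.
Proof.
rewrite descentsE; case: n h => [|n] h; first by rewrite big_nil.
rewrite big_nat_recr //= (@descent_at_big _ h n) // addn0.
rewrite (leq_trans (n := (\sum_(0 <= a < n) 1)%N)) ?leq_sum //.
  by move=> a _; case: descent_at.
by rewrite sum_nat_const_nat subn0 muln1.
Qed.

Lemma lift_max_small n (s : 'S_n) (i : 'I_n.+1) (a : nat) (h : (a < n.+1)%N) (h' : (a < n)%N) : (a < i)%N ->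
  lift_perm i ord_max s (Ordinal h) = s (Ordinal h') :> nat.
Proof.
move=> ai; rewrite (_ : Ordinal h = lift i (Ordinal h')).
  by rewrite lift_perm_lift /= /bump leqNgt ltn_ord.
by apply: val_inj; rewrite /= /bump leqNgt ai.
Qed.

Lemma lift_max_large n (s : 'S_n) (i : 'I_n.+1) (a : nat) (h : (a.+1 < n.+1)%N) (h' : (a < n)%N) : (i <= a)%N ->
  lift_perm i ord_max s (Ordinal h) = s (Ordinal h') :> nat.
Proof.
move=> ai; rewrite (_ : Ordinal h = lift i (Ordinal h')).
  by rewrite lift_perm_lift /= /bump leqNgt ltn_ord.
by apply: val_inj; rewrite /= /bump ai.
Qed.

Lemma lift_max_at n (s : 'S_n) (i : 'I_n.+1) (h : (i < n.+1)%N) :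
  lift_perm i ord_max s (Ordinal h) = n :> nat.
Proof.
rewrite (_ : Ordinal h = i) ?lift_perm_id //; exact: val_inj.
Qed.

Lemma descent_at_lift n (s : 'S_n) (i : 'I_n.+1) (a : nat) :
  (a < n.+1)%N ->
  descent_at (lift_perm i ord_max s) a =
  if (a.+1 < i)%N then descent_at s a
  else if (a.+1 == i)%N then false
  else if (a == i)%N then (i < n)%N else descent_at s a.-1.
Proof.
move=> an; have ile : (i <= n)%N by rewrite -ltnS.
have [an1|an1] := ltnP a n; last first.
  have -> : a = n by apply/eqP; rewrite eqn_leq an1 -ltnS an.
  rewrite descent_at_big //.
  case: ltnP => h1; first by rewrite descent_at_big.
  case: eqP => // _; rewrite descent_at_big ?leqSpred //.
  by case: (ltnP i n) => hi; rewrite ?(gtn_eqF hi) ?if_same.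
rewrite (descent_atE _ an (_ : a.+1 < n.+1)%N) //.
case: (ltnP a.+1 i) => h1.
  have h2 : (a.+1 < n)%N by apply: leq_trans ile.
  by rewrite (descent_atE _ an1 h2) (@lift_max_small _ _ _ _ _ h2) // (@lift_max_small _ _ _ _ _ an1) // ltnW.
case: eqP => h2.
  rewrite (@lift_max_small _ _ _ a _ an1) ?h2 //.
  have := @lift_max_at n s i; rewrite -h2 => ->.
  by apply/negbTE; rewrite -leqNgt ltnW.
case: eqP => h3.
  rewrite (@lift_max_large _ _ _ a _ an1) ?h3 //.
  have := @lift_max_at n s i; rewrite -h3 => ->.
  by rewrite ltn_ord an1.
case: a an an1 h1 h2 h3 => [|a] an an1 h1 h2 h3.
  by move: h1 h2 h3; case: (nat_of_ord i) => // -[].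
have ia : (i <= a)%N by move/eqP: h3; move/eqP: h2; lia.
have an2 := ltnW an1.
rewrite /= (descent_atE _ an2 an1) (@lift_max_large _ _ _ a.+1 _ an1) ?(@lift_max_large _ _ _ a _ an2) //.
exact: leqW.
Qed.

(** Inserting the maximum n of the word at position i creates a descent right
    after it, unless it stands at the end, and destroys the descent from i-1 to
    i if there was one: the letter before the maximum is now followed by an
    ascent. *)
Lemma descents_lift n (s : 'S_n) (i : 'I_n.+1) :
  (descents (lift_perm i ord_max s) + ((0 < i) && descent_at s i.-1) =
   descents s + (i < n))%N.
Proof.
have ile : (i <= n)%N by rewrite -ltnS.
rewrite !descentsE.
rewrite (@big_cat_nat _ _ _ i.-1) ?(leq_trans (leq_pred _)) ?leqW //=.
rewrite [X in (_ = X + _)%N](@big_cat_nat _ _ _ i.-1) ?(leq_trans (leq_pred _)) //=.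
rewrite [X in (X + _ + _ = _)%N](_ : _ = \sum_(0 <= a < i.-1) descent_at s a)%N; last first.
  rewrite big_nat_cond [RHS]big_nat_cond; apply: eq_bigr => a /andP[/andP[_ ai] _].
  by rewrite descent_at_lift 1?ifT //; move: (nat_of_ord i) ile ai => [|j] //=; lia.
rewrite -!addnA; congr addn.
rewrite (@big_cat_nat _ _ _ i) ?leq_pred ?leqW //=.
rewrite [X in (_ = X + _)%N](@big_cat_nat _ _ _ i) ?leq_pred //=.
rewrite [X in (X + _ + _ = _)%N](_ : _ = 0)%N; last first.
  rewrite big_nat_cond big1 // => a /andP[/andP[h1 h2] _].
  by rewrite descent_at_lift 1?(_ : a.+1 = i) ?ltnn ?eqxx //; lia.
rewrite [X in (_ = X + _ + _)%N](_ : _ = nat_of_bool ((0 < i)%N && descent_at s i.-1)); last first.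
  by move: (nat_of_ord i) => [|j] /=; [rewrite big_nil|rewrite big_nat1].
rewrite add0n (_ : \sum_(i <= a < n.+1) _ = (i < n) + \sum_(i <= a < n) descent_at s a)%N.
  by rewrite [X in (X + _)%N]addnC addnC addnA.
rewrite big_ltn // descent_at_lift // ltnNge leqnSn /= eqn_leq ltnn /= eqxx.
congr addn; rewrite big_add1 /= big_nat_cond [RHS]big_nat_cond.
apply: eq_bigr => a /andP[/andP[h1 h2] _].
by rewrite descent_at_lift ?ltnS // !ifN //; lia.
Qed.

(** The permutations of n+1 letters are obtained, once each, by inserting the
    maximum into the permutations of n letters. *)
Lemma sum_perm_lift n (A : nmodType) (F : 'S_n.+1 -> A) :
  \sum_h F h = \sum_(s : 'S_n) \sum_(i < n.+1) F (lift_perm i ord_max s).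
Proof.
pose f (u : 'S_n * 'I_n.+1) := lift_perm u.2 ord_max u.1.
have finj : injective f.
  move=> [s i] [t j] /= e.
  have eij : i = j.
    apply: (can_inj (permK (f (s, i)))).
    by rewrite {2}e /f /= !lift_perm_id.
  rewrite -eij in e *; congr pair.
  by apply/permP=> k; apply: (@lift_inj _ ord_max); rewrite -!(lift_perm_lift i) -/(f (s,i)) e.
have fbij : bijective f.
  apply: inj_card_bij => //.
  by rewrite card_prod !card_Sn card_ord factS mulnC.
rewrite (reindex f); last exact: onW_bij.
by rewrite -(pair_bigA _ (fun s i => F (lift_perm i ord_max s))).
Qed.

(** With d = des s, the d+1 insertions that preserve the number of descents are
    those inside an existing descent and the one at the end; the n-d others add
    a descent.  This is the recurrence of the Eulerian numbers. *)
Lemma sum_descents_lift n (s : 'S_n) (F : nat -> nat) :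
  (\sum_(i < n.+1) F (descents (lift_perm i ord_max s)) =
   (descents s).+1 * F (descents s) + (n - descents s) * F (descents s).+1)%N.
Proof.
set d := descents s.
have desE (i : 'I_n.+1) : descents (lift_perm i ord_max s) =
    if (0 < i)%N && descent_at s i.-1 || (i == n :> nat) then d else d.+1.
  have := descents_lift s i; rewrite -/d.
  have [->|ne] := eqVneq (i : nat) n.
    rewrite ltnn orbT descent_at_big ?leqSpred // andbF; lia.
  have -> : (i < n)%N by rewrite ltn_neqAle ne -ltnS ltn_ord.
  by rewrite orbF; case: andP; lia.
under eq_bigr do rewrite desE.
have dn : (d <= n.-1)%N by exact: descents_le.
rewrite big_ord_recr /= eqxx orbT.
have hd : (\sum_(i < n) ((0 < i)%N && descent_at s i.-1) = d)%N.
  rewrite /d descentsE; clear; case: n s => [|m] t; first by rewrite big_ord0 big_nil.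
  rewrite big_ord_recl big_nat_recr //= add0n (@descent_at_big _ t m) // addn0 big_mkord.
  by apply: eq_bigr.
rewrite (eq_bigr (fun i : 'I_n => ((0 < i)%N && descent_at s i.-1) * F d +
   (1 - ((0 < i)%N && descent_at s i.-1)) * F d.+1)%N); last first.
  move=> i _; rewrite ltn_eqF // orbF; case: andP => _; rewrite ?mul1n ?mul0n ?subn0 ?subnn; lia.
rewrite big_split /= -!big_distrl /= hd sumnB; last by move=> i _; case: andP.
rewrite hd sum_nat_const card_ord muln1; lia.
Qed.

(** The induction step of Worpitzky's identity, for one permutation: Pascal's
    rule turns the left side into (n+1) C(m,n+1) + (d+1) C(m,n) with m =
    j+n-d-1, and the absorption rule (n+1) C(m,n+1) = (m-n) C(m,n) makes the
    total coefficient of C(m,n) equal to j. *)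
Lemma worpitzky_step n d j : (d <= n)%N ->
  (d.+1 * 'C(j + n - d, n.+1) + (n - d) * 'C(j + n - d.+1, n.+1) =
   j * 'C(j + n.-1 - d, n))%N.
Proof.
move=> dn; case: n dn => [|n] dn.
  by move: dn; rewrite leqn0 => /eqP ->; rewrite subnn mul0n addn0 !subn0 /= !addn0 bin0 bin1 mul1n muln1.
case: j => [|j]; first by rewrite !add0n !bin_small //; lia.
rewrite /= (_ : j.+1 + n.+1 - d = (j + n.+1 - d).+1)%N; last by lia.
rewrite (_ : j.+1 + n.+1 - d.+1 = j + n.+1 - d)%N; last by lia.
rewrite (_ : j.+1 + n - d = j + n.+1 - d)%N; last by lia.
set m := (j + n.+1 - d)%N; rewrite binS mulnDr addnAC -mulnDl.
rewrite (_ : d.+1 + (n.+1 - d) = n.+2)%N; last by lia.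
rewrite mul_bin_left -mulnDl.
have [mn|nm] := leqP n.+1 m; first by congr muln; rewrite /m; lia.
by rewrite bin_small // !muln0.
Qed.

(** By induction on n: the binomial of a permutation, multiplied by j, is the
    sum of the binomials of the permutations obtained from it by inserting a
    maximum. *)
Lemma worpitzky n j :
  (j ^ n = \sum_(s : 'S_n) 'C(j + n.-1 - descents s, n))%N.
Proof.
elim: n => [|n IH].
  by rewrite expn0; under eq_bigr do rewrite bin0; rewrite sum_nat_const muln1 card_Sn.
rewrite expnS {}IH (@sum_perm_lift _ nat) big_distrr /=; apply: eq_bigr => s _.
rewrite (@sum_descents_lift _ s (fun d => 'C(j + n - d, n.+1))).
by rewrite worpitzky_step // (leq_trans (descents_le s)) // leq_pred.
Qed.

(** These are the weights c_j of the prime powers p^j dividing n.  The factor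
    (1 < j) makes c_1 = 1 also for l = 0, where 0 ^ 0 = 1 would give 0. *)
Definition pow_jump (l j : nat) : nat := (j ^ l - (1 < j) * j.-1 ^ l)%N.

(** Differencing Worpitzky's identity in j lowers both arguments of the
    binomials, by Pascal's rule.  At j = 0 the factor of pow_jump changes
    nothing, because the exponent l+1 is positive. *)
Lemma pow_jumpE l j :
  pow_jump l.+1 j.+1 = (\sum_(s : 'S_l.+1) 'C(j + l - descents s, l))%N.
Proof.
rewrite /pow_jump (_ : ((1 < j.+1) * j ^ l.+1 = j ^ l.+1)%N); last first.
  by case: j => [|j]; rewrite ?mul1n // exp0n.
rewrite !worpitzky -sumnB /=; last first.
  by move=> s _; apply: leq_bin2l; lia.
apply: eq_bigr => s _.
have ds := descents_le s.
rewrite (_ : j.+1 + l - descents s = (j + l - descents s).+1)%N; last by move: ds => /=; lia.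
by rewrite binS addKn.
Qed.

Lemma sum_pow_jump l v : (0 < v)%N -> (\sum_(1 <= j < v.+1) pow_jump l j = v ^ l)%N.
Proof.
elim: v => [//|v IH] _; rewrite big_nat_recr //=.
case: v IH => [|v] IH; first by rewrite big_nil /pow_jump exp1n.
by rewrite IH // /pow_jump /= mul1n subnKC //; case: (l) => [//|m]; rewrite leq_exp2r.
Qed.

(** By Pascal's rule, multiplying the partial sum for m+1 by 1-y gives the
    partial sum for m minus one boundary term, which tends to 0 because it is
    dominated by the terms of a convergent series. *)
Lemma negative_binomial_series_cvg (R : realType) (m : nat) (y : R) : 0 <= y < 1 ->
  (fun N => \sum_(0 <= i < N) 'C(i + m, m)%:R * y ^+ i) @ \oo --> (1 - y) ^- m.+1.
Proof.
move=> /andP[y0 y1]; have y1' : 1 - y != 0 by rewrite subr_eq0 gt_eqF.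
elim: m => [|m IH].
  have := @cvg_geometric_series R 1 y; rewrite ger0_norm // => /(_ y1).
  rewrite mul1r expr1; apply: cvgn_ext => N; apply: eq_bigr => i _.
  by rewrite /= addn0 bin0.
pose T N := \sum_(0 <= i < N) 'C(i + m.+1, m.+1)%:R * y ^+ i.
pose S N := \sum_(0 <= i < N) 'C(i + m, m)%:R * y ^+ i.
have TS N : (1 - y) * T N = S N - 'C(N + m, m.+1)%:R * y ^+ N.
  elim: N => [|N IHN].
    by rewrite /T /S !big_nil bin_small // mul0r subr0 mulr0.
  rewrite /T big_nat_recr //= mulrDr -/(T N) IHN /S big_nat_recr //= -/(S N).
  rewrite (_ : N.+1 + m = (N + m).+1)%N // addnS binS natrD exprS; ring.
have Sle N : S N <= (1 - y) ^- m.+1.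
  apply: (cvgn_ge (N := N) IH) => n Nn; apply: ler_sum_nat_widen => // i _ _.
  by rewrite mulr_ge0 ?exprn_ge0.
have Tcvg : cvgn T.
  apply: (@nondecreasing_bounded_cvgn _ _ ((1 - y)^-1 * (1 - y) ^- m.+1)).
    by move=> n; rewrite /T big_nat_recr //= lerDl mulr_ge0 ?exprn_ge0.
  move=> n; rewrite ler_pdivlMl ?subr_gt0 // TS.
  by rewrite (le_trans _ (Sle n)) // lerBlDr lerDl mulr_ge0 ?exprn_ge0.
have t0 : (fun N => 'C(N + m.+1, m.+1)%:R * y ^+ N) @ \oo --> (0 : R).
  exact: (cvg_series_cvg_0 Tcvg).
have t1 : (fun N => 'C(N + m, m.+1)%:R * y ^+ N) @ \oo --> (0 : R).
  apply: (squeeze_cvgr _ (cvg_cst (0 : R)) t0); near=> N.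
  rewrite mulr_ge0 ?exprn_ge0 //= ler_wpM2r ?exprn_ge0 // ler_nat.
  by apply: leq_bin2l; rewrite addnS.
have : (fun N => (1 - y)^-1 * (S N - 'C(N + m, m.+1)%:R * y ^+ N)) @ \oo --> (1 - y)^-1 * ((1 - y) ^- m.+1 - 0).
  by apply: cvgMl_tmp; apply: cvgB.
rewrite subr0 -invfM -exprS => h; apply: cvgn_ext h => N.
by rewrite -TS mulKf.
Unshelve. all: by end_near. Qed.

(** The case l = 0 is set apart because the sum over nu < l is then empty,
    whereas the empty word contributes 1. *)
Definition eulerian_poly {R : realType} (l : nat) (y : R) : R :=
  if l == 0%N then 1 else \sum_(0 <= nu < l) (eulerian l nu)%:R * y ^+ nu.

Lemma eulerian_polyE (R : realType) (l : nat) (y : R) :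
  eulerian_poly l y = \sum_(s : 'S_l) y ^+ descents s.
Proof.
rewrite /eulerian_poly; case: l => [|l] /=.
  rewrite (eq_bigr (fun=> 1)); first by rewrite sumr_const card_Sn.
  by move=> s _; have := descents_le s; rewrite leqn0 => /eqP ->.
rewrite big_mkord (eq_bigr (fun nu : 'I_l.+1 => \sum_(s : 'S_l.+1 | descents s == nu) y ^+ descents s)).
  rewrite (exchange_big_dep predT) //=; apply: eq_bigr => s _.
  have hs : (descents s < l.+1)%N by rewrite ltnS; exact: descents_le.
  by rewrite (big_pred1 (Ordinal hs)) // => i /=; rewrite eq_sym.
move=> nu _; rewrite (eq_bigr (fun=> y ^+ nu)); last by move=> s /eqP ->.
by rewrite sumr_const /eulerian cardsE mulr_natl.
Qed.

(** The closed form of the power series with coefficients c_j. *)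
Definition jump_series {R : realType} (l : nat) (y : R) : R :=
  y * (1 - y) ^- l * eulerian_poly l y.

(** With d the number of descents of a permutation of m+1 letters, this is the
    contribution of that permutation to the series of the c_(i+1) y^i for l =
    m+1.  The first d terms vanish, hence the factor y^d. *)
Lemma shifted_binomial_cvg (R : realType) (m d : nat) (y : R) : 0 <= y < 1 -> (d <= m)%N ->
  (fun N => \sum_(0 <= i < N) 'C(i + m - d, m)%:R * y ^+ i) @ \oo -->
  y ^+ d * (1 - y) ^- m.+1.
Proof.
move=> hy dm; apply: (cvgn_of_shift (d := d)).
have h := cvgn_scale (a := y ^+ d) (@negative_binomial_series_cvg R m y hy).
apply: cvgn_ext h => N /=.
rewrite [RHS](@big_cat_nat _ _ _ d) ?leq_addl //= [X in _ = X + _]big_nat_cond.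
rewrite [X in _ = X + _]big1 => [|i /andP[/andP[_ id] _]]; last first.
  by rewrite bin_small ?mul0r //; lia.
rewrite add0r -{2}[d]add0n big_addn addnK big_distrr; apply: eq_bigr => i _.
by rewrite /= exprD (_ : i + d + m - d = i + m)%N; [ring|lia].
Qed.

Lemma jump_series_cvg (R : realType) (l : nat) (y : R) : 0 <= y < 1 ->
  (fun N => \sum_(1 <= j < N.+1) (pow_jump l j)%:R * y ^+ j) @ \oo --> jump_series l y.
Proof.
move=> hy; rewrite /jump_series; case: l => [|l].
  rewrite expr0 invr1 mulr1 /eulerian_poly /= mulr1; apply: (cvgn_of_shift (d := 1)).
  have h : (fun=> y) @ \oo --> y by exact: cvg_cst.
  apply: cvgn_ext h => N /=.
  rewrite addn1 big_ltn // big_nat_cond big1 ?addr0 ?mul1r // => i /andP[/andP[h _] _].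
  by rewrite /pow_jump h !expn0 mul0r.
rewrite eulerian_polyE -mulrA big_distrr /= big_distrr /=.
suff : (fun N => \sum_(s : 'S_l.+1) (y * \sum_(0 <= i < N) 'C(i + l - descents s, l)%:R * y ^+ i))
   @ \oo --> \sum_(s : 'S_l.+1) y * ((1 - y) ^- l.+1 * y ^+ descents s).
  apply: cvgn_ext => N; rewrite big_add1 /=.
  under [LHS]eq_bigr do rewrite mulr_sumr.
  rewrite exchange_big /=; apply: eq_bigr => j _; rewrite pow_jumpE natr_sum big_distrl /=.
  by apply: eq_bigr => s _; rewrite exprS; ring.
apply: cvg_big => [|s _]; first exact: add_continuous.
apply: cvgMl_tmp; rewrite mulrC; apply: shifted_binomial_cvg => //.
exact: descents_le.
Qed.

Lemma jump_series_ge0 (R : realType) (l : nat) (y : R) : 0 <= y < 1 -> 0 <= jump_series l y.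
Proof.
move=> hy; apply: (cvgn_ge (N := 0%N) (@jump_series_cvg R l _ hy)) => n _.
by apply: sumr_ge0 => j _; rewrite mulr_ge0 ?exprn_ge0 //; case/andP: hy.
Qed.

Lemma pow_jump1 l : pow_jump l 1 = 1%N.
Proof. by rewrite /pow_jump exp1n. Qed.

(** Each term of the series is linear or higher in y, so that it is at most 2y
    times the term for y = 1/2.  As p^-k <= 1/2 for every prime, this bounds
    D_term uniformly in p. *)
Lemma jump_series_le (R : realType) (l : nat) (y : R) : 0 <= y <= 2^-1 ->
  jump_series l y <= 2 * y * jump_series l 2^-1.
Proof.
move=> /andP[y0 y1]; have h2 : 0 <= (2^-1 : R) < 1 by lra.
have hy : 0 <= y < 1 by rewrite y0 /=; lra.
have e := cvgn_scale (a := 2 * y) (@jump_series_cvg R l _ h2).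
apply: (ler_cvg_to (@jump_series_cvg R l _ hy) e); near=> N.
rewrite mulr_sumr big_nat_cond [leRHS]big_nat_cond; apply: ler_sum => j /andP[/andP[j0 _] _].
case: j j0 => // j _; rewrite [leRHS]mulrCA ler_wpM2l // exprS [_^-1 ^+ _]exprS.
rewrite mulrA [_ * y * _]mulrAC divff // mul1r ler_wpM2l // lerXn2r // nnegrE; lra.
Unshelve. all: by end_near. Qed.

(** Removing the first term y leaves terms at least quadratic in y, each at
    most (2y)^2 times the term for y = 1/2. *)
Lemma jump_series_sub_bounds (R : realType) (l : nat) (y : R) : 0 <= y <= 2^-1 ->
  0 <= jump_series l y - y <= 4 * y ^+ 2 * jump_series l 2^-1.
Proof.
move=> /andP[y0 y1]; have h2 : 0 <= (2^-1 : R) < 1 by lra.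
have hy : 0 <= y < 1 by rewrite y0 /=; lra.
have e1 : (fun N => \sum_(1 <= j < N.+1) (pow_jump l j)%:R * y ^+ j - y) @ \oo --> jump_series l y - y.
  by apply: cvgB; [exact: jump_series_cvg|exact: cvg_cst].
have split1 (N : nat) : (0 < N)%N -> \sum_(1 <= j < N.+1) (pow_jump l j)%:R * y ^+ j - y =
    \sum_(2 <= j < N.+1) (pow_jump l j)%:R * y ^+ j.
  by move=> N0; rewrite big_ltn // pow_jump1 mul1r expr1 addrC addKr.
apply/andP; split.
  apply: (cvgn_ge (N := 1%N) e1) => N N0; rewrite split1 //.
  by apply: sumr_ge0 => j _; rewrite mulr_ge0 ?exprn_ge0.
have e := cvgn_scale (a := 4 * y ^+ 2) (@jump_series_cvg R l _ h2).
apply: (ler_cvg_to e1 e); near=> N.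
have N0 : (0 < N)%N by near: N; exists 1%N.
rewrite split1 // (@le_trans _ _ (4 * y ^+ 2 * \sum_(2 <= j < N.+1) (pow_jump l j)%:R * 2^-1 ^+ j)) //; last first.
  rewrite ler_wpM2l ?mulr_ge0 ?exprn_ge0 // [leRHS]big_ltn // lerDr mulr_ge0 ?exprn_ge0 //; lra.
rewrite mulr_sumr big_nat_cond [leRHS]big_nat_cond; apply: ler_sum => j /andP[/andP[j0 _] _].
case: j j0 => // -[//|j] _; rewrite [leRHS]mulrCA ler_wpM2l //.
rewrite (_ : j.+2 = 2 + j)%N // !exprD mulrA exprVn.
rewrite (_ : 4 * y ^+ 2 / 2 ^+ 2 = y ^+ 2); last by field.
rewrite ler_wpM2l ?exprn_ge0 // lerXn2r // nnegrE; lra.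
Unshelve. all: by end_near. Qed.

Lemma eulerian_sumE (R : realType) (l k p : nat) :
  eulerian_sum l k p = eulerian_poly l (p%:R ^- k) :> R.
Proof.
rewrite /eulerian_sum /eulerian_poly; case: eqP => // _; apply: eq_bigr => nu _.
by rewrite mulnC exprM -exprVn.
Qed.

Lemma D_termE (R : realType) (l k p : nat) : prime p -> (0 < k)%N ->
  D_term l k p = p%:R * jump_series l (p%:R ^- k) :> R.
Proof.
move=> pp k0; rewrite /D_term /jump_series eulerian_sumE !mulrA.
congr (_ * _ * _); case: k k0 => // k _.
by rewrite subn1 /= exprS invfM mulrA divff ?mul1r // pnatr_eq0 -lt0n prime_gt0.
Qed.

Lemma eulerian_poly1 (R : realType) (y : R) : eulerian_poly 1 y = 1.
Proof.
rewrite eulerian_polyE (eq_bigr (fun=> 1)); first by rewrite sumr_const card_Sn.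
by move=> s _; have := descents_le s; rewrite leqn0 => /eqP ->.
Qed.

(** * Partial sums of the logarithmic series *)

Lemma ln1B_poly_MVT (R : realType) (p : {poly R}) (z : R) : 0 < z < 1 ->
  exists2 c, 0 < c < z &
  - ln (1 - z) - p.[z] + p.[0] = ((1 - c)^-1 - p^`().[c]) * z.
Proof.
move=> /andP[z0 z1].
pose f (t : R) := - ln (1 - t) - p.[t].
pose df (t : R) := (1 - t)^-1 - p^`().[t].
have dfE (t : R) : t < 1 -> is_derive t 1 f (df t).
  move=> t1; have h : 0 < 1 - t by rewrite subr_gt0.
  have dl : is_derive (1 - t) 1 (@ln R) (1 - t)^-1 by exact: is_derive1_ln.
  have d1 : is_derive t 1 (fun t : R => 1 - t) (0 - 1) by apply: is_deriveB.
  have dp := is_derive_poly p t.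
  have dc : is_derive t 1 (@ln R \o (fun t : R => 1 - t)) ((1 - t)^-1 * (0 - 1)) by apply: is_derive1_comp.
  have -> : df t = - ((1 - t)^-1 * (0 - 1)) - p^`().[t] by rewrite /df sub0r mulrN1 opprK.
  exact: is_deriveB.
have [c cz e] : exists2 c, c \in `]0, z[%R & f z - f 0 = df c * (z - 0).
  apply: MVT => //.
    by move=> x; rewrite in_itv /= => /andP[_ xz]; apply: dfE; apply: lt_trans z1.
  apply: continuous_in_subspaceT => x; rewrite inE /= in_itv /= => /andP[_ xz].
  apply: differentiable_continuous; apply/derivable1_diffP.
  by have [] := dfE x (le_lt_trans xz z1).
exists c; first by rewrite in_itv in cz.
by move: e; rewrite /f /df !subr0 ln1; lra.
Qed.

(** The remainder -log(1-t) - sum of t^m/m has derivative t^M/(1-t).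
    Subtracting K t^(M+1) turns it into t^M (1/(1-t) - K (M+1)), which is
    nonnegative for K = 0 and, with K = 1/((M+1)(1-z)), nonpositive on
    [0,z]. *)
Lemma ln1B_bounds (R : realType) (M : nat) (z : R) : 0 <= z < 1 ->
  \sum_(1 <= m < M.+1) z ^+ m / m%:R <= - ln (1 - z)
    <= \sum_(1 <= m < M.+1) z ^+ m / m%:R + z ^+ M.+1 / (M.+1%:R * (1 - z)).
Proof.
move=> /andP[z0 z1].
have [->|zn0] := eqVneq z 0.
  rewrite subr0 ln1 oppr0 expr0n mul0r addr0 big_nat_cond big1 ?lexx //.
  by move=> i /andP[/andP[i0 _] _]; rewrite expr0n gtn_eqF // mul0r.
have zp : 0 < z by rewrite lt_neqAle eq_sym zn0.
pose p (K : R) : {poly R} := \sum_(1 <= m < M.+1) m%:R^-1 *: 'X^m + K *: ('X^(M.+1)).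
have pE K t : (p K).[t] = \sum_(1 <= m < M.+1) t ^+ m / m%:R + K * t ^+ M.+1.
  rewrite /p hornerD hornerZ hornerXn horner_sum; congr (_ + _).
  by apply: eq_bigr => m _; rewrite hornerZ hornerXn mulrC.
have p0 K : (p K).[0] = 0.
  rewrite pE expr0n mulr0 addr0 big_nat_cond big1 //.
  by move=> i /andP[/andP[i0 _] _]; rewrite expr0n gtn_eqF // mul0r.
have dpE K t : (p K)^`().[t] = \sum_(0 <= m < M) t ^+ m + K * M.+1%:R * t ^+ M.
  rewrite /p derivD derivZ derivXn hornerD hornerZ hornerMn hornerXn /=.
  rewrite raddf_sum horner_sum big_add1 /=; congr (_ + _); last by rewrite -[t ^+ M *+ _]mulr_natr mulrA mulrAC.
  apply: eq_bigr => m _; rewrite derivZ derivXn hornerZ hornerMn hornerXn /=.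
  by rewrite -[t ^+ m *+ _]mulr_natr mulrCA mulVf ?mulr1 ?pnatr_eq0.
have geo (t : R) : t < 1 -> (1 - t)^-1 - \sum_(0 <= m < M) t ^+ m = t ^+ M / (1 - t).
  move=> t1; have t1' : 1 - t != 0 by rewrite subr_eq0 gt_eqF.
  apply: (mulIf t1'); rewrite mulrBl mulVf // mulfVK //.
  by rewrite big_mkord -[1 - t]opprB mulrN opprK mulrC -subrX1 addrC subrK.
have main K : exists2 c, 0 < c < z & - ln (1 - z) - (\sum_(1 <= m < M.+1) z ^+ m / m%:R + K * z ^+ M.+1) = c ^+ M * ((1 - c)^-1 - K * M.+1%:R) * z.
  have [|c hc e] := @ln1B_poly_MVT R (p K) z; first by rewrite zp z1.
  exists c => //; have c1 : c < 1 by case/andP: hc => _ /lt_trans; apply.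
  move: e; rewrite p0 addr0 pE => ->; congr (_ * _).
  by rewrite dpE opprD addrA geo //; ring.
apply/andP; split.
  have [c /andP[c0 cz] e] := main 0; rewrite -subr_ge0.
  have -> : - ln (1 - z) - \sum_(1 <= m < M.+1) z ^+ m / m%:R = c ^+ M * ((1 - c)^-1 - 0 * M.+1%:R) * z.
    by rewrite -e mul0r addr0.
  rewrite mul0r subr0 !mulr_ge0 ?exprn_ge0 ?invr_ge0 ?subr_ge0 ?(ltW c0) //.
  by rewrite ltW // (lt_trans cz).
have [c /andP[c0 cz] e] := main (M.+1%:R * (1 - z))^-1; rewrite -subr_le0 [z ^+ M.+1 / _]mulrC e.
rewrite -mulrA mulr_ge0_le0 ?exprn_ge0 ?(ltW c0) //.
rewrite mulr_le0_ge0 // subr_le0 invfM mulrAC mulVf ?pnatr_eq0 // mul1r.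
by rewrite lef_pV2 ?posrE ?subr_gt0 ?(lt_trans cz) // lerD2l lerN2 ltW.
Qed.

(** * Chebyshev's bound and Mertens' theorems *)

Lemma dvdn_prod_primes (a b n : nat) :
  (forall p, (a <= p < b)%N -> prime p -> (p %| n)%N) ->
  (\prod_(a <= p < b | prime p) p %| n)%N.
Proof.
elim: b => [|b IH] h; first by rewrite big_geq // dvd1n.
have [ab|ba] := leqP a b; last by rewrite big_geq // dvd1n.
rewrite big_mkcond big_nat_recr //= -big_mkcond /=.
have IH' : (\prod_(a <= p < b | prime p) p %| n)%N.
  by apply: IH => p /andP[ap pb]; apply: h; rewrite ap ltnW.
case: ifP => pb; last by rewrite muln1.
rewrite Gauss_dvd ?IH' ?h ?ab ?leqnn // coprime_sym big_nat_cond.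
apply: (big_ind (fun x => coprime b x)) => [|x y cx cy|p /andP[/andP[_ pb'] pp]].
- exact: coprimen1.
- by rewrite coprimeMr cx.
- by rewrite prime_coprime // dvdn_prime2 // gtn_eqF.
Qed.

Lemma prime_dvd_fact p n : prime p -> (p %| n`!)%N = (p <= n)%N.
Proof.
move=> pp; apply/idP/idP => [|pn]; last by rewrite dvdn_fact // prime_gt0.
elim: n => [|n IH]; first by rewrite fact0 dvdn1; case: p pp => [|[]].
by rewrite factS Euclid_dvdM // => /orP[/dvdn_leq -> //|/IH /leqW].
Qed.

(** C(2m+1,m) and C(2m+1,m+1) are equal, and both occur in the expansion of
    (1+1)^(2m+1). *)
Lemma central_bin_le m : ('C(m.*2.+1, m) <= 4 ^ m)%N.
Proof.
have h : ('C(m.*2.+1, m) + 'C(m.*2.+1, m.+1) <= 2 ^ m.*2.+1)%N.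
  rewrite -[2%N]/(1 + 1)%N expnDn.
  have h1 : (m < m.*2.+2)%N by lia.
  have h2 : (m.+1 < m.*2.+2)%N by lia.
  rewrite (bigD1 (Ordinal h1)) // (bigD1 (Ordinal h2)) //=.
    by rewrite !exp1n !muln1 addnA leq_addr.
  by apply/eqP => /(congr1 val) /=; lia.
have e : 'C(m.*2.+1, m.+1) = 'C(m.*2.+1, m).
  by rewrite -bin_sub; [congr binomial; lia|lia].
move: h; rewrite e addnn -mul2n expnS leq_pmul2l // => h.
by rewrite (leq_trans h) // -mul2n expnM.
Qed.

(** Erdos's argument: the primes in (m+1, 2m+1] all divide C(2m+1,m) <= 4^m,
    and the primes up to m+1 are dealt with by induction. *)
Lemma primorial_le n : (\prod_(0 <= p < n.+1 | prime p) p <= 4 ^ n)%N.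
Proof.
elim/ltn_ind: n => n IH.
have [n2|n2] := leqP n 2.
  move: n n2 {IH} => [|[|[|//]]] _; rewrite unlock //.
have [on|en] := boolP (odd n); last first.
  rewrite big_mkcond big_nat_recr //= -big_mkcond /= ifN ?muln1; last first.
    by apply: contra en => pn; have [?|//] := even_prime pn; lia.
  by case: n n2 IH {en} => // n n2 IH; rewrite (leq_trans (IH n _)) // leq_pexp2l.
have nE : n = n./2.*2.+1 by lia.
set m := n./2 in nE; rewrite nE in n2 IH *.
have m0 : (0 < m)%N by lia.
rewrite (@big_cat_nat _ _ _ m.+2) //=; last by lia.
rewrite (_ : 4 ^ m.*2.+1 = 4 ^ m.+1 * 4 ^ m)%N; last by rewrite -expnD; congr expn; lia.
apply: leq_mul; first by apply: IH; lia.
apply: leq_trans (central_bin_le m); apply: dvdn_leq; first by rewrite bin_gt0; lia.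
apply: dvdn_prod_primes => p /andP[mp pm] pp.
have : (p %| (m.*2.+1)`!)%N by rewrite prime_dvd_fact.
rewrite -(@bin_fact m.*2.+1 m); last by lia.
rewrite Euclid_dvdM // => /orP[//|]; rewrite Euclid_dvdM // !prime_dvd_fact //.
by lia.
Qed.

Lemma ln_prod_nat (R : realType) (I : Type) (r : seq I) (P : pred I) (F : I -> nat) :
  (forall i, P i -> (0 < F i)%N) ->
  ln (\prod_(i <- r | P i) F i)%N%:R = \sum_(i <- r | P i) ln (F i)%:R :> R.
Proof.
move=> F0; suff [] : (0 < \prod_(i <- r | P i) F i)%N /\
  ln (\prod_(i <- r | P i) F i)%N%:R = \sum_(i <- r | P i) ln (F i)%:R :> R by [].
apply: (big_rec2 (fun (x : nat) (y : R) => (0 < x)%N /\ ln x%:R = y)) => [|i x y Pi [x0 <-]].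
  by rewrite ln1.
by rewrite muln_gt0 F0 // natrM lnM ?posrE ?ltr0n ?F0.
Qed.

Lemma theta_le (R : realType) (n : nat) :
  \sum_(0 <= p < n.+1 | prime p) ln p%:R <= n%:R * ln 4 :> R.
Proof.
rewrite -ln_prod_nat => [|p]; last exact: prime_gt0.
rewrite mulr_natl -lnXn // ler_ln ?posrE ?exprn_gt0 //.
  by rewrite -natrX ler_nat primorial_le.
rewrite ltr0n big_seq_cond prodn_cond_gt0 // => p /andP[_]; exact: prime_gt0.
Qed.

Lemma ler_ln_nat (R : realType) (a b : nat) : (0 < a)%N -> (a <= b)%N -> ln a%:R <= ln b%:R :> R.
Proof. by move=> a0 ab; rewrite ler_ln ?posrE ?ltr0n ?ler_nat // (leq_trans a0). Qed.

Lemma isqrt_exists n : exists m, (m * m <= n < m.+1 * m.+1)%N.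
Proof.
elim: n => [|n [m /andP[h1 h2]]]; first by exists 0%N.
have [h|h] := ltnP n.+1 (m.+1 * m.+1)%N; first by exists m; rewrite h; lia.
by exists m.+1; rewrite h /=; lia.
Qed.

(** The primes are cut at m, the integer square root of n.  There are at most m
    primes up to m, and log n <= 2 log (m+1) <= 2m; a prime p > m satisfies log
    n <= 2 log p, so that the sum of the log p bounds their number. *)
Lemma chebyshev_upper (R : realType) (n : nat) : (1 < n)%N ->
  (\sum_(0 <= p < n.+1 | prime p) 1) * ln n%:R <= (2 + 2 * ln 4) * n%:R :> R.
Proof.
move=> n1; have [m /andP[mn nm]] := isqrt_exists n.
have m0 : (0 < m)%N by case: m mn nm => // _; lia.
have mn' : (m <= n)%N by rewrite (leq_trans _ mn) // leq_pmull.
have lnn : 0 < ln n%:R :> R by rewrite ln_gt0 // ltr1n.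
rewrite (@big_cat_nat _ _ _ m.+1) //= mulrDl mulrDl; apply: lerD.
  apply: (@le_trans _ _ (m%:R * (2 * m%:R))); last first.
    by rewrite mulrCA ler_wpM2l // -natrM ler_nat.
  apply: ler_pM => //; [by apply: sumr_ge0|exact: ltW| |].
    rewrite big_mkcond big_ltn //= add0r (@le_trans _ _ (\sum_(1 <= i < m.+1) 1)) //.
      by apply: ler_sum => i _; case: ifP.
    by rewrite sumr_const_nat subSS subn0.
  rewrite (@le_trans _ _ (ln (m.+1%:R ^+ 2))) //.
    by rewrite -natrX ler_ln_nat; lia.
  rewrite lnXn // -[X in X <= _]mulr_natl ler_wpM2l // -natr1 addrC le_ln1Dx //.
  by rewrite (lt_le_trans (ltrN10 _)).
rewrite -mulrA (mulrC (ln 4)) (le_trans _ (ler_wpM2l _ (theta_le R n))) //.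
rewrite mulr_suml mulr_sumr (@le_trans _ _ (\sum_(m.+1 <= i < n.+1 | prime i) 2 * ln i%:R)) //; last first.
  rewrite [leRHS](@big_cat_nat _ _ _ m.+1) //= lerDr; apply: sumr_ge0 => p pp.
  by rewrite mulr_ge0 // ln_ge0 // ler1n prime_gt0.
rewrite big_nat_cond [leRHS]big_nat_cond; apply: ler_sum => p /andP[/andP[mp _] pp].
by rewrite mul1r mulr_natl -lnXn ?ltr0n ?prime_gt0 // -natrX ler_ln_nat; nia.
Qed.

Lemma ln_fact_primes (R : realType) (n : nat) :
  ln n`!%:R = \sum_(0 <= p < n.+1 | prime p) (logn p n`!)%:R * ln p%:R :> R.
Proof.
have nfact : (n <= n`!)%N by exact: fact_geq.
rewrite -{1}(partnT (fact_gt0 n)) (@widen_partn n`!) //.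
rewrite (@big_cat_nat _ _ _ n.+1) //= [X in (_ * X)%N]big_nat_cond [X in (_ * X)%N]big1 ?muln1.
  rewrite (bigID prime) /= [X in (_ * X)%N]big1 ?muln1 => [|p np]; last first.
    by rewrite lognE (negbTE np).
  rewrite (@ln_prod_nat R) => [|p pp]; last by rewrite expn_gt0 prime_gt0.
  by apply: eq_bigr => p pp; rewrite natrX lnXn ?ltr0n ?prime_gt0 // mulr_natl.
move=> p /andP[/andP[np _] _]; rewrite lognE; case: (boolP (prime p)) => //= pp.
by rewrite fact_gt0 /= prime_dvd_fact // leqNgt np.
Qed.

(** The weak form of Stirling's lower bound that reads n^n/n! <= e^n: the left
    side is one term of the exponential series. *)
Lemma ln_fact_ge (R : realType) (n : nat) : (0 < n)%N ->
  n%:R * ln n%:R - n%:R <= ln n`!%:R :> R.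
Proof.
case: n => // n _; have := @expR_ge1Dxn R n.+1%:R n (ler0n _ _).
move=> h; have {}h : n.+1%:R ^+ n.+1 / n.+1`!%:R <= expR n.+1%:R :> R.
  by apply: le_trans h; rewrite lerDr.
have f0 : 0 < n.+1`!%:R :> R by rewrite ltr0n fact_gt0.
move: h; rewrite -ler_ln ?posrE ?expR_gt0 ?divr_gt0 ?exprn_gt0 //.
rewrite expRK ln_div ?posrE ?exprn_gt0 // lnXn // -mulr_natl; lra.
Qed.

Lemma ln_fact_le (R : realType) (n : nat) : ln n`!%:R <= n%:R * ln n%:R :> R.
Proof.
case: n => [|n]; first by rewrite fact0 ln1 mul0r.
rewrite mulr_natl -lnXn // -natrX ler_ln_nat ?fact_gt0 //.
rewrite fact_prod (leq_trans (n := \prod_(1 <= i < n.+2) n.+1)%N) //.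
  by rewrite big_nat_cond [leqRHS]big_nat_cond leq_prod // => i /andP[/andP[_ h] _].
by rewrite prod_nat_const_nat subn1.
Qed.

Lemma lnS_sub_bounds (R : realType) (q : nat) : (0 < q)%N ->
  q.+1%:R^-1 <= ln q.+1%:R - ln (q%:R : R) <= q%:R^-1.
Proof.
move=> q0; have q0' : 0 < q%:R :> R by rewrite ltr0n.
rewrite -ln_div ?posrE ?ltr0n //; apply/andP; split.
  rewrite -[leRHS]opprK -lnV ?posrE ?divr_gt0 ?ltr0n // invf_div lerNr.
  have -> : q%:R / q.+1%:R = 1 + (- q.+1%:R^-1) :> R.
    by rewrite -natr1; field; rewrite natr1 pnatr_eq0.
  rewrite le_ln1Dx // ltrN2 invf_lt1 ?ltr0n // ltr1n; lia.
have -> : q.+1%:R / q%:R = 1 + q%:R^-1 :> R by rewrite -natr1; field; rewrite gt_eqF.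
by rewrite le_ln1Dx // (lt_trans (ltrN10 _)) // invr_gt0.
Qed.

(** The discrete version of the fact that -(log t + 1)/t is a primitive of (log
    t)/t^2; the constant 2 in place of 1 absorbs the discretisation. *)
Lemma sum_ln_over_square_le (R : realType) (n : nat) :
  \sum_(2 <= p < n.+1) ln p%:R / (p%:R * (p%:R - 1)) <= 2 :> R.
Proof.
pose f (p : nat) : R := (ln p.-1%:R + 2) / p.-1%:R.
have f0 p : 0 <= f p.
  case: p => [|[|p]]; rewrite /f ?invr0 ?mulr0 //=.
  by rewrite divr_ge0 // addr_ge0 // ln_ge0 // ler1n.
have [n1|n1] := leqP 2 n.+1; last by rewrite big_geq // ltnW.
apply: (@le_trans _ _ (f 2%N - f n.+1)); last first.
  have -> : f 2%N = 2 by rewrite /f /= ln1 divr1 add0r.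
  by rewrite lerBlDr lerDl; exact: f0.
apply: ler_sum_telescope => // -[//|[//|q]] _; rewrite /f /=.
have /andP[_] := @lnS_sub_bounds R q.+1 isT.
set a := ln q.+1%:R; set b := ln q.+2%:R => hab.
have q0 : 1 <= q.+1%:R :> R by rewrite ler1n.
have {}hab : (b - a) * q.+1%:R <= 1 by rewrite -ler_pdivlMr ?div1r ?ltr0n.
rewrite -[q.+2%:R]natr1; set t := q.+1%:R in q0 hab *.
rewrite -subr_ge0.
have -> : (a + 2) / t - (b + 2) / (t + 1) - b / ((t + 1) * (t + 1 - 1)) =
  (2 - (b - a) * t - (b - a)) / (t * (t + 1)).
  by field; rewrite !gt_eqF //; lra.
rewrite divr_ge0 //; last by nra.
suff : b - a <= 1 by nra.
have [ba|/ltW ba] := lerP 0 (b - a); last by lra.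
by rewrite (le_trans _ hab) // ler_peMr.
Qed.

Lemma natr_divn_le (R : realType) (n d : nat) : (0 < d)%N ->
  (n %/ d)%:R <= n%:R / d%:R :> R.
Proof. by move=> d0; rewrite ler_pdivlMr ?ltr0n // -natrM ler_nat leq_divM. Qed.

Lemma natr_divn_gt (R : realType) (n d : nat) : (0 < d)%N ->
  n%:R / d%:R < (n %/ d)%:R + 1 :> R.
Proof.
by move=> d0; rewrite ltr_pdivrMr ?ltr0n // natr1 -natrM ltr_nat ltn_ceil.
Qed.

Lemma logn_fact_lower (R : realType) (p n : nat) : prime p ->
  n%:R / p%:R - 1 <= (logn p n`!)%:R :> R.
Proof.
move=> pp; case: n => [|n]; first by rewrite mul0r sub0r (le_trans (lerN10 _)).
rewrite lerBlDr (le_trans (ltW (@natr_divn_gt R n.+1 p (prime_gt0 pp)))) // lerD2r ler_nat.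
by rewrite logn_fact // big_ltn // expn1 leq_addr.
Qed.

Lemma logn_fact_upper (R : realType) (p n : nat) : prime p ->
  (logn p n`!)%:R <= n%:R / (p%:R - 1) :> R.
Proof.
move=> pp; rewrite logn_fact // natr_sum.
have p1 : 1 < p%:R :> R by rewrite ltr1n prime_gt1.
pose f k : R := n%:R / (p%:R - 1) * p%:R^-1 ^+ k.-1.
apply: (@le_trans _ _ (f 1%N - f n.+1)); last first.
  have -> : f 1%N = n%:R / (p%:R - 1) by rewrite /f expr0 mulr1.
  by rewrite lerBlDr lerDl mulr_ge0 ?exprn_ge0 ?invr_ge0 // divr_ge0 // subr_ge0 ltW.
apply: ler_sum_telescope => // k /andP[k0 _]; case: k k0 => // k _.
rewrite (le_trans (@natr_divn_le R _ _ _)) ?expn_gt0 ?prime_gt0 // natrX.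
rewrite /f /= -[X in X <= _]mulr1 -exprVn exprSr le_eqVlt; apply/orP; left; apply/eqP.
by field; rewrite !gt_eqF //; lra.
Qed.

(** log n! is the sum of v_p(n!) log p, and v_p(n!) >= n/p - 1.  The terms -log
    p cost at most n log 4. *)
Lemma mertens_first_upper (R : realType) (n : nat) : (0 < n)%N ->
  \sum_(0 <= p < n.+1 | prime p) ln p%:R / p%:R <= ln n%:R + ln 4 :> R.
Proof.
move=> n0; have n0' : 0 < n%:R :> R by rewrite ltr0n.
rewrite -(ler_pM2l n0') mulrDr.
have h : \sum_(0 <= p < n.+1 | prime p) (n%:R / p%:R - 1) * ln p%:R <= n%:R * ln n%:R :> R.
  apply: le_trans (ln_fact_le R n); rewrite ln_fact_primes; apply: ler_sum => p pp.
  by rewrite ler_wpM2r ?logn_fact_lower // ln_ge0 // ler1n prime_gt0.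
apply: le_trans (lerD h (theta_le R n)); rewrite -big_split /= mulr_sumr.
by apply: ler_sum => p _; lra.
Qed.

(** Legendre's formula gives v_p(n!) <= n/(p-1) = n/p + n/(p(p-1)).  Of the 3
    lost, 1 comes from Stirling's bound and 2 from the sum of the log
    p/(p(p-1)). *)
Lemma mertens_first_lower (R : realType) (n : nat) : (0 < n)%N ->
  ln n%:R - 3 <= \sum_(0 <= p < n.+1 | prime p) ln p%:R / p%:R :> R.
Proof.
move=> n0; have n0' : 0 < n%:R :> R by rewrite ltr0n.
rewrite -(ler_pM2l n0').
have h : n%:R * ln n%:R - n%:R <= \sum_(0 <= p < n.+1 | prime p) n%:R / (p%:R - 1) * ln p%:R :> R.
  apply: le_trans (ln_fact_ge R n0) _; rewrite ln_fact_primes; apply: ler_sum => p pp.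
  by rewrite ler_wpM2r ?logn_fact_upper // ln_ge0 // ler1n prime_gt0.
have e : \sum_(0 <= p < n.+1 | prime p) n%:R / (p%:R - 1) * ln p%:R =
   n%:R * (\sum_(0 <= p < n.+1 | prime p) ln p%:R / p%:R +
    \sum_(0 <= p < n.+1 | prime p) ln p%:R / (p%:R * (p%:R - 1))) :> R.
  rewrite -big_split mulr_sumr /=; apply: eq_bigr => p pp.
  have p1 : 1 < p%:R :> R by rewrite ltr1n prime_gt1.
  by field; rewrite !gt_eqF //; lra.
have s2 : \sum_(0 <= p < n.+1 | prime p) ln p%:R / (p%:R * (p%:R - 1)) <= 2 :> R.
  apply: le_trans (sum_ln_over_square_le R n).
  rewrite big_mkcond big_ltn //= add0r; case: n {n0 n0' h e} => [|n]; first by rewrite !big_geq.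
  rewrite big_ltn //= add0r; apply: ler_sum_nat => p /andP[p2 _]; case: ifP => // _.
  have p1 : 1 < p%:R :> R by rewrite ltr1n.
  rewrite divr_ge0 ?ln_ge0 ?mulr_ge0 ?subr_ge0 //; exact: ltW.
move: h; rewrite e; nra.
Qed.

(** The sequence v - d increases and v + d decreases, so both converge to the
    same limit, and v stays within d of it.  This gives explicit error bounds
    for constants that are defined only as limits. *)
Lemma cvgn_of_telescoping_dist (R : realType) (v d : R^nat) :
  (forall n, 0 <= d n) -> d @ \oo --> (0 : R) ->
  (forall n, `|v n.+1 - v n| <= d n - d n.+1) ->
  exists l, forall n, `|v n - l| <= d n.
Proof.
move=> d0 dcvg h.
have Uni n : v n.+1 + d n.+1 <= v n + d n.
  by have := h n; rewrite ler_norml => /andP[]; lra.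
have Lnd n : v n - d n <= v n.+1 - d n.+1.
  by have := h n; rewrite ler_norml => /andP[]; lra.
have Lmono m n : (m <= n)%N -> v m - d m <= v n - d n.
  by move=> mn; apply: (@homo_leq _ (fun n => v n - d n) <=%R) mn => //; exact: le_trans.
have Umono m n : (m <= n)%N -> v n + d n <= v m + d m.
  move=> mn; apply: (@homo_leq _ (fun n => v n + d n) (fun x y => y <= x)) mn => //.
  by move=> x y z /[swap]; exact: le_trans.
have Lb n : v n - d n <= v 0%N + d 0%N.
  by apply: le_trans (Umono 0%N n (leq0n n)); have := d0 n; lra.
have Lcvg : cvgn (fun n => v n - d n).
  exact: (nondecreasing_bounded_cvgn Lnd Lb).
exists (limn (fun n => v n - d n)) => n.
have l1 : v n - d n <= limn (fun n => v n - d n).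
  by apply: (cvgn_ge (N := n) Lcvg) => m nm; exact: Lmono.
have l2 : limn (fun n => v n - d n) <= v n + d n.
  apply: (cvgn_le (N := n) Lcvg) => m nm; apply: le_trans (Umono _ _ nm).
  by have := d0 m; lra.
by rewrite ler_norml; apply/andP; split; lra.
Qed.

Lemma inv_ln_natr_small (R : realType) (e : R) : 0 < e -> exists N, forall n, (N <= n)%N -> (ln n%:R)^-1 <= e.
Proof.
move=> e0; have [N hN] : exists N : nat, expR e^-1 <= N%:R.
  by exists (Num.truncn (expR e^-1)).+1; exact: ltW (truncnS_gt _).
exists N => n Nn; rewrite invf_ple ?posrE //.
  rewrite -[e^-1]expRK ler_ln ?posrE ?expR_gt0 //.
    by rewrite (le_trans hN) // ler_nat.
  by rewrite (lt_le_trans (expR_gt0 e^-1)) // (le_trans hN) // ler_nat.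
rewrite ln_gt0 // (lt_le_trans _ (le_trans hN _)) ?ler_nat //.
by rewrite expR_gt1 invr_gt0.
Qed.

(** Partial summation from Mertens' first theorem, written without integrals:
    with S the sum of 1/p and A the sum of (log p)/p, the sequence S - log log
    n - A/log n converges and its increments are dominated by those of 4/log n.
    The constant 7 is 4 plus the bound 3 for A - log n. *)
Lemma mertens_second (R : realType) : exists B : R, forall n, (1 < n)%N ->
  `|\sum_(0 <= p < n.+1 | prime p) p%:R^-1 - ln (ln n%:R) - B| <= 7 / ln n%:R.
Proof.
pose S (n : nat) : R := \sum_(0 <= p < n.+1 | prime p) p%:R^-1.
pose A (n : nat) : R := \sum_(0 <= p < n.+1 | prime p) ln p%:R / p%:R.
have lnp (n : nat) : 0 < ln n.+2%:R :> R by rewrite ln_gt0 // ltr1n.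
(* At a prime n+1, S grows by 1/(n+1) and A/log(n+1) by the same amount: the
   jumps cancel.  Since A/log n tends to 1, the summand 1 makes V have the
   limit B. *)
pose V (n : nat) : R := S n.+2 - ln (ln n.+2%:R) - A n.+2 / ln n.+2%:R + 1.
pose d (n : nat) : R := 4 / ln n.+2%:R.
have Abound n : `|A n.+2 - ln n.+2%:R| <= 3.
  rewrite ler_norml; apply/andP; split.
    by have := @mertens_first_lower R n.+2 isT; rewrite -/(A _); lra.
  have := @mertens_first_upper R n.+2 isT; rewrite -/(A _).
  have : ln 4 <= 3 :> R by rewrite (_ : 4 = 1 + 3) ?le_ln1Dx //; lra.
  lra.
have [|||B hB] := @cvgn_of_telescoping_dist R V d.
- by move=> n; rewrite divr_ge0 // ltW.
- apply/cvgn_eps => e e0; have e4 : 0 < e / 4 by lra.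
  have [N hN] := inv_ln_natr_small e4; exists N => n Nn.
  have := hN n.+2; rewrite /d subr0 ger0_norm ?divr_ge0 ?(ltW (lnp _)) // => /(_ _).
  by rewrite leqW ?leqW // => /(_ isT); lra.
- move=> n; rewrite /V /d.
  set a := ln n.+2%:R; set b := ln n.+3%:R.
  have a0 : 0 < a by exact: lnp.
  have /andP[ba1 ba2] := @lnS_sub_bounds R n.+2 isT; rewrite -/a -/b in ba1 ba2.
  have ab : a < b by rewrite -subr_gt0 (lt_le_trans _ ba1) // invr_gt0 ltr0n.
  have ba1' : b - a <= 1 by rewrite (le_trans ba2) // invf_le1 ?ler1n ?ltr0n.
  have b0 : 0 < b by exact: lt_trans ab.
  have -> : S n.+3 = S n.+2 + (A n.+3 - A n.+2) / b.
    rewrite /S /A big_prime_recr [X in (X - _) / b]big_prime_recr; congr (_ + _).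
    rewrite addrAC subrr add0r.
    case: ifP => _; last by rewrite mul0r.
    by rewrite -/b mulrAC mulfV ?mul1r // gt_eqF.
  (* Of the bound 4 (1/a - 1/b), 3 comes from the distance of A to log n and 1
     from comparing log b - log a with 1 - a/b. *)
  have e : S n.+2 + (A n.+3 - A n.+2) / b - ln b - A n.+3 / b + 1 -
      (S n.+2 - ln a - A n.+2 / a + 1) =
     (A n.+2 - a) * (a^-1 - b^-1) + (1 - a / b - (ln b - ln a)).
    by field; rewrite !gt_eqF.
  rewrite e -mulrBr; set i := a^-1 - b^-1.
  have i0 : 0 <= i by rewrite subr_ge0 lef_pV2 ?posrE // ltW.
  have t1 : `|(A n.+2 - a) * i| <= 3 * i by rewrite normrM (ger0_norm i0) ler_wpM2r.
  have hl1 : ln b - ln a <= b / a - 1.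
    by rewrite -ln_div ?posrE // ln_leB1 // divr_gt0.
  have hl2 : 1 - a / b <= ln b - ln a.
    have : ln a - ln b <= a / b - 1.
      by rewrite -ln_div ?posrE // ln_leB1 // divr_gt0.
    lra.
  have t2 : `|1 - a / b - (ln b - ln a)| <= i.
    rewrite ler_norml; apply/andP; split; last by lra.
    have e2 : b / a - 1 - (1 - a / b) = (b - a) * i.
      by rewrite /i; field; rewrite !gt_eqF.
    have : (b - a) * i <= i by rewrite ler_piMl.
    by rewrite -e2; lra.
  by rewrite (le_trans (ler_normD _ _)) //; lra.
exists B => -[|[|n]] // _; rewrite -/(S n.+2).
have := hB n; rewrite /V /d => h.
have -> : S n.+2 - ln (ln n.+2%:R) - B =
  (S n.+2 - ln (ln n.+2%:R) - A n.+2 / ln n.+2%:R + 1 - B) + (A n.+2 - ln n.+2%:R) / ln n.+2%:R.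
  by field; rewrite gt_eqF.
have -> : 7 / ln n.+2%:R = 4 / ln n.+2%:R + 3 / ln n.+2%:R :> R by rewrite -mulrDl; congr (_ * _); lra.
rewrite (le_trans (ler_normD _ _)) //.
apply: lerD => //; rewrite normrM [X in _ * X]ger0_norm ?invr_ge0 ?(ltW (lnp _)) //.
by rewrite ler_wpM2r // invr_ge0 ltW.
Qed.

(** * Euler's product *)

(** The natural numbers without prime factor below q; 0 counts as rough as
    well, since its list of primes is empty, which does no harm to functions
    vanishing at 0. *)
Definition rough (q n : nat) : bool := all (leq q) (primes n).

Lemma rough_small q n : (1 < n < q)%N -> ~~ rough q n.
Proof.
move=> /andP[n1 nq]; apply/negP => /allP /(_ (pdiv n)).
rewrite mem_primes pdiv_prime // pdiv_dvd /= (ltnW n1) => /(_ isT) h.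
have := pdiv_leq (ltnW n1); lia.
Qed.

Lemma rough_prime_step q n : prime q -> (0 < n)%N -> rough q.+1 n = rough q n && ~~ (q %| n)%N.
Proof.
move=> pq n0; apply/idP/andP => [/allP h|[/allP h qn]].
  split; first by apply/allP => p /h /ltnW.
  by apply/negP => qn; have := h q; rewrite mem_primes pq n0 qn ltnn => /(_ isT).
apply/allP => p hp; rewrite ltn_neqAle h // andbT.
by apply: contra qn => /eqP ->; move: hp; rewrite mem_primes => /and3P[].
Qed.

Lemma rough_nonprime_step q n : ~~ prime q -> rough q.+1 n = rough q n.
Proof.
move=> pq; apply/allP/allP => h p hp; first exact: ltnW (h p hp).
rewrite ltn_neqAle h // andbT.
by apply: contraNneq pq => ->; move: hp; rewrite mem_primes => /and3P[].
Qed.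

Lemma rough_mul_prime q m : prime q -> rough q (q * m)%N = rough q m.
Proof.
move=> pq; case: m => [|m]; first by rewrite muln0.
apply/allP/allP => h p; last first.
  rewrite primesM ?(prime_gt0 pq) // => /orP[|/h //].
  by rewrite primes_prime // inE => /eqP ->.
by move=> hp; apply: h; rewrite primesM ?(prime_gt0 pq) // hp orbT.
Qed.

Lemma sum_multiples (R : realType) (F : nat -> R) (P : pred nat) (q M : nat) : (0 < q)%N ->
  \sum_(0 <= n < q * M | P n && (q %| n)%N) F n = \sum_(0 <= m < M | P (q * m)%N) F (q * m)%N.
Proof.
move=> q0; elim: M => [|M IH]; first by rewrite muln0 !big_geq.
rewrite mulnS addnC (@big_cat_nat _ _ _ (q * M)%N) ?leq_addr //= IH.
rewrite [RHS]big_mkcond big_nat_recr //= -big_mkcond; congr (_ + _).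
rewrite big_mkcond big_ltn ?dvdn_mulr //= ?andbT; last by lia.
rewrite big_nat_cond big1 ?addr0 // => i /andP[/andP[h1 h2] _]; case: ifP => // /andP[_].
case/dvdnP => k e; move: h1 h2; rewrite e (mulnC k) -mulnSr !ltn_mul2l q0 /=; lia.
Qed.

(** Sieving: if L q is the sum of f over the q-rough integers, then complete
    multiplicativity gives L (q+1) = (1 - f q) L q at a prime q, whence log Z =
    (sum over p < q of -log(1 - f p)) + log (L q).  Apart from 1, a q-rough
    integer is at least q, so L q - 1 lies between 0 and the tail of the
    series. *)
Lemma euler_product_bounds (R : realType) (f : nat -> R) (Z : R) :
  f 0%N = 0 -> f 1%N = 1 -> (forall m n, f (m * n)%N = f m * f n) ->
  (forall n, 0 <= f n) -> (forall p, prime p -> f p < 1) ->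
  (fun N => \sum_(0 <= n < N) f n) @ \oo --> Z ->
  forall q, ln Z - (Z - \sum_(0 <= n < q) f n) <=
     \sum_(0 <= p < q | prime p) - ln (1 - f p) <= ln Z.
Proof.
move=> f0 f1 fM fge0 fp1 fZ.
pose W q N := \sum_(0 <= n < N | rough q n) f n.
have Wle q N : W q N <= Z.
  apply: (cvgn_ge (N := N) fZ) => n Nn.
  apply: (@le_trans _ _ (\sum_(0 <= n < N) f n)); last exact: ler_sum_nat_widen.
  by rewrite /W big_mkcond; apply: ler_sum => i _; case: ifP.
have Wcvg q : cvgn (W q).
  apply: (@nondecreasing_bounded_cvgn _ _ Z) => // n; exact: ler_sum_nat_widen.
pose L q := limn (W q).
have WL q : W q @ \oo --> L q by exact: Wcvg.
have Lprime q : prime q -> L q.+1 = (1 - f q) * L q.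
  move=> pq; have q0 := prime_gt0 pq.
  have sub r : (fun M => W r (q * M)%N) @ \oo --> L r.
    apply/cvgn_eps => e e0; have /cvgn_eps /(_ e e0) [N hN] := WL r.
    by exists N => n Nn; apply: hN; rewrite (leq_trans Nn) // leq_pmull.
  have e M : W q (q * M)%N = W q.+1 (q * M)%N + f q * W q M.
    rewrite {1}/W (bigID (fun n => q %| n)%N) /= addrC; congr (_ + _).
      rewrite /W big_mkcond [RHS]big_mkcond; apply: eq_bigr => -[|n] _.
        by rewrite f0 !if_same.
      by rewrite rough_prime_step.
    rewrite (sum_multiples f (rough q)) // mulr_sumr; apply: eq_big => m.
      exact: rough_mul_prime.
    by rewrite fM.
  have h : (fun M => W q.+1 (q * M)%N + f q * W q M) @ \oo --> L q.+1 + f q * L q.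
    by apply: cvgD; [exact: sub|exact: cvgn_scale].
  have h2 := cvgn_unique (sub q) (cvgn_ext (fun M => esym (e M)) h).
  by rewrite mulrBl mul1r {1}h2 addrK.
have Lnonprime q : ~~ prime q -> L q.+1 = L q.
  move=> pq; congr (limn _); apply/funext => N; apply: eq_bigl => n.
  exact: rough_nonprime_step.
have L0 : L 0%N = Z.
  by apply: cvgn_unique (WL 0%N) _; apply: cvgn_ext fZ => N; apply: eq_bigl => n; apply/esym/allP.
have Lge1 q : 1 <= L q.
  apply: (cvgn_ge (N := 2%N) (WL q)) => N N2.
  have : W q 2%N <= W q N by exact: ler_sum_nat_widen.
  by apply: le_trans; rewrite /W big_mkcond !big_nat_recl //= !big_geq // f0 f1 add0r addr0.
have Lle q : L q <= 1 + (Z - \sum_(0 <= n < q) f n).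
  apply: (cvgn_le (N := q) (WL q)) => N qN.
  rewrite /W (@big_cat_nat _ _ _ q) //=; apply: lerD.
    case: q {qN} => [|[|q]]; [by rewrite big_geq| |].
      by rewrite big_mkcond big_nat1 f0.
    rewrite big_mkcond big_ltn // big_ltn //= f0 f1 add0r -big_mkcond big_nat_cond big1 ?addr0 //.
    by move=> i /andP[/andP[h1 h2] /=]; rewrite (negbTE (rough_small _)) // h1.
  rewrite lerBrDr addrC; apply: (cvgn_ge (N := N) fZ) => n Nn.
  rewrite (@le_trans _ _ (\sum_(0 <= n < N) f n)) //; last exact: ler_sum_nat_widen.
  rewrite [leRHS](@big_cat_nat _ _ _ q) //= lerD2l big_mkcond; apply: ler_sum => i _.
  by case: ifP.
have main q : ln Z = \sum_(0 <= p < q | prime p) - ln (1 - f p) + ln (L q).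
  elim: q => [|q IH]; first by rewrite big_geq // add0r L0.
  rewrite IH big_prime_recr; case: (boolP (prime q)) => pq; last by rewrite addr0 Lnonprime.
  rewrite Lprime // lnM ?posrE ?subr_gt0 ?fp1 //; last exact: lt_le_trans (Lge1 q).
  ring.
move=> q; rewrite (main q); have h1 := ln_ge0 (Lge1 q).
have h2 := ln_leB1 (lt_le_trans ltr01 (Lge1 q)).
by have h3 := Lle q; apply/andP; split; lra.
Qed.

Lemma euler_product_cvg (R : realType) (f : nat -> R) (Z : R) :
  f 0%N = 0 -> f 1%N = 1 -> (forall m n, f (m * n)%N = f m * f n) ->
  (forall n, 0 <= f n) -> (forall p, prime p -> f p < 1) ->
  (fun N => \sum_(0 <= n < N) f n) @ \oo --> Z ->
  prime_partial_sum (fun p => - ln (1 - f p)) @ \oo --> ln Z.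
Proof.
move=> f0 f1 fM fge0 fp1 fZ.
have h : (fun q => ln Z - (Z - \sum_(0 <= n < q) f n)) @ \oo --> ln Z - (Z - Z).
  by apply: cvgB; [exact: cvg_cst|apply: cvgB => //; exact: cvg_cst].
rewrite subrr subr0 in h.
apply: (squeeze_cvgr _ h (cvg_cst (ln Z))); near=> q.
exact: euler_product_bounds.
Unshelve. all: by end_near. Qed.

(** * Euler's constant and zeta(1+d) near its pole *)

Definition harmonic_number {R : realType} (n : nat) : R := \sum_(1 <= i < n.+1) i%:R^-1.

(** The first two terms of the Euler-Maclaurin expansion of the harmonic
    numbers: the error sequence moves by less than the decrements of
    1/(2n^2). *)
Lemma euler_gamma_dist (R : realType) (n : nat) : (0 < n)%N ->
  `|harmonic_number n - ln n%:R - (2 * n%:R)^-1 - euler_gamma R| <= (2 * n%:R ^+ 2)^-1.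
Proof.
pose v (n : nat) : R := harmonic_number n.+1 - ln n.+1%:R - (2 * n.+1%:R)^-1.
pose d (n : nat) : R := (2 * n.+1%:R ^+ 2)^-1.
have inv0 : (fun n : nat => n.+1%:R^-1 : R) @ \oo --> (0 : R) by exact: cvg_harmonic.
have d0 : d @ \oo --> (0 : R).
  have -> : (0 : R) = 2^-1 * (0 * 0) by rewrite !mulr0.
  have : (fun n : nat => 2^-1 * (n.+1%:R^-1 * n.+1%:R^-1) : R) @ \oo --> 2^-1 * (0 * 0 : R).
    by apply: cvgn_scale; apply: cvgM.
  by apply: cvgn_ext => m; rewrite /d invfM expr2 invfM.
have [||l hl] := @cvgn_of_telescoping_dist R v d _ d0.
- by move=> m; rewrite /d invr_ge0 mulr_ge0 ?exprn_ge0.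
- move=> m; rewrite /v /d /harmonic_number [X in X - _ - _ - _]big_nat_recr //=.
  set H := \sum_(1 <= i < m.+2) _.
  set z : R := m.+2%:R^-1.
  have x0 : 0 < m.+1%:R :> R by rewrite ltr0n.
  have z01 : 0 <= z < 1 by rewrite invr_ge0 ler0n invf_lt1 ?ltr0n // ltr1n.
  have e1 : 1 - z = m.+1%:R / m.+2%:R.
    by rewrite /z -[m.+1%:R](addrK 1) natr1 mulrBl divff ?pnatr_eq0 // mul1r.
  have e2 : - ln (1 - z) = ln m.+2%:R - ln m.+1%:R.
    by rewrite e1 ln_div ?posrE ?ltr0n // opprB.
  have := ln1B_bounds 2 z01; rewrite e2 unlock /= expr1 divr1 addr0.
  (* In terms of z = 1/(m+2) the increment of v becomes a rational function of
     z plus log(1-z), and two terms of the logarithmic series suffice. *)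
  have e3 : m.+1%:R = z^-1 - 1 :> R by rewrite /z invrK -[m.+2%:R]natr1 addrK.
  have z0 : 0 < z by rewrite invr_gt0 ltr0n.
  have z1 : 0 < 1 - z by rewrite subr_gt0; case/andP: z01.
  have e4 : m.+2%:R = z^-1 :> R by rewrite /z invrK.
  set a := ln m.+1%:R; set b := ln m.+2%:R.
  rewrite e4 e3 => /andP[h1 h2].
  have k1 : (2 * (z^-1 - 1))^-1 = z / 2 + z ^+ 2 / 2 + z ^+ 3 / (2 * (1 - z)).
    field; rewrite !gt_eqF //=; lra.
  have k2 : (2 * (z^-1 - 1) ^+ 2)^-1 - (2 * z^-1 ^+ 2)^-1 = z ^+ 3 / (2 * (1 - z)) + z ^+ 3 / (2 * (1 - z) ^+ 2).
    field; rewrite !gt_eqF //=; lra.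
  rewrite k2 k1.
  have k3 : (2 * z^-1)^-1 = z / 2 by rewrite invfM invrK mulrC.
  rewrite k3.
  have k4 : z ^+ 3 / (3 * (1 - z)) = z ^+ 3 / (2 * (1 - z)) - z ^+ 3 / (6 * (1 - z)).
    by field; rewrite gt_eqF.
  have k5 : 0 <= z ^+ 3 / (6 * (1 - z)) by rewrite divr_ge0 ?exprn_ge0 ?mulr_ge0 // ltW.
  have k6 : 0 <= z ^+ 3 / (2 * (1 - z) ^+ 2) by rewrite divr_ge0 ?exprn_ge0 ?mulr_ge0 ?exprn_ge0 // ltW.
  have k7 : 0 <= z ^+ 3 / (2 * (1 - z)) by rewrite divr_ge0 ?exprn_ge0 ?mulr_ge0 // ltW.
  move: h2; rewrite k4 => h2.
  by rewrite ler_norml; apply/andP; split; lra.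
have vl : v @ \oo --> l.
  apply/cvgn_eps => e e0; have /cvgn_eps /(_ e e0) [N hN] := d0.
  exists N => m Nm; apply: le_trans (hl m) _.
  by have := hN m Nm; rewrite subr0; apply: le_trans; exact: ler_norm.
have -> : euler_gamma R = l.
  apply: cvgn_lim; apply: (cvgn_of_shift (d := 1%N)).
  have : (fun m => v m + 2^-1 * m.+1%:R^-1) @ \oo --> l + 2^-1 * (0 : R).
    by apply: cvgD => //; exact: cvgn_scale.
  rewrite mulr0 addr0; apply: cvgn_ext => m.
  by rewrite /v addn1 invfM subrK.
by case: n => // n _; exact: hl.
Qed.

Lemma powR_natE (R : realType) (n : nat) (x : R) : (0 < n)%N ->
  n%:R `^ x = expR (x * ln n%:R).
Proof. by move=> n0; rewrite /powR pnatr_eq0 gtn_eqF. Qed.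

(** The comparison of n^-(1+d) with its integral over [n,n+1], obtained from 1
    + t <= exp t at t = d (log (n+1) - log n) and its opposite. *)
Lemma powR_nat_step (R : realType) (d : R) (n : nat) : 0 < d -> (0 < n)%N ->
  n.+1%:R `^ (- (1 + d)) <= d^-1 * (n%:R `^ (- d) - n.+1%:R `^ (- d)) <= n%:R `^ (- (1 + d)).
Proof.
move=> d0 n0; have n0' : 0 < n%:R :> R by rewrite ltr0n.
have pE m : (0 < m)%N -> m%:R `^ (- (1 + d)) = m%:R^-1 * m%:R `^ (- d).
  move=> m0; rewrite !powR_natE // opprD mulrDl expRD mulN1r expRN lnK // posrE.
  by rewrite ltr0n.
rewrite !pE // !powR_natE //.
have /andP[l1 l2] := @lnS_sub_bounds R n n0.
set a := ln n%:R in l1 l2 *; set b := ln n.+1%:R in l1 l2 *.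
have ea : expR (- d * a) = expR (- d * b) * expR (d * (b - a)).
  by rewrite -expRD; congr expR; ring.
have eb : expR (- d * b) = expR (- d * a) * expR (- (d * (b - a))).
  by rewrite -expRD; congr expR; ring.
apply/andP; split; rewrite -(ler_pM2l d0) mulVKf ?gt_eqF //.
  rewrite ea mulrA [leRHS](_ : _ = (expR (d * (b - a)) - 1) * expR (- d * b)); last by ring.
  rewrite ler_wpM2r ?expR_ge0 // (le_trans (ler_wpM2l (ltW d0) l1)) //.
  by have := expR_ge1Dx (d * (b - a)); lra.
rewrite eb mulrA [leLHS](_ : _ = (1 - expR (- (d * (b - a)))) * expR (- d * a)); last by ring.
rewrite ler_wpM2r ?expR_ge0 // (le_trans _ (ler_wpM2l (ltW d0) l2)) //.
by have := expR_ge1Dx (- (d * (b - a))); lra.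
Qed.

Lemma powR_nat_cvg0 (R : realType) (d : R) : 0 < d ->
  (fun n : nat => n%:R `^ (- d)) @ \oo --> (0 : R).
Proof.
move=> d0; apply/cvgn_eps => e e0.
have [N hN] := inv_ln_natr_small (mulr_gt0 d0 e0); exists (maxn N 2) => n.
rewrite geq_max => /andP[Nn n2]; rewrite subr0 ger0_norm ?powR_ge0 // powR_natE; last by lia.
have l0 : 0 < ln n%:R :> R by rewrite ln_gt0 // ltr1n.
rewrite mulNr expRN invf_ple ?posrE ?expR_gt0 //.
apply: le_trans (_ : d * ln n%:R <= _); last by have := expR_ge1Dx (d * ln n%:R : R); lra.
by have := hN n Nn; rewrite invf_ple ?posrE ?mulr_gt0 // invfM -ler_pdivrMl // .
Qed.

(** Summing the previous comparison: the integral of t^-(1+d) from 1 to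
    infinity is 1/d. *)
Lemma zeta_bounds (R : realType) (d : R) : 0 < d ->
  exists Z, (fun N => \sum_(0 <= n < N) n%:R `^ (- (1 + d))) @ \oo --> Z /\
    d^-1 <= Z <= 1 + d^-1.
Proof.
move=> d0; pose f n : R := n%:R `^ (- (1 + d)).
pose T n : R := d^-1 * n%:R `^ (- d).
have T0 n : 0 <= T n by rewrite mulr_ge0 ?powR_ge0 // invr_ge0 ltW.
have T1 : T 1%N = d^-1 by rewrite /T powR1 mulr1.
have f0 : f 0%N = 0 by rewrite /f powR0 // oppr_eq0 gt_eqF // addr_gt0.
have f1 : f 1%N = 1 by rewrite /f powR1.
have fge0 n : 0 <= f n by exact: powR_ge0.
have ub n : \sum_(0 <= i < n) f i <= 1 + d^-1.
  apply: le_trans (ler_sum_nat_widen (n := n.+2) _ _ _) _ => //; first by lia.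
  rewrite big_ltn // big_ltn // f0 f1 add0r lerD2l big_add1 /= -T1.
  apply: (@le_trans _ _ (T 1%N - T n.+1)); last by rewrite lerBlDr lerDl.
  apply: ler_sum_telescope => // i /andP[i0 _].
  by have /andP[] := powR_nat_step d0 i0; rewrite mulrBr.
have fcvg : cvgn (fun N => \sum_(0 <= n < N) f n).
  apply: (@nondecreasing_bounded_cvgn _ _ (1 + d^-1)) => // n; exact: ler_sum_nat_widen.
exists (limn (fun N => \sum_(0 <= n < N) f n)); split => //; apply/andP; split; last first.
  by apply: (cvgn_le (N := 0%N) fcvg) => n _.
have h : (fun N => T 1%N - T N) @ \oo --> d^-1 - d^-1 * 0.
  rewrite T1; apply: cvgB; first exact: cvg_cst.
  by apply: cvgn_scale; exact: powR_nat_cvg0.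
rewrite mulr0 subr0 in h; apply: (ler_cvg_to h fcvg); near=> N.
have N0 : (0 < N)%N by near: N; exists 1%N.
rewrite big_ltn // f0 add0r -[leLHS]opprK opprB -(telescope_sumr _ N0) -sumrN.
apply: ler_sum_nat => i /andP[i0 _]; rewrite opprB.
by have /andP[_] := powR_nat_step d0 i0; rewrite mulrBr.
Unshelve. all: by end_near. Qed.

(** Abel's limit theorem along a sequence z k tending to 1.  Summation by parts
    writes the difference with b as (1-z) times the power series of the s_m -
    b, where s_m are the partial sums: its first M terms are killed by the
    factor 1-z, and the others are small with total weight at most 1. *)
Lemma abel_limit (R : realType) (a z A : R^nat) (b : R) :
  (forall k, 0 <= z k < 1) -> z @ \oo --> (1 : R) ->
  (fun N => \sum_(1 <= m < N.+1) a m) @ \oo --> b ->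
  (forall k, (fun N => \sum_(1 <= m < N.+1) a m * z k ^+ m) @ \oo --> A k) ->
  A @ \oo --> b.
Proof.
move=> z01 z1 ab Acvg; pose s N := \sum_(1 <= m < N.+1) a m.
have summ k N : \sum_(1 <= m < N.+1) a m * z k ^+ m - b =
    (s N - b) * z k ^+ N + (1 - z k) * \sum_(0 <= m < N) (s m - b) * z k ^+ m.
  elim: N => [|N IH]; first by rewrite /s !big_geq // expr0; ring.
  rewrite big_nat_recr //= addrAC IH [in RHS]big_nat_recr //= /s [in RHS]big_nat_recr //= exprS; ring.
have sb : s @ \oo --> b by [].
apply/cvgn_eps => e e0; have e3 : 0 < e / 3 by lra.
have /cvgn_eps /(_ _ e3) [M hM] := sb.
pose C := \sum_(0 <= m < M) `|s m - b|.
have C0 : 0 <= C by exact: sumr_ge0.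
have Ce : 0 < e / 3 / (C + 1) by rewrite divr_gt0 // ltr_wpDl.
have /cvgn_eps /(_ _ Ce) [K hK] := z1.
exists K => k Kk; have /andP[zk0 zk1] := z01 k.
have zk1' : 0 < 1 - z k by rewrite subr_gt0.
have hz : (1 - z k) * C <= e / 3.
  have := hK k Kk; rewrite distrC ger0_norm ?(ltW zk1') // ler_pdivlMr ?ltr_wpDl //.
  by apply: le_trans; rewrite ler_wpM2l ?(ltW zk1') // lerDl.
have geo m n : (1 - z k) * \sum_(m <= i < n) z k ^+ i <= 1.
  have [mn|nm] := leqP m n; last by rewrite big_geq ?mulr0 // ltnW.
  rewrite mulr_sumr (@le_trans _ _ (z k ^+ m - z k ^+ n)) //.
    by apply: ler_sum_telescope => // i _; rewrite exprS mulrBl mul1r.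
  by rewrite lerBlDr (le_trans (exprn_ile1 m _ (ltW zk1))) // lerDl exprn_ge0.
have fin N : (M <= N)%N -> `|\sum_(1 <= m < N.+1) a m * z k ^+ m - b| <= e.
  move=> MN; rewrite summ (le_trans (ler_normD _ _)) //.
  have t1 : `|(s N - b) * z k ^+ N| <= e / 3.
    rewrite normrM -[leRHS]mulr1 ler_pM // ?hM // ger0_norm ?exprn_ge0 //.
    by rewrite exprn_ile1 // ltW.
  have t2 : `|(1 - z k) * \sum_(0 <= m < N) (s m - b) * z k ^+ m| <= e / 3 + e / 3.
    rewrite normrM (ger0_norm (ltW zk1')) (@big_cat_nat _ _ _ M) //=.
    apply: le_trans (ler_wpM2l (ltW zk1') (ler_normD _ _)) _; rewrite mulrDr; apply: lerD.
      apply: le_trans hz; rewrite ler_wpM2l ?(ltW zk1') //.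
      apply: le_trans (ler_norm_sum _ _ _) _; apply: ler_sum => m _.
      by rewrite normrM ler_piMr // ger0_norm ?exprn_ge0 // exprn_ile1 // ltW.
    rewrite -[leRHS]mulr1 (le_trans _ (ler_wpM2l (ltW e3) (geo M N))) // mulrCA.
    rewrite ler_wpM2l ?(ltW zk1') // mulr_sumr.
    apply: le_trans (ler_norm_sum _ _ _) _; apply: ler_sum_nat => m /andP[Mm _].
    by rewrite normrM [X in _ * X]ger0_norm ?exprn_ge0 // ler_wpM2r ?exprn_ge0 // hM.
  by lra.
have h : (fun N => `|\sum_(1 <= m < N.+1) a m * z k ^+ m - b|) @ \oo --> `|A k - b|.
  by apply: cvg_norm; apply: cvgB; [exact: Acvg|exact: cvg_cst].
exact: (cvgn_le (N := M) h).
Qed.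

(** * The constant in Mertens' theorem *)

(** The sum over the primes is bounded by the sum over all integers, where
    1/i^2 <= 1/(i-1) - 1/i. *)
Lemma ler_sum_prime_tail (R : realType) (f : nat -> R) (C : R) (q N : nat) : (1 < q)%N -> 0 <= C ->
  (forall p, (q <= p)%N -> prime p -> f p <= C / p%:R ^+ 2) ->
  \sum_(q <= p < N | prime p) f p <= C / (q%:R - 1).
Proof.
move=> q1 C0 h.
have q1' : 0 < q%:R - 1 :> R by rewrite subr_gt0 ltr1n.
have [qN|Nq] := leqP q N; last by rewrite big_geq ?divr_ge0 ?(ltW q1') // ltnW.
pose T (n : nat) : R := C / (n%:R - 1).
apply: (@le_trans _ _ (T q - T N)); last first.
  by rewrite lerBlDr lerDl divr_ge0 // subr_ge0 ler1n; lia.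
rewrite big_mkcond; apply: ler_sum_telescope => // i /andP[qi _].
have i1 : 1 < i%:R :> R by rewrite ltr1n; lia.
have i1' : 0 < i%:R - 1 :> R by rewrite subr_gt0.
rewrite /T -[i.+1%:R]natr1 addrK.
have e : C / (i%:R - 1) - C / i%:R = C / (i%:R * (i%:R - 1)).
  by field; rewrite !gt_eqF // (lt_trans ltr01).
rewrite e; case: ifP => pi; last by rewrite divr_ge0 // mulr_ge0 // ltW // (lt_trans ltr01).
apply: le_trans (h _ qi pi) _; rewrite ler_wpM2l // lef_pV2 ?posrE ?mulr_gt0 ?exprn_gt0 ?(lt_trans ltr01 i1) //.
by rewrite expr2 ler_wpM2l // gerBl.
Qed.

Lemma prime_partial_sum_cvg (R : realType) (f : nat -> R) (C : R) : 0 <= C ->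
  (forall p, prime p -> 0 <= f p <= C / p%:R ^+ 2) -> cvgn (prime_partial_sum f).
Proof.
move=> C0 h; apply: (@nondecreasing_bounded_cvgn _ _ (C / (2 - 1))) => n.
  by rewrite /prime_partial_sum big_prime_recr lerDl; case: ifP => // /h /andP[].
rewrite /prime_partial_sum.
apply: le_trans (@ler_sum_prime_tail R f C 2 n isT C0 _); last by move=> p _ /h /andP[].
have [n2|n2] := leqP 2 n.
  rewrite (@big_cat_nat _ _ _ 2) //= [X in X + _]big_mkcond.
  by rewrite big_ltn // big_nat1 /= !add0r.
rewrite [leRHS]big_geq; last by lia.
by rewrite big_mkcond big_nat_cond big1 // => -[|[|i]] //=; lia.
Qed.

Definition log_excess {R : realType} (y : R) : R := - ln (1 - y) - y.

Lemma log_excess_bounds (R : realType) (y : R) : 0 <= y <= 2^-1 -> 0 <= log_excess y <= y ^+ 2.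
Proof.
move=> /andP[y0 y1]; have hy : 0 <= y < 1 by rewrite y0 /=; lra.
have := ln1B_bounds 1 hy; rewrite big_nat1 expr1 divr1 /log_excess => /andP[h1 h2].
have : y ^+ 2 / (2 * (1 - y)) <= y ^+ 2.
  by rewrite ler_piMr ?exprn_ge0 // invf_le1 //; lra.
by move=> h3; apply/andP; split; lra.
Qed.

Lemma log_excess_le (R : realType) (x y : R) : 0 <= x -> x <= y -> y < 1 ->
  log_excess x <= log_excess y.
Proof.
move=> x0 xy y1; have x1 := le_lt_trans xy y1; rewrite /log_excess.
have : ln (1 - y) - ln (1 - x) <= (1 - y) / (1 - x) - 1.
  by rewrite -ln_div ?posrE ?subr_gt0 // ln_leB1 // divr_gt0 ?subr_gt0.
have -> : (1 - y) / (1 - x) - 1 = - ((y - x) / (1 - x)).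
  by field; rewrite gt_eqF // subr_gt0.
have : y - x <= (y - x) / (1 - x).
  by rewrite ler_peMr ?subr_ge0 // invf_ge1 ?subr_gt0 //; lra.
lra.
Qed.

Lemma powR_nat_le_inv (R : realType) (d : R) (p : nat) : 0 < d -> (1 < p)%N ->
  0 <= p%:R `^ (- (1 + d)) <= (p%:R^-1 : R).
Proof.
move=> d0 p1; rewrite powR_ge0 /= -powR_inv1 // ler_powR ?ler1n //; [lia|lra].
Qed.

Lemma inv_natr_le_half (R : realType) (p : nat) : (1 < p)%N -> 0 <= (p%:R^-1 : R) <= 2^-1.
Proof. by move=> p1; rewrite invr_ge0 ler0n /= lef_pV2 ?posrE ?ltr0n ?ler_nat //; lia. Qed.

(** The sum of 1/p over the primes with 2^(m-1) < p <= 2^m; it is close to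
    1/m. *)
Definition dyadic_prime_mass {R : realType} (m : nat) : R :=
  \sum_((2 ^ m.-1).+1 <= p < (2 ^ m).+1 | prime p) p%:R^-1.

(** In the m-th block, p^-d lies between (2^m)^-d = z^m and (2^(m-1))^-d =
    z^(m-1).  The sum over primes thus becomes a power series in z, to which
    Abel's theorem applies. *)
Lemma dyadic_prime_sum_bounds (R : realType) (d z : R) (N : nat) : 0 < d ->
  z = expR (- d * ln 2) ->
  \sum_(1 <= m < N.+1) dyadic_prime_mass m * z ^+ m <=
    \sum_(0 <= p < (2 ^ N).+1 | prime p) p%:R `^ (- (1 + d)) <=
    z^-1 * \sum_(1 <= m < N.+1) dyadic_prime_mass m * z ^+ m.
Proof.
move=> d0 zd; have z0 : 0 < z by rewrite zd expR_gt0.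
have zE m : z ^+ m = (2 ^ m)%:R `^ (- d).
  by rewrite powR_natE ?expn_gt0 // natrX lnXn // zd -expRM_natl mulr_natl mulrnAr.
have step m : dyadic_prime_mass m.+1 * z ^+ m.+1 <=
    \sum_((2 ^ m).+1 <= p < (2 ^ m.+1).+1 | prime p) p%:R `^ (- (1 + d)) <=
    z^-1 * (dyadic_prime_mass m.+1 * z ^+ m.+1).
  have pw (p : nat) : (0 < p)%N -> p%:R `^ (- (1 + d)) = p%:R^-1 * p%:R `^ (- d) :> R.
    move=> p0; rewrite !powR_natE // opprD mulrDl expRD mulN1r expRN lnK // posrE.
    by rewrite ltr0n.
  rewrite mulrCA exprS mulKf ?gt_eqF // -exprS /dyadic_prime_mass /= !mulr_suml.
  apply/andP; split; apply: ler_sum_prime => p /andP[p1 p2] pp;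
    rewrite pw ?prime_gt0 // ler_wpM2l //.
    rewrite zE !powR_natE ?expn_gt0 ?prime_gt0 // ler_expR ler_wnM2l ?ler_ln_nat ?prime_gt0 //.
    by rewrite oppr_le0 ltW.
  rewrite zE !powR_natE ?expn_gt0 ?prime_gt0 // ler_expR ler_wnM2l ?ler_ln_nat ?expn_gt0 //.
    by rewrite oppr_le0 ltW.
  exact: ltnW.
elim: N => [|N IH].
  by rewrite !(big_geq (m := 1)) // mulr0 expn0 big_mkcond big_ltn // big_nat1 /= add0r lexx.
have /andP[s1 s2] := step N; have /andP[i1 i2] := IH.
have hN : (2 ^ N < (2 ^ N.+1).+1)%N by rewrite ltnS leq_exp2l.
rewrite big_nat_recr //= (@big_cat_nat _ _ _ (2 ^ N).+1 0 (2 ^ N.+1).+1) //.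
by rewrite mulrDr !lerD.
Qed.

Lemma zeta_euler_product (R : realType) (d : R) : 0 < d ->
  exists Z, d^-1 <= Z <= 1 + d^-1 /\
  prime_partial_sum (fun p => - ln (1 - p%:R `^ (- (1 + d)))) @ \oo --> ln Z.
Proof.
move=> d0; have [Z [Zcvg Zb]] := zeta_bounds d0; exists Z; split=> //.
apply: euler_product_cvg Zcvg => //.
- by rewrite powR0 // oppr_eq0 gt_eqF // addr_gt0.
- by rewrite powR1.
- by move=> m n; rewrite natrM powRM.
- move=> p pp; have /andP[_] := powR_nat_le_inv d0 (prime_gt1 pp).
  by move=> /le_lt_trans; apply; rewrite invf_lt1 ?ltr0n ?ltr1n ?prime_gt1 ?prime_gt0.
Qed.

Lemma ln1B_series_cvg (R : realType) (z : R) : 0 <= z < 1 ->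
  (fun N => \sum_(1 <= m < N.+1) z ^+ m / m%:R) @ \oo --> - ln (1 - z).
Proof.
move=> hz; have /andP[z0 z1] := hz; have z1' : 0 < 1 - z by rewrite subr_gt0.
have h : (fun N => - ln (1 - z) - (1 - z)^-1 * N.+1%:R^-1) @ \oo --> - ln (1 - z) - (1 - z)^-1 * 0.
  by apply: cvgB; [exact: cvg_cst|apply: cvgn_scale; exact: cvg_harmonic].
rewrite mulr0 subr0 in h.
apply: (squeeze_cvgr _ h (cvg_cst (- ln (1 - z)))); near=> N.
have /andP[h1 h2] := ln1B_bounds N hz; rewrite h1 andbT lerBlDr (le_trans h2) // lerD2l.
rewrite invfM [leRHS]mulrC ler_piMl ?exprn_ile1 ?mulr_ge0 ?invr_ge0 //; exact: ltW.
Unshelve. all: by end_near. Qed.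

Lemma dyadic_prime_mass_ge0 (R : realType) (m : nat) : 0 <= dyadic_prime_mass m :> R.
Proof. exact: sumr_ge0. Qed.

(** Taking logarithms in Euler's product, log zeta(1+d) is the sum of p^-(1+d)
    plus the sum Phi of the excesses of -log(1-y) over y at y = p^-(1+d). *)
Lemma dyadic_zeta_comparison (R : realType) (d z : R) : 0 < d -> z = expR (- d * ln 2) ->
  exists Z Phi w, [/\ d^-1 <= Z <= 1 + d^-1,
    prime_partial_sum (fun p => log_excess (p%:R `^ (- (1 + d)))) @ \oo --> Phi,
    (fun N => \sum_(1 <= m < N.+1) dyadic_prime_mass m * z ^+ m) @ \oo --> w &
    w <= ln Z - Phi <= z^-1 * w].
Proof.
move=> d0 zE; have z0 : 0 < z by rewrite zE expR_gt0.
have [Z [Zb Zcvg]] := zeta_euler_product d0.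
pose f p : R := p%:R `^ (- (1 + d)).
have fb p : prime p -> 0 <= f p <= p%:R^-1 by move=> pp; exact: powR_nat_le_inv (prime_gt1 pp).
have Phicvg : cvgn (prime_partial_sum (fun p => log_excess (f p))).
  apply: (@prime_partial_sum_cvg _ _ 1) => // p pp.
  have /andP[f0 f1] := fb p pp; have /andP[p0 p1] := @inv_natr_le_half R p (prime_gt1 pp).
  have /andP[-> h] : 0 <= log_excess (f p) <= f p ^+ 2.
    by apply: log_excess_bounds; rewrite f0 (le_trans f1).
  by rewrite /= (le_trans h) // mul1r -exprVn lerXn2r.
pose Phi : R := limn (prime_partial_sum (fun p => log_excess (f p))).
have Gcvg : prime_partial_sum f @ \oo --> ln Z - Phi.
  have : (fun N => prime_partial_sum (fun p => - ln (1 - f p)) N -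
     prime_partial_sum (fun p => log_excess (f p)) N) @ \oo --> ln Z - Phi by exact: cvgB.
  apply: cvgn_ext => N; rewrite /prime_partial_sum -sumrB; apply: eq_bigr => p _.
  by rewrite /log_excess; ring.
have Gd : (fun N => prime_partial_sum f (2 ^ N).+1) @ \oo --> ln Z - Phi.
  apply/cvgn_eps => e e0; have /cvgn_eps /(_ e e0) [N hN] := Gcvg.
  exists N => n Nn; apply: hN; have := ltn_expl n (isT : 1 < 2)%N; lia.
have bnd N := dyadic_prime_sum_bounds N d0 zE.
have wcvg : cvgn (fun N => \sum_(1 <= m < N.+1) dyadic_prime_mass m * z ^+ m).
  apply: (@nondecreasing_bounded_cvgn _ _ (ln Z - Phi)) => N.
    by rewrite [leRHS]big_nat_recr //= lerDl mulr_ge0 ?dyadic_prime_mass_ge0 ?exprn_ge0 // ltW.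
  apply: (cvgn_ge (N := N) Gd) => n Nn; have /andP[b1 _] := bnd n; apply: le_trans b1.
  apply: ler_sum_nat_widen => // i _ _.
  by rewrite mulr_ge0 ?dyadic_prime_mass_ge0 ?exprn_ge0 // ltW.
exists Z, Phi, (limn (fun N => \sum_(1 <= m < N.+1) dyadic_prime_mass m * z ^+ m)).
split => //; apply/andP; split.
  by apply: (ler_cvg_to wcvg Gd); near=> N; have /andP[] := bnd N.
have wz := cvgn_scale (a := z^-1) wcvg.
by apply: (ler_cvg_to Gd wz); near=> N; have /andP[] := bnd N.
Unshelve. all: by end_near. Qed.

Lemma sum_dyadic_prime_mass (R : realType) (N : nat) :
  \sum_(1 <= m < N.+1) dyadic_prime_mass m = \sum_(0 <= p < (2 ^ N).+1 | prime p) p%:R^-1 :> R.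
Proof.
elim: N => [|N IH].
  by rewrite big_geq // expn0 big_mkcond big_ltn // big_nat1 /= add0r.
have hN : (2 ^ N < (2 ^ N.+1).+1)%N by rewrite ltnS leq_exp2l.
by rewrite big_nat_recr //= IH [RHS](@big_cat_nat _ _ _ (2 ^ N).+1 0 (2 ^ N.+1).+1).
Qed.

Lemma harmonic_sub_ln_cvg (R : realType) :
  (fun n => harmonic_number n - ln n%:R) @ \oo --> euler_gamma R.
Proof.
have inv0 : (fun n : nat => n.+1%:R^-1 : R) @ \oo --> (0 : R) by exact: cvg_harmonic.
apply: (cvgn_of_shift (d := 1%N)); apply/cvgn_eps => e e0.
have /cvgn_eps /(_ e e0) [N hN] := inv0; exists N => n Nn.
have := hN n Nn; rewrite subr0 ger0_norm ?invr_ge0 // addn1 => h.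
have g := @euler_gamma_dist R n.+1 isT.
set u := harmonic_number _ - _ in g *; have n0 : 0 < n.+1%:R :> R by rewrite ltr0n.
have n1 : 1 <= n.+1%:R :> R by rewrite ler1n.
have -> : u - euler_gamma R = (u - (2 * n.+1%:R)^-1 - euler_gamma R) + (2 * n.+1%:R)^-1 by ring.
rewrite (le_trans (ler_normD _ _)) // (ger0_norm (_ : 0 <= (2 * n.+1%:R)^-1)); last by rewrite invr_ge0 mulr_ge0.
apply: le_trans (lerD g (lexx _)) _; apply: le_trans h; rewrite invfM [X in _ + X]invfM.
have : (n.+1%:R ^+ 2)^-1 <= n.+1%:R^-1 :> R.
  by rewrite lef_pV2 ?posrE ?exprn_gt0 // expr2 ler_peMr // ltW.
set i := n.+1%:R^-1; set j := n.+1%:R ^- 2; lra.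
Qed.

(** The sum of the first N masses is the sum of 1/p up to 2^N, which is about
    log N + log log 2 + B, while the harmonic sum is about log N + gamma. *)
Lemma dyadic_mass_minus_harmonic_cvg (R : realType) (B : R) :
  (forall n, (1 < n)%N ->
    `|\sum_(0 <= p < n.+1 | prime p) p%:R^-1 - ln (ln n%:R) - B| <= 7 / ln n%:R) ->
  (fun N => \sum_(1 <= m < N.+1) (dyadic_prime_mass m - m%:R^-1)) @ \oo -->
    B + ln (ln 2) - euler_gamma R.
Proof.
move=> hB; pose S n : R := \sum_(0 <= p < n.+1 | prime p) p%:R^-1.
have ln2 : 0 < ln 2 :> R by rewrite ln_gt0 // ltr1n.
have SB : (fun N => S (2 ^ N.+1)%N - ln (ln (2 ^ N.+1)%:R)) @ \oo --> B.
  apply/cvgn_eps => e e0; have e7 : 0 < e / 7 by lra.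
  have [M hM] := @inv_ln_natr_small R _ e7; exists M => n Mn.
  have n2 : (1 < 2 ^ n.+1)%N by rewrite -{1}(expn0 2) ltn_exp2l.
  apply: le_trans (hB _ n2) _.
  have : (ln (2 ^ n.+1)%:R)^-1 <= e / 7.
    by apply: hM; have := ltn_expl n.+1 (isT : 1 < 2)%N; lia.
  lra.
have Hg := @cvgn_shift R 1%N _ _ (@harmonic_sub_ln_cvg R).
apply: (cvgn_of_shift (d := 1%N)).
have : (fun N => S (2 ^ N.+1)%N - ln (ln (2 ^ N.+1)%:R) + ln (ln 2) -
   (harmonic_number (N + 1) - ln (N + 1)%:R)) @ \oo --> B + ln (ln 2) - euler_gamma R.
  by apply: cvgB => //; apply: cvgD => //; exact: cvg_cst.
apply: cvgn_ext => N; rewrite addn1 sumrB sum_dyadic_prime_mass -/(S _) -/(harmonic_number _).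
have -> : ln (ln (2 ^ N.+1)%:R) = ln N.+1%:R + ln (ln 2) :> R.
  by rewrite natrX lnXn // -[_ *+ N.+1]mulr_natl lnM ?posrE.
ring.
Qed.

Lemma inv_succ_cvg0 (R : realType) : (fun k : nat => k.+1%:R^-1) @ \oo --> (0 : R).
Proof. exact: cvg_harmonic. Qed.

(** Exchanging the limit d -> 0 with the series: the terms increase to those at
    d = 0, so every Phi k is at most K, and a partial sum close to K is a
    finite sum, in which the limit can be taken term by term. *)
Lemma log_excess_zeta_cvg (R : realType) (K : R) (Phi : R^nat) :
  prime_partial_sum (fun p => log_excess p%:R^-1) @ \oo --> K ->
  (forall k, prime_partial_sum (fun p => log_excess (p%:R `^ (- (1 + k.+1%:R^-1)))) @ \oo --> Phi k) ->
  Phi @ \oo --> K.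
Proof.
move=> Kcvg Pcvg.
have dk k : 0 < k.+1%:R^-1 :> R by rewrite invr_gt0 ltr0n.
have fb k p : prime p -> 0 <= (p%:R `^ (- (1 + k.+1%:R^-1)) : R) <= p%:R^-1.
  by move=> pp; exact: powR_nat_le_inv (dk k) (prime_gt1 pp).
have Kge Q : prime_partial_sum (fun p => log_excess p%:R^-1) Q <= K.
  apply: (cvgn_ge (N := Q) Kcvg) => n Qn; apply: ler_sum_nat_widen => // p _ pp.
  by have /andP[] := log_excess_bounds (@inv_natr_le_half R p (prime_gt1 pp)).
have Pge k Q : prime_partial_sum (fun p => log_excess (p%:R `^ (- (1 + k.+1%:R^-1)))) Q <= Phi k.
  apply: (cvgn_ge (N := Q) (Pcvg k)) => n Qn; apply: ler_sum_nat_widen => // p _ pp.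
  have /andP[f0 f1] := fb k p pp; have /andP[p0 p1] := @inv_natr_le_half R p (prime_gt1 pp).
  have /andP[//] : 0 <= log_excess (p%:R `^ (- (1 + k.+1%:R^-1)) : R) <= (p%:R `^ (- (1 + k.+1%:R^-1))) ^+ 2.
    by apply: log_excess_bounds; rewrite f0 (le_trans f1).
have PK k : Phi k <= K.
  apply: (ler_cvg_to (Pcvg k) Kcvg); near=> N; apply: ler_sum => p pp.
  have /andP[f0 f1] := fb k p pp; apply: log_excess_le => //.
  by rewrite invf_lt1 ?ltr0n ?ltr1n ?prime_gt1 ?prime_gt0.
apply/cvgn_eps => e e0; have e2 : 0 < e / 2 by lra.
have /cvgn_eps /(_ _ e2) [Q hQ] := Kcvg.
have fin : (fun k : nat => prime_partial_sum (fun p => log_excess (p%:R `^ (- (1 + k.+1%:R^-1)))) Q) @ \oo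
     --> (prime_partial_sum (fun p => log_excess p%:R^-1) Q : R).
  apply: cvg_big => [|p pp]; first exact: add_continuous.
  have p0 : 0 < p%:R :> R by rewrite ltr0n prime_gt0.
  have fc : (fun k : nat => p%:R `^ (- (1 + k.+1%:R^-1))) @ \oo --> (p%:R^-1 : R).
    have : (fun k : nat => expR (- (1 + k.+1%:R^-1) * ln p%:R)) @ \oo --> expR (- (1 + 0) * ln p%:R : R).
      apply: continuous_cvg; first exact: continuous_expR.
      apply: cvgMr_tmp; apply: cvgN; apply: cvgD; [exact: cvg_cst|exact: inv_succ_cvg0].
    rewrite addr0 mulN1r expRN lnK ?posrE //; apply: cvgn_ext => k.
    by rewrite powR_natE // prime_gt0.
  apply: cvgB => //; apply: cvgN; apply: continuous_cvg.
    by apply: continuous_ln; rewrite subr_gt0 invf_lt1 ?ltr1n ?prime_gt1.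
  by apply: cvgB => //; exact: cvg_cst.
have /cvgn_eps /(_ _ e2) [M hM] := fin.
exists M => k Mk; have h1 := hM k Mk; have h2 := hQ Q (leqnn _).
move: h1 h2; rewrite !ler_norml => /andP[h1 _] /andP[h2 _].
by have h3 := Pge k Q; have h4 := PK k; apply/andP; split; lra.
Unshelve. all: by end_near. Qed.

Lemma ln2_bounds (R : realType) : 0 < (ln 2 : R) <= 1.
Proof.
by rewrite ln_gt0 ?ltr1n //=; have := @ln_leB1 R 2 (ltr0n _ 2); lra.
Qed.

(** zeta(1+d) is about 1/d and 1 - 2^-d about d log 2, so the logarithm of the
    product tends to log log 2; the linear error bound is enough for the
    limit. *)
Lemma zeta_pole_dist (R : realType) (d Z : R) : 0 < d -> d^-1 <= Z <= 1 + d^-1 ->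
  `|ln Z + ln (1 - expR (- d * ln 2)) - ln (ln 2)| <= d.
Proof.
move=> d0 /andP[Z1 Z2]; have /andP[L0 L1] := ln2_bounds R; set L := ln 2 in L0 L1 *.
have dL0 : 0 < d * L by exact: mulr_gt0.
have Z0 : 0 < Z by rewrite (lt_le_trans _ Z1) // invr_gt0.
have e1 : 1 - expR (- d * L) <= d * L by have := expR_ge1Dx (- d * L); lra.
have e2 : d * L / (1 + d * L) <= 1 - expR (- d * L).
  have : expR (- d * L) <= (1 + d * L)^-1.
    rewrite mulNr expRN lef_pV2 ?posrE ?expR_gt0 //; last by lra.
    exact: expR_ge1Dx.
  have -> : d * L / (1 + d * L) = 1 - (1 + d * L)^-1 by field; rewrite gt_eqF //; lra.
  lra.
have t0 : 0 < 1 - expR (- d * L).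
  by rewrite (lt_le_trans _ e2) // divr_gt0 //; lra.
rewrite -lnM ?posrE //; set T := Z * _.
have T0 : 0 < T by exact: mulr_gt0.
have Tle : T <= L * (1 + d).
  apply: le_trans (ler_pM (ltW Z0) (ltW t0) Z2 e1) _.
  by rewrite mulrDl mul1r mulrA mulVf ?gt_eqF // mul1r; lra.
have Tge : L / (1 + d * L) <= T.
  have d0' : 0 <= d^-1 by rewrite invr_ge0 ltW.
  have q0 : 0 <= d * L / (1 + d * L) by rewrite divr_ge0 //; lra.
  apply: le_trans (ler_pM d0' q0 Z1 e2).
  by rewrite !mulrA mulVf ?gt_eqF // mul1r.
have l1 : ln T <= ln L + d.
  apply: le_trans (_ : ln (L * (1 + d)) <= _).
    by rewrite ler_ln ?posrE // mulr_gt0 //; lra.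
  rewrite lnM ?posrE //; last by lra.
  by rewrite lerD2l; have := @ln_leB1 R (1 + d); lra.
have l2 : ln L - d <= ln T.
  apply: le_trans (_ : _ <= ln (L / (1 + d * L))) _; last first.
    by rewrite ler_ln ?posrE // divr_gt0 //; lra.
  rewrite ln_div ?posrE //; last by lra.
  have : d * L <= d by rewrite ler_piMr // ltW.
  by have := @ln_leB1 R (1 + d * L); lra.
by rewrite ler_norml; apply/andP; split; lra.
Qed.

Lemma ln_over_id_cvg0 (R : realType) : (fun k : nat => ln k.+2%:R / k.+1%:R) @ \oo --> (0 : R).
Proof.
apply/cvgn_eps => e e0; pose a := e / 4; have a0 : 0 < a by rewrite /a; lra.
have /cvgn_eps /(_ (e / 2 / (1 + `|ln a|))) [|N hN] := @inv_succ_cvg0 R.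
  by rewrite !divr_gt0 // ltr_wpDr.
exists N => k Nk; have := hN k Nk; rewrite subr0 ger0_norm ?invr_ge0 // => h.
have k0 : 0 < k.+1%:R :> R by rewrite ltr0n.
have k1 : 1 <= k.+1%:R :> R by rewrite ler1n.
rewrite subr0 ger0_norm ?divr_ge0 ?ln_ge0 ?ler1n // ler_pdivrMr //.
have := @ln_leB1 R (a * k.+2%:R) (mulr_gt0 a0 (ltr0n _ k.+2)).
rewrite lnM ?posrE ?ltr0n // -[k.+2%:R]natr1.
move: h; rewrite ler_pdivlMr; last by rewrite ltr_wpDr.
rewrite mulrC ler_pdivrMr // => h.
have : - ln a <= `|ln a| by rewrite -normrN ler_norm.
have : a * k.+1%:R * 2 = e / 2 * k.+1%:R by rewrite /a; field.
move: h k1; set x := k.+1%:R; set b := `|ln a|; set c := ln a; set w := ln _ => h k1 h2 h3 h4.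
nra.
Qed.

Lemma log_excess_inv_prime_cvg (R : realType) :
  cvgn (prime_partial_sum (fun p => log_excess p%:R^-1 : R)).
Proof.
apply: (@prime_partial_sum_cvg _ _ 1) => // p pp.
by rewrite mul1r -exprVn log_excess_bounds // inv_natr_le_half ?prime_gt1.
Qed.

(** With w the power series of the block masses, log zeta(1+d) + log(1-z) is
    the sum of three parts: the loss in the dyadic comparison, at most (1/z -
    1) w, which is of order d log(1/d) and tends to 0; w + log(1-z), which
    tends to B + log log 2 - gamma by Abel's theorem; and Phi, which tends to
    K.  The whole tends to log log 2. *)
Lemma mertens_constant_eq (R : realType) (B K : R) :
  (forall n, (1 < n)%N ->
    `|\sum_(0 <= p < n.+1 | prime p) p%:R^-1 - ln (ln n%:R) - B| <= 7 / ln n%:R) ->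
  prime_partial_sum (fun p => log_excess p%:R^-1) @ \oo --> K ->
  B = euler_gamma R - K.
Proof.
move=> hB Kcvg.
pose d k : R := k.+1%:R^-1; pose z k : R := expR (- d k * ln 2).
have d0 k : 0 < d k by rewrite invr_gt0 ltr0n.
have /andP[L0 L1] := ln2_bounds R.
have z01 k : 0 <= z k < 1.
  by rewrite expR_ge0 expR_lt1 mulNr oppr_lt0 mulr_gt0.
have /boolp.choice[ZPw hZ] : forall k, exists ZPw : R * R * R, [/\ (d k)^-1 <= ZPw.1.1 <= 1 + (d k)^-1,
    prime_partial_sum (fun p => log_excess (p%:R `^ (- (1 + d k)))) @ \oo --> ZPw.1.2,
    (fun N => \sum_(1 <= m < N.+1) dyadic_prime_mass m * z k ^+ m) @ \oo --> ZPw.2 &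
    ZPw.2 <= ln ZPw.1.1 - ZPw.1.2 <= (z k)^-1 * ZPw.2].
  move=> k; have [Z [P [w [h1 h2 h3 h4]]]] := dyadic_zeta_comparison (d0 k) (erefl (z k)).
  by exists (Z, P, w).
pose Z k := (ZPw k).1.1; pose P k := (ZPw k).1.2; pose w k := (ZPw k).2.
have Pge0 k : 0 <= P k.
  have [_ h _ _] := hZ k; apply: (cvgn_ge (N := 0%N) h) => n _; apply: sumr_ge0 => p pp.
  have /andP[f0 f1] := powR_nat_le_inv (d0 k) (prime_gt1 pp).
  have /andP[p0 p1] := @inv_natr_le_half R p (prime_gt1 pp).
  have fk : 0 <= (p%:R `^ (- (1 + d k)) : R) <= 2^-1 by rewrite f0 (le_trans f1).
  by have /andP[] := log_excess_bounds fk.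
have dcvg : d @ \oo --> (0 : R) by exact: inv_succ_cvg0.
have zcvg : z @ \oo --> (1 : R).
  have : (fun k => expR (- d k * ln 2)) @ \oo --> expR (- 0 * ln 2 : R).
    apply: continuous_cvg; first exact: continuous_expR.
    by apply: cvgMr_tmp; apply: cvgN.
  by rewrite oppr0 mul0r expR0.
have PK : P @ \oo --> K by apply: (log_excess_zeta_cvg Kcvg) => k; have [] := hZ k.
pose A k := w k + ln (1 - z k).
have Acvg : A @ \oo --> B + ln (ln 2) - euler_gamma R.
  apply: (@abel_limit R _ z A _ z01 zcvg (dyadic_mass_minus_harmonic_cvg hB)) => k.
  have [_ _ h _] := hZ k.
  have : (fun N => \sum_(1 <= m < N.+1) dyadic_prime_mass m * z k ^+ m -
     \sum_(1 <= m < N.+1) z k ^+ m / m%:R) @ \oo --> w k - - ln (1 - z k).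
    by apply: cvgB => //; exact: ln1B_series_cvg.
  rewrite opprK; apply: cvgn_ext => N; rewrite -sumrB; apply: eq_bigr => m _.
  by rewrite mulrBl [X in _ - X]mulrC.
have lhs : (fun k => ln (Z k) + ln (1 - z k)) @ \oo --> ln (ln 2 : R).
  apply/cvgn_eps => e e0; have /cvgn_eps /(_ e e0) [N hN] := dcvg.
  exists N => k Nk; have [h _ _ _] := hZ k; apply: le_trans (zeta_pole_dist (d0 k) h) _.
  by have := hN k Nk; rewrite subr0; apply: le_trans; exact: ler_norm.
have gap : (fun k => ln (Z k) - P k - w k) @ \oo --> (0 : R).
  have h2 : (fun k : nat => 2 * (ln k.+2%:R / k.+1%:R) : R) @ \oo --> (2 * 0 : R).
    by apply: cvgn_scale; exact: ln_over_id_cvg0.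
  rewrite mulr0 in h2; apply: (squeeze_cvgr _ (cvg_cst (0 : R)) h2); near=> k.
  have [/andP[Z1 Z2] _ _ /andP[w1 w2]] := hZ k.
  rewrite subr_ge0 w1 /=.
  have zk : 2^-1 <= z k.
    rewrite /z mulNr expRN lef_pV2 ?posrE ?expR_gt0 // -{2}[2](@lnK R) ?posrE // ler_expR.
    by rewrite ler_piMl ?(ltW L0) // invf_le1 ?ler1n ?ltr0n.
  have zk0 : 0 < z k by exact: expR_gt0.
  have wlnZ : w k <= ln (Z k) by apply: le_trans w1 _; rewrite gerBl; exact: Pge0.
  have lnZ : ln (Z k) <= ln k.+2%:R.
    rewrite ler_ln ?posrE ?ltr0n //.
      by apply: le_trans Z2 _; rewrite invrK -[k.+2%:R]natr1 addrC.
    by rewrite (lt_le_trans _ Z1) // invr_gt0.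
  have w0 : 0 <= w k.
    have [_ _ h _] := hZ k; apply: (cvgn_ge (N := 0%N) h) => n _; apply: sumr_ge0 => m _.
    by rewrite mulr_ge0 ?dyadic_prime_mass_ge0 ?exprn_ge0 // ltW.
  have z1 : (z k)^-1 - 1 <= 2 * d k.
    have -> : (z k)^-1 - 1 = (1 - z k) / z k by field; rewrite gt_eqF.
    rewrite ler_pdivrMr //; have := expR_ge1Dx (- d k * ln 2); rewrite -/(z k).
    by have := d0 k; nra.
  have : ln (Z k) - P k - w k <= ((z k)^-1 - 1) * w k by rewrite mulrBl mul1r lerD2r.
  move=> /le_trans; apply.
  rewrite mulrA [_ * _ / _]mulrAC; apply: ler_pM => //; last exact: le_trans wlnZ lnZ.
  by rewrite subr_ge0 invf_ge1 //; have /andP[_ /ltW] := z01 k.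
have rhs : (fun k => (ln (Z k) - P k - w k) + A k + P k) @ \oo -->
    0 + (B + ln (ln 2) - euler_gamma R) + K.
  by apply: cvgD => //; apply: cvgD.
have : ln (ln 2) = 0 + (B + ln (ln 2) - euler_gamma R) + K.
  apply: (cvgn_unique lhs); apply: cvgn_ext rhs => k; rewrite /A; ring.
lra.
Unshelve. all: by end_near. Qed.

Lemma mertens_term_cvg (R : realType) :
  prime_partial_sum (fun p => ln (1 - p%:R^-1) + p%:R^-1 : R) @ \oo -->
  - prime_sum (fun p => log_excess p%:R^-1 : R).
Proof.
have : (fun N => - prime_partial_sum (fun p => log_excess p%:R^-1 : R) N) @ \oo -->
   - prime_sum (fun p => log_excess p%:R^-1 : R).
  by apply: cvgN; exact: log_excess_inv_prime_cvg.
apply: cvgn_ext => N; rewrite /prime_partial_sum -sumrN; apply: eq_bigr => p _.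
by rewrite /log_excess; ring.
Qed.

Lemma mertens_second_explicit (R : realType) (n : nat) : (1 < n)%N ->
  `|\sum_(0 <= p < n.+1 | prime p) p%:R^-1 - ln (ln n%:R) - mertens R| <= 7 / ln n%:R.
Proof.
have [B hB] := mertens_second R.
suff -> : mertens R = B by exact: hB.
rewrite (mertens_constant_eq hB (@log_excess_inv_prime_cvg R)) /mertens.
by congr (_ + _); rewrite /prime_sum (cvgn_lim (@mertens_term_cvg R)).
Qed.

(** * The gcd sum as a sum of shares of the primes *)

Lemma big_primes_widen (A : nmodType) (F : nat -> A) (n M : nat) : (0 < n <= M)%N ->
  \sum_(p <- primes n) F p = \sum_(0 <= p < M.+1 | prime p && (p %| n)%N) F p.
Proof.
move=> /andP[n0 nM]; rewrite -[RHS]big_filter; apply: perm_big; apply: uniq_perm.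
- exact: primes_uniq.
- by apply: filter_uniq; exact: iota_uniq.
move=> p; rewrite mem_primes n0 mem_filter mem_index_iota /= ltnS.
case: (prime p) => //=; case: (boolP (p %| n)%N) => //= /(dvdn_leq n0) pn.
by rewrite (leq_trans pn).
Qed.

(** The ranges of p and j go up to a common bound M for all n in the sum, so
    that the sums over the tuples and over the prime powers can be
    exchanged. *)
Lemma A_ell_prime_powers (l n M : nat) : (0 < n <= M)%N ->
  A_ell l n = (\sum_(0 <= p < M.+1 | prime p) \sum_(1 <= j < M.+1)
     pow_jump l j * p * (p ^ j %| n))%N.
Proof.
move=> nM; have /andP[n0 nM'] := nM; rewrite /A_ell (@big_primes_widen nat _ _ M) //.
rewrite big_mkcondr; apply: eq_bigr => p pp.
have hj j : (p ^ j %| n)%N = (j <= logn p n)%N by exact: pfactor_dvdn.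
case: ifP => pn; last first.
  rewrite big_nat_cond big1 // => j /andP[/andP[j0 _] _].
  have l0 : logn p n = 0%N by rewrite lognE pp n0 pn.
  by rewrite hj l0 leqNgt j0 muln0.
have l0 : (0 < logn p n)%N by rewrite logn_gt0 mem_primes pp n0.
have lM : (logn p n <= M)%N.
  by apply: leq_trans nM'; apply: ltnW; exact: ltn_logl.
rewrite -(sum_pow_jump l l0) big_distrl /= [RHS](@big_cat_nat _ _ _ (logn p n).+1) //=.
rewrite [X in (_ = _ + X)%N]big_nat_cond [X in (_ = _ + X)%N]big1 ?addn0; last first.
  by move=> j /andP[/andP[j0 _] _]; rewrite hj leqNgt j0 muln0.
by rewrite big_nat_cond [RHS]big_nat_cond; apply: eq_bigr => j /andP[/andP[_ jl] _]; rewrite hj -ltnS jl muln1.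
Qed.

(** The gcd is divisible by q if and only if every entry is: the count is a
    power of the number of multiples of q in [1,N]. *)
Lemma card_multiples_tuples (k N q : nat) : (0 < q)%N ->
  (\sum_(n : {ffun 'I_k -> 'I_N.+1} | [forall i, (0 < n i)%N]) (q %| \big[gcdn/0]_(i < k) n i) =
   (N %/ q) ^ k)%N.
Proof.
move=> q0; rewrite -big_mkcondr /= sum1_card.
pose A := [pred i : 'I_N.+1 | (0 < i)%N && (q %| i)%N].
rewrite (eq_card (B := ffun_on A)); last first.
  move=> n; rewrite inE; apply/andP/ffun_onP => [[/forallP h1 /dvdn_biggcdP h2] i|h].
    by rewrite inE h1 h2.
  split; first by apply/forallP => i; have := h i; rewrite inE => /andP[].
  by apply/dvdn_biggcdP => i _; have := h i; rewrite inE => /andP[].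
rewrite card_ffun_on card_ord; congr expn.
rewrite divn_count_dvd -sum1_card big_mkcond /= -(big_mkord xpredT (fun i => if (0 < i)%N && (q %| i)%N then 1 else 0)%N).
rewrite big_ltn //= add0n; apply: eq_big_nat => i /andP[i0 _].
by rewrite i0; case: (q %| i)%N.
Qed.

Definition prime_share {R : realType} (l k N p : nat) : R :=
  \sum_(1 <= j < N.+1) (pow_jump l j)%:R * p%:R * (N %/ p ^ j)%:R ^+ k.

Lemma gcd_sum_prime_shares (R : realType) (l k : nat) (x : R) : (0 < k)%N ->
  gcd_sum (A_ell l) k x =
  \sum_(0 <= p < (Num.truncn x).+1 | prime p) prime_share l k (Num.truncn x) p :> R.
Proof.
move=> k0; rewrite /gcd_sum; set N := Num.truncn x.
have -> : (\sum_(n : {ffun 'I_k -> 'I_N.+1} | [forall i, 0 < n i]) A_ell l (\big[gcdn/0]_(i < k) n i) =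
  \sum_(0 <= p < N.+1 | prime p) \sum_(1 <= j < N.+1) pow_jump l j * p * (N %/ p ^ j) ^ k)%N.
  rewrite (eq_bigr (fun n : {ffun 'I_k -> 'I_N.+1} => \sum_(0 <= p < N.+1 | prime p) \sum_(1 <= j < N.+1)
     pow_jump l j * p * (p ^ j %| \big[gcdn/0]_(i < k) n i))%N); last first.
    move=> n /forallP npos; rewrite (@A_ell_prime_powers _ _ N) //.
    pose i0 : 'I_k := Ordinal k0.
    have d : (\big[gcdn/0]_(i < k) n i %| n i0)%N by rewrite (bigD1 i0) //= dvdn_gcdl.
    rewrite (dvdn_gt0 (npos i0) d) /= (leq_trans (dvdn_leq (npos i0) d)) //.
    by rewrite -ltnS ltn_ord.
  rewrite exchange_big /=; apply: eq_bigr => p pp; rewrite exchange_big /=.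
  apply: eq_bigr => j _; rewrite -card_multiples_tuples ?expn_gt0 ?prime_gt0 //.
  by rewrite big_distrr.
rewrite natr_sum; apply: eq_bigr => p _; rewrite natr_sum; apply: eq_bigr => j _.
by rewrite !natrM natrX.
Qed.

(** t^(k+1) - u^(k+1) is t - u <= 1 times a sum of k+1 products, each at most
    t^k. *)
Lemma expr_sub_bounds (R : realType) (u t : R) (k : nat) : 0 <= u -> u <= t -> t <= u + 1 ->
  0 <= t ^+ k.+1 - u ^+ k.+1 <= k.+1%:R * t ^+ k.
Proof.
move=> u0 ut tu; have t0 := le_trans u0 ut; apply/andP; split.
  by rewrite subr_ge0 lerXn2r.
rewrite subrXX -[leRHS]mul1r; apply: ler_pM; rewrite ?subr_ge0 //; last 2 first.
- by lra.
- rewrite mulr_natl -[k.+1 in leRHS]card_ord -sumr_const; apply: ler_sum => i _.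
  have ik : (i <= k)%N by rewrite -ltnS.
  have -> : t ^+ k = t ^+ (k - i) * t ^+ i by rewrite -exprD subnK.
  by rewrite ler_wpM2l ?exprn_ge0 // lerXn2r.
by apply: sumr_ge0 => i _; rewrite mulr_ge0 ?exprn_ge0.
Qed.

Lemma floor_quotient_bounds (R : realType) (x : R) (q : nat) : 0 <= x -> (0 < q)%N ->
  (Num.truncn x %/ q)%:R <= x / q%:R <= (Num.truncn x %/ q)%:R + 1.
Proof.
move=> x0 q0; have /andP[h1 h2] := truncn_itv x0.
rewrite ler_pdivlMr ?ltr0n // ler_pdivrMr ?ltr0n // natr1 -!natrM; apply/andP; split.
  by apply: le_trans h1; rewrite ler_nat leq_divM.
by apply: le_trans (ltW h2) _; rewrite ler_nat ltn_ceil.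
Qed.

Lemma inv_natrX_le_half (R : realType) (p k : nat) : (1 < p)%N ->
  0 <= (p%:R ^- k.+1 : R) <= 2^-1.
Proof.
move=> p1; rewrite invr_ge0 exprn_ge0 //= lef_pV2 ?posrE ?exprn_gt0 ?ltr0n //; last by lia.
rewrite -natrX ler_nat (leq_trans p1) // -{1}(expn1 p) leq_exp2l //.
Qed.

(** Prime power by prime power, t^k - floor(t)^k <= k t^(k-1) at t = x/p^j: the
    upper bound is again a main term, for the exponent lowered by one. *)
Lemma prime_share_error (R : realType) (l k p : nat) (x : R) : 0 <= x -> prime p ->
  0 <= x ^+ k.+2 * D_term l k.+2 p - prime_share l k.+2 (Num.truncn x) p
    <= k.+2%:R * x ^+ k.+1 * D_term l k.+1 p.
Proof.
move=> x0 pp; have p1 := prime_gt1 pp; set N := Num.truncn x.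
have pR0 : 0 < p%:R :> R by rewrite ltr0n prime_gt0.
pose main (m : nat) (J : nat) : R := x ^+ m * (p%:R * \sum_(1 <= j < J.+1) (pow_jump l j)%:R * (p%:R ^- m) ^+ j).
have maincvg m : main m.+1 @ \oo --> x ^+ m.+1 * D_term l m.+1 p.
  rewrite D_termE //; apply: cvgn_scale; apply: cvgn_scale; apply: jump_series_cvg.
  by have /andP[-> h] := @inv_natrX_le_half R p m p1; rewrite (le_lt_trans h) //; lra.
have mainE m J : main m J = \sum_(1 <= j < J.+1) (pow_jump l j)%:R * p%:R * (x / (p ^ j)%:R) ^+ m.
  rewrite /main !mulr_sumr; apply: eq_bigr => j _.
  have -> : p%:R ^- m ^+ j = (p ^ j)%:R^-1 ^+ m :> R.
    by rewrite natrX !exprVn -!exprM mulnC.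
  rewrite exprMn; ring.
(* For j > N the quotient N/p^j has floor 0, so the share may be summed as far
   as the series. *)
have share J : (N <= J)%N -> prime_share l k.+2 N p =
   \sum_(1 <= j < J.+1) (pow_jump l j)%:R * p%:R * (N %/ p ^ j)%:R ^+ k.+2 :> R.
  move=> NJ; rewrite [RHS](@big_cat_nat _ _ _ N.+1) //= [X in _ = _ + X]big_nat_cond.
  rewrite [X in _ = _ + X]big1 ?addr0 // => j /andP[/andP[Nj _] _].
  by rewrite divn_small ?expr0n ?mulr0 // (leq_trans Nj) // ltnW // ltn_expl.
have step J : (N <= J)%N -> 0 <= main k.+2 J - prime_share l k.+2 N p <= k.+2%:R * main k.+1 J.
  move=> NJ; rewrite (share J NJ) !mainE -sumrB mulr_sumr.
  have hj j : 0 <= (pow_jump l j)%:R * p%:R * (x / (p ^ j)%:R) ^+ k.+2 -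
      (pow_jump l j)%:R * p%:R * (N %/ p ^ j)%:R ^+ k.+2 <=
      k.+2%:R * ((pow_jump l j)%:R * p%:R * (x / (p ^ j)%:R) ^+ k.+1).
    have pj : (0 < p ^ j)%N by rewrite expn_gt0 prime_gt0.
    have /andP[h1 h2] := floor_quotient_bounds x0 pj.
    have /andP[e1 e2] := @expr_sub_bounds R _ _ k.+1 (ler0n _ _) h1 h2.
    have c0 : 0 <= (pow_jump l j)%:R * p%:R :> R by rewrite mulr_ge0.
    rewrite -mulrBr mulr_ge0 //= [leRHS]mulrCA ler_wpM2l //.
  apply/andP; split; first by apply: sumr_ge0 => j _; have /andP[] := hj j.
  by apply: ler_sum => j _; have /andP[] := hj j.
have lim1 : (fun J => main k.+2 J - prime_share l k.+2 N p) @ \oo -->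
    x ^+ k.+2 * D_term l k.+2 p - prime_share l k.+2 N p.
  by apply: cvgB; [exact: maincvg|exact: cvg_cst].
apply/andP; split.
  by apply: (cvgn_ge (N := N) lim1) => J /step /andP[].
rewrite -mulrA; apply: (ler_cvg_to lim1 (cvgn_scale (a := k.+2%:R) (maincvg k))).
by exists N => // J /= /step /andP[].
Qed.

(** * Asymptotic formulas *)

Lemma eqO_pinfty (R : realType) (f g : R -> R) (C x0 : R) : 0 <= C ->
  (forall x, x0 <= x -> `|f x| <= C * `|g x|) ->
  f =O_ (+oo_R) g.
Proof.
move=> C0 h; apply/eqO_exP; exists (C + 1); first by rewrite /= ltr_wpDl.
near=> x; apply: le_trans (h x _) _.
  by near: x; apply: nbhs_pinfty_ge; exact: num_real.
by rewrite ler_wpM2r // lerDl.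
Unshelve. all: by end_near. Qed.

Lemma D_term_bounds (R : realType) (l m p : nat) : prime p ->
  0 <= (D_term l m.+1 p : R) <= 2 * jump_series l 2^-1 / p%:R ^+ m.
Proof.
move=> pp; have pR0 : 0 < p%:R :> R by rewrite ltr0n prime_gt0.
have hy := @inv_natrX_le_half R p m (prime_gt1 pp); have /andP[y0 y1] := hy.
rewrite D_termE //; apply/andP; split.
  by rewrite mulr_ge0 ?jump_series_ge0 // y0 /=; lra.
apply: le_trans (ler_wpM2l (ltW pR0) (jump_series_le l hy)) _.
rewrite le_eqVlt exprS; apply/orP; left; apply/eqP; field.
by rewrite !gt_eqF ?exprn_gt0.
Qed.

(** What D_2(p) adds to 1/p; it is of order p^-3, hence the constant for k = 2
    is the Mertens constant plus the sum of these terms. *)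
Definition prime_square_term {R : realType} (l p : nat) : R := D_term l 2 p - p%:R^-1.

Lemma mul_jump_half_ge0 (R : realType) (l : nat) (c : R) :
  0 <= c -> 0 <= c * jump_series l 2^-1.
Proof. by move=> c0; apply: mulr_ge0 => //; apply: jump_series_ge0; lra. Qed.

Lemma prime_square_term_bounds (R : realType) (l p : nat) : prime p ->
  0 <= (prime_square_term l p : R) <= 4 * jump_series l 2^-1 / p%:R ^+ 2.
Proof.
move=> pp; have pR0 : 0 < p%:R :> R by rewrite ltr0n prime_gt0.
have p1 : 1 <= p%:R :> R by rewrite ler1n prime_gt0.
have hy := @inv_natrX_le_half R p 1 (prime_gt1 pp); have /andP[y0 y1] := hy.
have /andP[h1 h2] := jump_series_sub_bounds l hy.
have e : prime_square_term l p = p%:R * (jump_series l (p%:R ^- 2) - p%:R ^- 2) :> R.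
  by rewrite /prime_square_term D_termE // mulrBr; congr (_ - _); field; rewrite gt_eqF.
rewrite e mulr_ge0 ?(ltW pR0) //=; apply: le_trans (ler_wpM2l (ltW pR0) h2) _.
have -> : p%:R * (4 * p%:R ^- 2 ^+ 2 * jump_series l 2^-1) = 4 * jump_series l 2^-1 / p%:R ^+ 3 :> R.
  by field; rewrite gt_eqF.
rewrite ler_wpM2l ?mul_jump_half_ge0 // lef_pV2 ?posrE ?exprn_gt0 //.
by rewrite [leRHS]exprS ler_peMl ?exprn_ge0 // ltW.
Qed.

Lemma prime_square_term_cvg (R : realType) (l : nat) :
  cvgn (prime_partial_sum (@prime_square_term R l)).
Proof.
apply: (@prime_partial_sum_cvg _ _ (4 * jump_series l 2^-1)).
  exact: mul_jump_half_ge0.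
by move=> p pp; exact: prime_square_term_bounds.
Qed.

Lemma D_term_le_square (R : realType) (l k p : nat) : prime p -> (3 <= k)%N ->
  0 <= (D_term l k p : R) <= 2 * jump_series l 2^-1 / p%:R ^+ 2.
Proof.
case: k => [|[|[|k]]] // pp _; have /andP[-> h] := @D_term_bounds R l k.+2 p pp.
apply: le_trans h _; rewrite ler_wpM2l ?mul_jump_half_ge0 //.
rewrite lef_pV2 ?posrE ?exprn_gt0 ?ltr0n ?prime_gt0 //.
by rewrite ler_weXn2l ?ler1n ?prime_gt0.
Qed.

Lemma D_term_cvg (R : realType) (l k : nat) : (3 <= k)%N ->
  cvgn (prime_partial_sum (@D_term R l k)).
Proof.
move=> k3; apply: (@prime_partial_sum_cvg _ _ (2 * jump_series l 2^-1)).
  exact: mul_jump_half_ge0.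
by move=> p pp; exact: D_term_le_square.
Qed.

Lemma D2_term_partial_cvg (R : realType) (l : nat) :
  prime_partial_sum (@D2_term R l) @ \oo -->
  - prime_sum (fun p => log_excess p%:R^-1 : R) + prime_sum (@prime_square_term R l).
Proof.
have : (fun N => prime_partial_sum (fun p => ln (1 - p%:R^-1) + p%:R^-1 : R) N +
    prime_partial_sum (@prime_square_term R l) N) @ \oo -->
  - prime_sum (fun p => log_excess p%:R^-1 : R) + prime_sum (@prime_square_term R l).
  by apply: cvgD; [exact: mertens_term_cvg|exact: prime_square_term_cvg].
apply: cvgn_ext => N; rewrite /prime_partial_sum -big_split; apply: eq_bigr => p _.
by rewrite /= /prime_square_term /D2_term /D_term subSS subn0 expr1; ring.
Qed.

Lemma Dbar2_mertens (R : realType) (l : nat) :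
  Dbar2 R l = mertens R + prime_sum (@prime_square_term R l).
Proof.
rewrite /Dbar2 /mertens {1}/prime_sum (cvgn_lim (@D2_term_partial_cvg R l)).
by rewrite /prime_sum (cvgn_lim (@mertens_term_cvg R)) addrA.
Qed.

Lemma prime_sum_tail (R : realType) (f : nat -> R) (C : R) (n : nat) : (0 < n)%N -> 0 <= C ->
  (forall p, prime p -> 0 <= f p <= C / p%:R ^+ 2) ->
  0 <= prime_sum f - \sum_(0 <= p < n.+1 | prime p) f p <= C / n%:R.
Proof.
move=> n0 C0 h; have fc := prime_partial_sum_cvg C0 h.
have lim1 : (fun N => prime_partial_sum f N - \sum_(0 <= p < n.+1 | prime p) f p) @ \oo -->
   prime_sum f - \sum_(0 <= p < n.+1 | prime p) f p.
  by apply: cvgB => //; exact: cvg_cst.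
apply/andP; split.
  apply: (cvgn_ge (N := n.+1) lim1) => N nN; rewrite subr_ge0.
  by apply: ler_sum_nat_widen => // p _ /h /andP[].
apply: (cvgn_le (N := n.+1) lim1) => N nN; rewrite /prime_partial_sum.
rewrite (@big_cat_nat _ _ _ n.+1) //= addrAC subrr add0r.
have n1 : (1 < n.+1)%N by [].
apply: le_trans (@ler_sum_prime_tail R f C n.+1 N n1 C0 _) _; first by move=> p _ /h /andP[].
by rewrite -natr1 addrK.
Qed.

Lemma truncn_bounds (R : realType) (x : R) : 1 <= x ->
  [/\ (0 < Num.truncn x)%N, (Num.truncn x)%:R <= x & x <= 2 * (Num.truncn x)%:R].
Proof.
move=> x1; have /andP[h1 h2] := truncn_itv (le_trans ler01 x1).
have n0 : (0 < Num.truncn x)%N by rewrite truncn_gt0.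
split=> //; apply: le_trans (ltW h2) _; rewrite -natr1.
have : 1 <= (Num.truncn x)%:R :> R by rewrite ler1n.
lra.
Qed.

Lemma gcd_sum_error (R : realType) (l k : nat) (x : R) : 1 <= x ->
  0 <= x ^+ k.+2 * \sum_(0 <= p < (Num.truncn x).+1 | prime p) D_term l k.+2 p
    - gcd_sum (A_ell l) k.+2 x <=
  k.+2%:R * x ^+ k.+1 * \sum_(0 <= p < (Num.truncn x).+1 | prime p) D_term l k.+1 p.
Proof.
move=> x1; have x0 := le_trans ler01 x1.
rewrite gcd_sum_prime_shares // !mulr_sumr -sumrB; apply/andP; split.
  by apply: sumr_ge0 => p pp; have /andP[] := prime_share_error l k x0 pp.
by apply: ler_sum => p pp; have /andP[] := prime_share_error l k x0 pp.
Qed.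

Lemma gcd_sum_Dbar_error (R : realType) (l k : nat) (x : R) : 1 <= x ->
  `|gcd_sum (A_ell l) k.+3 x - Dbar R l k.+3 * x ^+ k.+3| <=
  4 * jump_series l 2^-1 * x ^+ k.+2 +
  k.+3%:R * x ^+ k.+2 * \sum_(0 <= p < (Num.truncn x).+1 | prime p) D_term l k.+2 p.
Proof.
move=> x1; have [n0 nx xn] := truncn_bounds x1; have x0 := le_trans ler01 x1.
set N := Num.truncn x in n0 nx xn *.
have C0 : 0 <= 2 * jump_series l 2^-1 :> R by exact: mul_jump_half_ge0.
have /andP[t1 t2] := @prime_sum_tail R (@D_term R l k.+3) _ N n0 C0 (fun p pp => @D_term_le_square R l k.+3 p pp isT).
have /andP[e1 e2] := gcd_sum_error l k.+1 x1; rewrite -/N in e1 e2.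
rewrite -/(Dbar R l k.+3) in t1 t2.
have xk : 0 <= x ^+ k.+3 by exact: exprn_ge0.
have t3 : x ^+ k.+3 * (Dbar R l k.+3 - \sum_(0 <= p < N.+1 | prime p) D_term l k.+3 p) <=
    4 * jump_series l 2^-1 * x ^+ k.+2.
  apply: le_trans (ler_wpM2l xk t2) _; rewrite exprS.
  have -> : x * x ^+ k.+2 * (2 * jump_series l 2^-1 / N%:R) = (x / N%:R) * (2 * jump_series l 2^-1 * x ^+ k.+2) by ring.
  have -> : 4 * jump_series l 2^-1 * x ^+ k.+2 = 2 * (2 * jump_series l 2^-1 * x ^+ k.+2) by ring.
  rewrite ler_wpM2r //; first by apply: mulr_ge0 => //; exact: exprn_ge0.
  by rewrite ler_pdivrMr ?ltr0n.
have t4 : 0 <= x ^+ k.+3 * (Dbar R l k.+3 - \sum_(0 <= p < N.+1 | prime p) D_term l k.+3 p).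
  exact: mulr_ge0.
rewrite ler_norml; apply/andP; split; nra.
Qed.

Lemma gcd_sum_asymp_ge4 (R : realType) (l k : nat) :
  (fun x : R => gcd_sum (A_ell l) k.+4 x - Dbar R l k.+4 * x ^+ k.+4) =O_ (+oo_R)
  (fun x : R => x ^+ k.+3).
Proof.
pose C : R := 4 * jump_series l 2^-1 + k.+4%:R * Dbar R l k.+3.
have C0 : 0 <= 2 * jump_series l 2^-1 :> R by exact: mul_jump_half_ge0.
have tail n : (0 < n)%N -> 0 <= Dbar R l k.+3 - \sum_(0 <= p < n.+1 | prime p) D_term l k.+3 p.
  move=> n0; have := @prime_sum_tail R (@D_term R l k.+3) _ n n0 C0 (fun p pp => @D_term_le_square R l k.+3 p pp isT).
  by case/andP.
have D0 : 0 <= Dbar R l k.+3.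
  rewrite (@le_trans _ _ (\sum_(0 <= p < 2 | prime p) D_term l k.+3 p)) //.
    by apply: sumr_ge0 => p pp; have /andP[] := @D_term_le_square R l k.+3 p pp isT.
  by have := tail 1%N isT; rewrite subr_ge0.
apply: (@eqO_pinfty _ _ _ C 1).
  by rewrite addr_ge0 ?mul_jump_half_ge0 // mulr_ge0.
move=> x x1; have x0 := le_trans ler01 x1; have [n0 _ _] := truncn_bounds x1.
rewrite [X in _ <= C * X]ger0_norm ?exprn_ge0 //.
apply: le_trans (gcd_sum_Dbar_error l k.+1 x1) _; rewrite [leRHS]mulrDl lerD2l.
rewrite mulrAC ler_wpM2r ?exprn_ge0 // ler_wpM2l //.
by have := tail _ n0; rewrite subr_ge0.
Qed.

(** The estimates for primes concern the integer part N of x; these comparisons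
    move them to x. *)
Lemma ln_truncn_bounds (R : realType) (x : R) : 3 <= x ->
  [/\ (1 < Num.truncn x)%N, 2^-1 <= ln (Num.truncn x)%:R :> R, ln x <= 2 * ln (Num.truncn x)%:R,
     0 <= ln x - ln (Num.truncn x)%:R <= 1 & (Num.truncn x)%:R^-1 <= (ln (Num.truncn x)%:R)^-1 :> R].
Proof.
move=> x3; have x1 : 1 <= x by lra.
have [n0 nx xn] := truncn_bounds x1.
have n2 : (1 < Num.truncn x)%N by rewrite truncn_ge_nat ?ler0n //; lra.
set N := Num.truncn x in n0 nx xn n2 *.
have N2 : 2 <= N%:R :> R by rewrite ler_nat.
have N0 : 0 < N%:R :> R by lra.
have xl : 0 < x by lra.
have half : 2^-1 <= ln (N%:R : R).
  apply: (@le_trans _ _ (ln 2)); last by rewrite ler_ln ?posrE.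
  have := @ln_leB1 R 2^-1; rewrite lnV ?posrE // => h.
  by have := h _; lra.
have lnN0 : 0 < ln (N%:R : R) by lra.
have h1 : ln x - ln N%:R <= x / N%:R - 1.
  by rewrite -ln_div ?posrE // ln_leB1 // divr_gt0.
have h2 : x / N%:R <= 2 by rewrite ler_pdivrMr.
have h3 : ln N%:R <= ln x by rewrite ler_ln ?posrE.
split => //.
- apply: (@le_trans _ _ (ln (N%:R ^+ 2))); last by rewrite lnXn // mulr_natl.
  rewrite ler_ln ?posrE ?exprn_gt0 //; apply: le_trans xn _; rewrite expr2 ler_wpM2r //; lra.
- by apply/andP; split; lra.
- by rewrite lef_pV2 ?posrE // (le_trans (ln_leB1 N0)) //; lra.
Qed.

Lemma sum_inv_primes_le_lnln (R : realType) : exists C : R, 0 <= C /\ forall x, expR (expR 1) <= x ->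
  1 <= ln (ln x) /\
  \sum_(0 <= p < (Num.truncn x).+1 | prime p) p%:R^-1 <= C * ln (ln x).
Proof.
exists (15 + `|mertens R|); split; first by rewrite addr_ge0.
move=> x hx; have e1 : 2 <= expR 1 :> R by have := expR_ge1Dx (1 : R); lra.
have e2 : 3 <= expR (expR 1) :> R by have := expR_ge1Dx (expR 1 : R); lra.
have x3 := le_trans e2 hx; have [n1 n2 n3 /andP[n4 n5] n6] := ln_truncn_bounds x3.
have x0 : 0 < x by lra.
have lx : expR 1 <= ln x by rewrite -[expR 1]expRK ler_ln ?posrE ?expR_gt0.
have l1 : 1 <= ln (ln x).
  by rewrite -{1}(expRK 1) ler_ln ?posrE ?expR_gt0 // (lt_le_trans (expR_gt0 1)).
split=> //; have := mertens_second_explicit R n1; rewrite ler_norml => /andP[_].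
set S := \sum_(_ <= _ < _ | _) _; set N := Num.truncn x in n1 n2 n3 n4 n5 n6 *.
have h1 : ln (ln N%:R) <= ln (ln x) by rewrite ler_ln ?posrE //; lra.
have h2 : 7 / ln N%:R <= 14 :> R by rewrite ler_pdivrMr; lra.
have h3 : mertens R <= `|mertens R| by exact: ler_norm.
have h4 : `|mertens R| <= `|mertens R| * ln (ln x) by rewrite ler_peMr.
by rewrite mulrDl; lra.
Qed.

Lemma gcd_sum_asymp_3 (R : realType) (l : nat) :
  (fun x : R => gcd_sum (A_ell l) 3 x - Dbar R l 3 * x ^+ 3) =O_ (+oo_R)
  (fun x : R => x ^+ 2 * ln (ln x)).
Proof.
have [C [C0 hC]] := sum_inv_primes_le_lnln R.
have G0 : 0 <= jump_series l 2^-1 :> R by apply: jump_series_ge0; lra.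
apply: (@eqO_pinfty _ _ _ (4 * jump_series l 2^-1 + 3 * (2 * jump_series l 2^-1 * C)) (expR (expR 1))).
  by apply: addr_ge0; apply: mulr_ge0 => //; do 2! (apply: mulr_ge0 => //).
move=> x hx; have [l1 hS] := hC x hx.
have x1 : 1 <= x.
  by apply: le_trans hx; rewrite -(@expR0 R) ler_expR; exact: expR_ge0.
have x2 : 0 <= x ^+ 2 by apply: exprn_ge0; lra.
rewrite [X in _ <= _ * X]ger0_norm; last by rewrite mulr_ge0 //; lra.
apply: le_trans (gcd_sum_Dbar_error l 0 x1) _; rewrite [leRHS]mulrDl; apply: lerD.
  by rewrite ler_wpM2l ?mul_jump_half_ge0 // ler_peMr.
rewrite [leRHS](_ : _ = 3 * x ^+ 2 * (2 * jump_series l 2^-1 * (C * ln (ln x)))); last by ring.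
apply: ler_wpM2l; first exact: mulr_ge0.
apply: le_trans (ler_wpM2l _ hS); last exact: mul_jump_half_ge0.
rewrite mulr_sumr; apply: ler_sum => p pp; have /andP[_] := @D_term_bounds R l 1 p pp.
by rewrite expr1.
Qed.

Lemma lnln_truncn_dist (R : realType) (x : R) : 3 <= x ->
  0 <= ln (ln x) - ln (ln (Num.truncn x)%:R) <= (ln (Num.truncn x)%:R)^-1.
Proof.
move=> x3; have [n1 n2 n3 /andP[n4 n5] n6] := ln_truncn_bounds x3.
set b := ln (_%:R) in n2 n3 n4 n5 n6 *; set a := ln x in n2 n3 n4 n5 n6 *.
have b0 : 0 < b by lra.
have a0 : 0 < a by lra.
have h1 : ln b <= ln a by rewrite ler_ln ?posrE //; lra.
have h2 : ln a - ln b <= a / b - 1 by rewrite -ln_div ?posrE // ln_leB1 // divr_gt0.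
have h3 : a / b - 1 <= b^-1.
  have -> : a / b - 1 = (a - b) / b by field; rewrite gt_eqF.
  by rewrite -[leRHS]mul1r ler_wpM2r // invr_ge0 ltW.
by apply/andP; split; lra.
Qed.

(** With N the integer part of x, the four errors are: Mertens' theorem at N,
    log log x - log log N, the tail of the series of the prime_square_term (all
    O(1 / log x) relative to x^2), and the floors, which cost at most 2x times
    a sum of pi(N) bounded terms D_1(p). *)
Lemma gcd_sum_asymp_2 (R : realType) (l : nat) :
  (fun x : R => gcd_sum (A_ell l) 2 x - (x ^+ 2 * ln (ln x) + Dbar2 R l * x ^+ 2)) =O_ (+oo_R)
  (fun x : R => x ^+ 2 / ln x).
Proof.
pose G : R := jump_series l 2^-1.
have G0 : 0 <= G by apply: jump_series_ge0; lra.
have l4 : 0 <= ln 4 :> R by rewrite ln_ge0 // ler1n.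
(* In C1, 8 = 7 + 1 collects the errors of Mertens' theorem and of log log, 4 G
   that of the tail; the factor 2 passes from 1/log N to 1/log x.  In C2, the
   first 2 is k, 2 G bounds D_1(p), and 2 (2 + 2 log 4) comes from Chebyshev's
   bound, again with log x in place of log N. *)
pose C1 : R := 2 * (8 + 4 * G); pose C2 : R := 2 * (2 * G) * (2 * (2 + 2 * ln 4)).
have C10 : 0 <= C1 by rewrite /C1; lra.
have C20 : 0 <= C2 by rewrite /C2; apply: mulr_ge0; [apply: mulr_ge0 => //|]; lra.
apply: (@eqO_pinfty _ _ _ (C1 + C2) 3); first exact: addr_ge0.
move=> x x3; have x1 : 1 <= x by lra.
have x0 : 0 < x by lra.
have [n1 n2 n3 _ n6] := ln_truncn_bounds x3.
have [n0 nx xn] := truncn_bounds x1.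
have /andP[d1 d2] := lnln_truncn_dist x3.
have /andP[e1 e2] := gcd_sum_error l 0 x1.
have msm := mertens_second_explicit R n1.
set N := Num.truncn x in n0 n1 n2 n3 n6 nx xn d1 d2 e1 e2 msm *.
set L := ln (N%:R : R) in n2 n3 n6 d1 d2 msm *.
have L0 : 0 < L by lra.
have lx0 : 0 < ln x by rewrite ln_gt0 //; lra.
have iL : L^-1 <= 2 / ln x.
  by rewrite ler_pdivlMr // mulrC ler_pdivrMr.
have C40 : 0 <= 4 * G by lra.
have /andP[t1 t2] := @prime_sum_tail R (@prime_square_term R l) (4 * G) N n0 C40 (fun p pp => @prime_square_term_bounds R l p pp).
have split2 : \sum_(0 <= p < N.+1 | prime p) D_term l 2 p =
   \sum_(0 <= p < N.+1 | prime p) p%:R^-1 + \sum_(0 <= p < N.+1 | prime p) prime_square_term l p :> R.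
  by rewrite -big_split; apply: eq_bigr => p _; rewrite /= /prime_square_term addrC subrK.
have D1 : \sum_(0 <= p < N.+1 | prime p) D_term l 1 p <= 2 * G * (2 * (2 + 2 * ln 4) * (x / ln x)) :> R.
  apply: (@le_trans _ _ (2 * G * \sum_(0 <= p < N.+1 | prime p) 1)).
    rewrite mulr_sumr; apply: ler_sum => p pp; have /andP[_] := @D_term_bounds R l 0 p pp.
    by rewrite expr0 divr1 mulr1.
  rewrite ler_wpM2l //; first by lra.
  have := @chebyshev_upper R N n1; rewrite -/L -ler_pdivlMr // => /le_trans; apply.
  have -> : 2 * (2 + 2 * ln 4) * (x / ln x) = (2 + 2 * ln 4) * (x * (2 / ln x)) by ring.
  rewrite -mulrA ler_wpM2l //; first by lra.
  by apply: ler_pM => //; rewrite invr_ge0 ltW.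
rewrite [X in _ <= _ * X]ger0_norm; last by rewrite divr_ge0 ?exprn_ge0 // ltW.
set E := x ^+ 2 * \sum_(0 <= p < N.+1 | prime p) D_term l 2 p - _ in e1 e2.
have Eb : E <= C2 * (x ^+ 2 / ln x).
  apply: le_trans e2 _; rewrite expr1.
  have c : 0 <= 2 * x by lra.
  apply: le_trans (ler_wpM2l c D1) _; rewrite le_eqVlt; apply/orP; left; apply/eqP.
  by rewrite /C2; ring.
pose S : R := \sum_(0 <= p < N.+1 | prime p) p%:R^-1.
pose H : R := \sum_(0 <= p < N.+1 | prime p) prime_square_term l p.
have -> : gcd_sum (A_ell l) 2 x - (x ^+ 2 * ln (ln x) + Dbar2 R l * x ^+ 2) =
  x ^+ 2 * ((S - ln L - mertens R) - (ln (ln x) - ln L) - (prime_sum (@prime_square_term R l) - H)) - E.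
  by rewrite Dbar2_mertens /E split2 -/S -/H; ring.
set b := _ - _ - _; have bb : `|b| <= C1 / ln x.
  have m7 : `|S - ln L - mertens R| <= 7 / L by exact: msm.
  have t3 : 4 * G / N%:R <= 4 * G * L^-1 by rewrite ler_wpM2l.
  have t4 : (8 + 4 * G) * L^-1 <= C1 / ln x.
    have -> : C1 / ln x = (8 + 4 * G) * (2 / ln x) by rewrite /C1; ring.
    by rewrite ler_wpM2l //; lra.
  have t5 : (8 + 4 * G) * L^-1 = 7 / L + L^-1 + 4 * G * L^-1 by ring.
  move: m7 t1 t2; rewrite !ler_norml t5 -/H in t4 * => /andP[m1 m2] t1 t2.
  move: t1 t2 t3 t4 d1 d2 m1 m2; rewrite /b; clear.
  move: (4 * G / N%:R) (4 * G / L) (7 / L) (L^-1) (C1 / ln x) (ln (ln x) - ln L)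
    (prime_sum _ - H) (S - _ - _) => a1 a2 a3 a4 a5 a6 a7 a8 *.
  by apply/andP; split; lra.
have E0 : 0 <= E by [].
rewrite (le_trans (ler_normB _ _)) // normrM (ger0_norm (exprn_ge0 2 (ltW x0))) (ger0_norm E0).
rewrite mulrDl; apply: lerD => //.
rewrite [leRHS](_ : _ = x ^+ 2 * (C1 / ln x)); last by ring.
by rewrite ler_wpM2l ?exprn_ge0 // ltW.
Qed.

Lemma gcd_sum_estimates_A_ell (R : realType) (l : nat) :
  gcd_sum_estimates (A_ell l) (Dbar2 R l) (Dbar R l).
Proof.
split; first exact: gcd_sum_asymp_2.
move=> [|[|[|[|k]]]] // _ /=; first exact: gcd_sum_asymp_3.
by have := @gcd_sum_asymp_ge4 R l k; rewrite -[k.+3]/(k.+4 - 1)%N.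
Qed.

(** * The numerical value of the constant for l = 1 *)

(** For n >= M the term 1/n^2 lies between 1/n - 1/(n+1) and 1/(n-1/2) -
    1/(n+1/2); the midpoint form of the upper bound makes the two bounds differ
    by only about 1/(2 M^2). *)
Lemma basel_bounds (R : realType) : exists Z : R,
  (fun N => \sum_(0 <= n < N) n%:R ^- 2) @ \oo --> Z /\
  forall M, (0 < M)%N -> \sum_(0 <= n < M) n%:R ^- 2 + M%:R^-1 <= Z <=
    \sum_(0 <= n < M) n%:R ^- 2 + 2 / (2 * M%:R - 1).
Proof.
pose T (n : nat) : R := 2 / (2 * n%:R - 1).
have T0 n : (0 < n)%N -> 0 <= T n.
  by move=> n0; rewrite divr_ge0 //; have : 1 <= n%:R :> R by [rewrite ler1n]; lra.
have tail M n : (0 < M)%N -> (M <= n)%N -> \sum_(M <= i < n) i%:R ^- 2 <= T M - T n.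
  move=> M0 Mn; apply: ler_sum_telescope => // i /andP[Mi _].
  have i1 : 1 <= i%:R :> R by rewrite ler1n; lia.
  rewrite /T -[i.+1%:R]natr1.
  have -> : 2 / (2 * i%:R - 1) - 2 / (2 * (i%:R + 1) - 1) = (i%:R ^+ 2 - 4^-1)^-1 :> R.
    by field; rewrite !gt_eqF //; nra.
  by rewrite lef_pV2 ?posrE; nra.
have ge0 (n : nat) : 0 <= n%:R ^- 2 :> R by rewrite invr_ge0 exprn_ge0.
have Zc : cvgn (fun N => \sum_(0 <= n < N) n%:R ^- 2 : R).
  apply: (@nondecreasing_bounded_cvgn _ _ (0 + T 1%N)) => n; first exact: ler_sum_nat_widen.
  apply: le_trans (ler_sum_nat_widen (n := n.+1) _ _ _) _ => //.
  rewrite big_ltn // expr0n invr0 lerD2l; apply: le_trans (tail 1%N n.+1 isT _) _ => //.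
  by rewrite gerBl T0.
exists (limn (fun N => \sum_(0 <= n < N) n%:R ^- 2 : R)); split => // M M0.
apply/andP; split; last first.
  apply: (cvgn_le (N := M) Zc) => n Mn; rewrite (@big_cat_nat _ _ _ M 0 n) //= lerD2l.
  by apply: le_trans (tail M n M0 Mn) _; rewrite gerBl T0 // (leq_trans M0).
have h : (fun N => \sum_(0 <= n < M) n%:R ^- 2 + (M%:R^-1 - (N%:R^-1 : R))) @ \oo -->
    \sum_(0 <= n < M) n%:R ^- 2 + (M%:R^-1 - (0 : R)).
  apply: cvgD; first exact: cvg_cst.
  apply: cvgB; first exact: cvg_cst.
  apply: (cvgn_of_shift (d := 1%N)); apply: cvgn_ext (@inv_succ_cvg0 R) => n.
  by rewrite addn1.
rewrite subr0 in h; apply: (ler_cvg_to h Zc); near=> N.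
have MN : (M <= N)%N by near: N; exists M.
rewrite (@big_cat_nat _ _ _ M 0 N) //= lerD2l.
rewrite -[leLHS]opprK opprB -(telescope_sumr (fun n => n%:R^-1 : R) MN) -sumrN.
apply: ler_sum_nat => i /andP[Mi _]; rewrite opprB.
have i0 : 0 < i%:R :> R by rewrite ltr0n; lia.
rewrite -[i.+1%:R]natr1.
have -> : i%:R^-1 - (i%:R + 1)^-1 = (i%:R * (i%:R + 1))^-1 :> R.
  by field; rewrite !gt_eqF //; lra.
by rewrite lef_pV2 ?posrE; nra.
Unshelve. all: by end_near. Qed.

(** The logarithm is 2 artanh(1/p).  As p/(p^2-1) = 1/p + 1/p^3 + ... and
    artanh(1/p) = 1/p + 1/(3p^3) + ..., the gap is of order p^-3. *)
Definition artanh_gap {R : realType} (p : nat) : R :=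
  p%:R / (p%:R ^+ 2 - 1) - 2^-1 * ln ((p%:R + 1) / (p%:R - 1)).

Lemma artanh_gap_bounds (R : realType) (p : nat) : (1 < p)%N ->
  0 <= (artanh_gap p : R) <= 2 / ((p%:R - 1) * (p%:R + 1) ^+ 2).
Proof.
move=> p1; have p2 : 2 <= p%:R :> R by rewrite ler_nat.
set x : R := p%:R in p2 *; rewrite /artanh_gap -/x.
(* 1 - w = (p-1)/(p+1), so that the logarithm is a value of the logarithmic
   series; p/(p^2-1) is half of the sum of its first two terms and of a
   remainder slightly larger than the bound for its own. *)
pose w : R := 2 / (x + 1).
have w01 : 0 <= w < 1 by rewrite divr_ge0 //= ?ltr_pdivrMr; lra.
have e : - ln (1 - w) = ln ((x + 1) / (x - 1)).
  rewrite -lnV ?posrE ?subr_gt0; last by case/andP: w01.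
  by congr ln; rewrite /w; field; rewrite !gt_eqF //; lra.
have := ln1B_bounds 2 w01; rewrite e unlock /= expr1 divr1 addr0; set L := ln _.
have x1 : 0 < x - 1 by lra.
have x2 : 0 < x + 1 by lra.
have x3 : 0 < x ^+ 2 - 1 by nra.
have e1 : x / (x ^+ 2 - 1) = 2^-1 * (w + w ^+ 2 / 2 + w ^+ 3 / (2 * (1 - w))).
  by rewrite /w; field; rewrite !gt_eqF //; nra.
have w1 : 0 < 1 - w by rewrite subr_gt0; case/andP: w01.
have e2 : w ^+ 3 / (3 * (1 - w)) = w ^+ 3 / (2 * (1 - w)) - w ^+ 3 / (6 * (1 - w)).
  by field; rewrite gt_eqF.
have e3 : 0 <= w ^+ 3 / (6 * (1 - w)).
  have w0 : 0 <= w by case/andP: w01.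
  by apply: divr_ge0; [exact: exprn_ge0|apply: mulr_ge0 => //; exact: ltW].
have e4 : 2^-1 * (w ^+ 3 / (2 * (1 - w))) = 2 / ((x - 1) * (x + 1) ^+ 2).
  by rewrite /w; field; rewrite !gt_eqF //; nra.
rewrite -e4 e1 e2 => /andP[h1 h2].
by apply/andP; split; lra.
Qed.

(** (1-1/p)^2 = (1-1/p^2) (p-1)/(p+1): half of the logarithm of 1-1/p^2 and an
    artanh make up log(1-1/p).  By Euler's product, the former add up to -(log
    zeta(2))/2. *)
Lemma D2_term1E (R : realType) (p : nat) : prime p ->
  D2_term 1 p = artanh_gap p - 2^-1 * - ln (1 - p%:R ^- 2) :> R.
Proof.
move=> pp; have p2 : 2 <= p%:R :> R by rewrite ler_nat prime_gt1.
rewrite /D2_term eulerian_sumE eulerian_poly1 /artanh_gap; set x : R := p%:R in p2 *.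
have x1 : 0 < x - 1 by lra.
have x2 : 0 < x + 1 by lra.
have x3 : 0 < x ^+ 2 - 1 by nra.
have x0 : 0 < x by lra.
have -> : 1 - x^-1 = (x - 1) / x by field; rewrite gt_eqF.
have -> : 1 - x ^- 2 = (x - 1) / x * ((x + 1) / x) by field; rewrite gt_eqF.
rewrite !lnM ?posrE ?divr_gt0 ?invr_gt0 // !lnV ?posrE //.
rewrite mulr1 expr1.
have -> : x^-1 / ((x - 1) / x * ((x + 1) / x)) = x / (x ^+ 2 - 1).
  by field; rewrite !gt_eqF.
by field; rewrite gt_eqF.
Qed.

(** The gaps at p >= Q are at most 2/((Q-1) p^2), whence a quadratic tail
    bound. *)
Lemma Dbar2_1_bounds (R : realType) (Q : nat) (Z : R) : (1 < Q)%N ->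
  (fun N => \sum_(0 <= n < N) n%:R ^- 2) @ \oo --> Z ->
  0 <= Dbar2 R 1 - (euler_gamma R + \sum_(0 <= p < Q | prime p) artanh_gap p - 2^-1 * ln Z)
    <= 2 / (Q%:R - 1) ^+ 2.
Proof.
move=> Q1 Zc; have Q1' : 0 < Q%:R - 1 :> R by rewrite subr_gt0 ltr1n.
have lc : prime_partial_sum (fun p => - ln (1 - p%:R ^- 2)) @ \oo --> ln Z.
  apply: (euler_product_cvg (f := fun n => n%:R ^- 2)) => //.
  - by rewrite expr0n invr0.
  - by rewrite expr1n invr1.
  - by move=> m n; rewrite natrM exprMn invfM.
  - move=> p pp; rewrite invf_lt1 ?exprn_gt0 ?ltr0n ?prime_gt0 //.
    by rewrite exprn_egt1 // ltr1n prime_gt1.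
have Dc : prime_partial_sum (@D2_term R 1) @ \oo --> Dbar2 R 1 - euler_gamma R.
  have -> : Dbar2 R 1 - euler_gamma R = prime_sum (@D2_term R 1) by rewrite /Dbar2 addrC addKr.
  by apply/cvg_ex; eexists; exact: D2_term_partial_cvg.
have gc : (fun N => prime_partial_sum (@artanh_gap R) N - \sum_(0 <= p < Q | prime p) artanh_gap p) @ \oo -->
   Dbar2 R 1 - euler_gamma R + 2^-1 * ln Z - \sum_(0 <= p < Q | prime p) artanh_gap p.
  apply: cvgB; last exact: cvg_cst.
  have : (fun N => prime_partial_sum (@D2_term R 1) N + 2^-1 * prime_partial_sum (fun p => - ln (1 - p%:R ^- 2)) N)
     @ \oo --> Dbar2 R 1 - euler_gamma R + 2^-1 * ln Z.
    by apply: cvgD => //; exact: cvgn_scale.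
  apply: cvgn_ext => N; rewrite /prime_partial_sum mulr_sumr -big_split; apply: eq_bigr => p pp /=.
  by rewrite D2_term1E // subrK.
have -> : Dbar2 R 1 - (euler_gamma R + \sum_(0 <= p < Q | prime p) artanh_gap p - 2^-1 * ln Z) =
  Dbar2 R 1 - euler_gamma R + 2^-1 * ln Z - \sum_(0 <= p < Q | prime p) artanh_gap p by ring.
apply/andP; split.
  apply: (cvgn_ge (N := Q) gc) => n Qn; rewrite subr_ge0; apply: ler_sum_nat_widen => // p _ pp.
  by have /andP[] := artanh_gap_bounds R (prime_gt1 pp).
apply: (cvgn_le (N := Q) gc) => n Qn; rewrite /prime_partial_sum (@big_cat_nat _ _ _ Q 0 n) //=.
rewrite addrAC subrr add0r expr2 invfM mulrA; apply: ler_sum_prime_tail => //.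
  by rewrite divr_ge0 // ltW.
move=> p Qp pp; have /andP[_ h] := artanh_gap_bounds R (prime_gt1 pp); apply: le_trans h _.
have p2 : 2 <= p%:R :> R by rewrite ler_nat prime_gt1.
have Qp' : Q%:R <= p%:R :> R by rewrite ler_nat.
rewrite -mulrA ler_wpM2l // -invfM lef_pV2 ?posrE ?mulr_gt0 ?exprn_gt0 //; try lra.
by apply: ler_pM; rewrite ?exprn_ge0 //; try lra; rewrite lerXn2r // nnegrE; lra.
Qed.

Local Notation nadd := BinNat.N.add.
Local Notation nmul := BinNat.N.mul.
Local Notation ndiv := BinNat.N.div.
Local Notation npow := BinNat.N.pow.
Local Notation nleb := BinNat.N.leb.
Local Notation nltb := BinNat.N.ltb.
Local Notation nofn := BinNat.N.of_nat.
Local Notation nzero := BinNums.N0.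

(** Binary integers are used for the computation, and this embedding transfers
    its inequalities to R. *)
Definition N2R {R : realType} (x : BinNums.N) : R := (BinNat.N.to_nat x)%:R.

Lemma N2R_of_nat (R : realType) (n : nat) : N2R (nofn n) = n%:R :> R.
Proof. by rewrite /N2R Nnat.Nat2N.id. Qed.

Lemma N2R_add (R : realType) (a b : BinNums.N) : N2R (nadd a b) = N2R a + N2R b :> R.
Proof. by rewrite /N2R Nnat.N2Nat.inj_add -natrD. Qed.

Lemma N2R_mul (R : realType) (a b : BinNums.N) : N2R (nmul a b) = N2R a * N2R b :> R.
Proof. by rewrite /N2R Nnat.N2Nat.inj_mul -natrM. Qed.

Lemma N2R_ge0 (R : realType) (a : BinNums.N) : 0 <= N2R a :> R.
Proof. exact: ler0n. Qed.

Lemma N2R_le (R : realType) (a b : BinNums.N) : nleb a b -> N2R a <= N2R b :> R.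
Proof. by move=> /BinNat.N.leb_spec0 h; rewrite /N2R ler_nat; apply/ssrnat.leP; lia. Qed.

Lemma N2R_gt0 (R : realType) (a : BinNums.N) : nltb nzero a -> 0 < N2R a :> R.
Proof. by move=> /BinNat.N.ltb_spec0 h; rewrite /N2R ltr0n; apply/ssrnat.ltP; lia. Qed.

Lemma N2R_pow (R : realType) (a : BinNums.N) (i : nat) : N2R (npow a (nofn i)) = N2R a ^+ i :> R.
Proof.
elim: i => [|i IH]; first by rewrite expr0.
by rewrite Nnat.Nat2N.inj_succ BinNat.N.pow_succ_r' N2R_mul IH exprS.
Qed.

Lemma N2R_div_bounds (R : realType) (a b : BinNums.N) : nltb nzero b ->
  N2R (ndiv a b) <= (N2R a / N2R b : R) <= N2R (ndiv a b) + 1.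
Proof.
move=> b0; have b0' := @N2R_gt0 R b b0; rewrite ler_pdivlMr // ler_pdivrMr //.
have -> : N2R (ndiv a b) + 1 = N2R (nadd (ndiv a b) (nofn 1)) :> R by rewrite N2R_add N2R_of_nat.
rewrite -!N2R_mul; move/BinNat.N.ltb_spec0 in b0; apply/andP; split; apply: N2R_le; apply/BinNat.N.leb_spec0.
  by rewrite BinNat.N.mul_comm; apply: BinNat.N.Div0.mul_div_le.
have h : b <> nzero by move=> e; rewrite e in b0.
have := @BinNat.N.mul_succ_div_gt a b h; rewrite /=; lia.
Qed.

(** Integer approximation of S times the sum of the a i / b i: each term is
    rounded down, so that the error is at most the number of terms. *)
Definition floor_sum (S : BinNums.N) (a b : nat -> BinNums.N) (l : seq nat) : BinNums.N :=
  foldr (fun i acc => nadd (ndiv (nmul S (a i)) (b i)) acc) nzero l.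

Lemma floor_sum_bounds (R : realType) (S : BinNums.N) (a b : nat -> BinNums.N) (l : seq nat) :
  all (fun i => nltb nzero (b i)) l ->
  N2R (floor_sum S a b l) <= N2R S * (\sum_(i <- l) N2R (a i) / N2R (b i) : R) <=
    N2R (floor_sum S a b l) + (size l)%:R.
Proof.
elim: l => [_|i l IH] /=; first by rewrite big_nil mulr0 addr0 lexx.
case/andP => bi /IH /andP[h1 h2]; rewrite big_cons N2R_add mulrDr -natr1.
have /andP[h3 h4] := @N2R_div_bounds R (nmul S (a i)) _ bi; rewrite N2R_mul -mulrA in h3 h4.
by apply/andP; split; lra.
Qed.

Definition prodN (f : nat -> nat) (l : seq nat) : BinNums.N :=
  foldr (fun p acc => nmul (nofn (f p)) acc) (nofn 1) l.

Lemma prodN_E (R : realType) (f : nat -> nat) (l : seq nat) :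
  N2R (prodN f l) = \prod_(p <- l) (f p)%:R :> R.
Proof.
elim: l => [|p l IH]; first by rewrite big_nil; exact: (N2R_of_nat R 1).
rewrite /=.
by rewrite big_cons N2R_mul IH N2R_of_nat.
Qed.

(** Integer approximation of S times the first M terms of the series of
    -log(1-z) at z = a/b. *)
Definition log_terms (S : BinNums.N) (a b : BinNums.N) (M : nat) : BinNums.N :=
  floor_sum S (fun i => npow a (nofn i)) (fun i => nmul (nofn i) (npow b (nofn i))) (iota 1 M).

(** With c = b - a, so that c/b = 1-z, the last clause says that S times the
    remainder of the series after M terms is at most 1; it adds to the M
    roundings. *)
Definition log_check (S a b c : BinNums.N) (M : nat) : bool :=
  [&& nltb nzero b, nltb nzero c, BinNat.N.eqb (nadd a c) b,
    all (fun i => nltb nzero (nmul (nofn i) (npow b (nofn i)))) (iota 1 M) &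
    nleb (nmul S (npow a (nofn M.+1))) (nmul (nofn M.+1) (nmul (npow b (nofn M)) c))].

Lemma log_terms_bounds (R : realType) (S a b c : BinNums.N) (M : nat) :
  log_check S a b c M ->
  N2R (log_terms S a b M) <= N2R S * (- ln (N2R c / N2R b) : R) <= N2R (log_terms S a b M) + M.+1%:R.
Proof.
move=> /and5P[b0 c0 abc all0 rem].
have b0' := @N2R_gt0 R b b0; have c0' := @N2R_gt0 R c c0; have a0 := @N2R_ge0 R a.
have e : N2R b = N2R a + N2R c :> R.
  by move/BinNat.N.eqb_eq: abc => <-; rewrite N2R_add.
pose z : R := N2R a / N2R b.
have cz : N2R c / N2R b = 1 - z by rewrite /z; move: b0'; rewrite e => h; field; rewrite gt_eqF.
have z01 : 0 <= z < 1.
  by rewrite divr_ge0 ?(ltW b0') //= ltr_pdivrMr // mul1r e ltrDl.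
have S0 := @N2R_ge0 R S.
have /andP[h1 h2] := ln1B_bounds M z01; rewrite -cz in h1 h2.
have se : \sum_(i <- iota 1 M) N2R (npow a (nofn i)) / N2R (nmul (nofn i) (npow b (nofn i))) =
   \sum_(1 <= m < M.+1) z ^+ m / m%:R :> R.
  rewrite /index_iota subSS subn0; apply: eq_bigr => i _.
  by rewrite N2R_mul !N2R_pow N2R_of_nat /z expr_div_n invfM mulrA mulrAC.
have /andP[] := @floor_sum_bounds R S (fun i => npow a (nofn i)) _ _ all0; rewrite se size_iota -/(log_terms S a b M) => h3 h4.
have remR : N2R S * (z ^+ M.+1 / (M.+1%:R * (N2R c / N2R b))) <= 1.
  have := @N2R_le R _ _ rem; rewrite !N2R_mul !N2R_pow !N2R_of_nat => h.
  have -> : N2R S * (z ^+ M.+1 / (M.+1%:R * (N2R c / N2R b))) =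
     N2R S * N2R a ^+ M.+1 / (M.+1%:R * (N2R b ^+ M * N2R c)).
    rewrite /z; move: b0' c0' (ltr0Sn R M); clear; move: (N2R S) (N2R a) (N2R b) (N2R c) (M.+1%:R : R) => s A B C m B0 C0 m0.
    rewrite expr_div_n [in B ^+ M.+1]exprS; field.
    by rewrite !gt_eqF ?exprn_gt0.
  rewrite ler_pdivrMr ?mul1r //.
  by apply: mulr_gt0; [exact: ltr0Sn|apply: mulr_gt0 => //; exact: exprn_gt0].
apply/andP; split; first by apply: le_trans h3 _; rewrite ler_wpM2l.
apply: le_trans (ler_wpM2l S0 h2) _; rewrite mulrDr.
by apply: le_trans (lerD h4 remR) _; rewrite -addrA natr1.
Qed.

(* The scale is 10^6 2^21.  It makes exact the thresholds 9659/20000 and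
   9661/20000, the correction 1/2048 and the error 1/2^21 for Euler's constant
   at n = 1024, and the tail bound 51/10^6. *)
Definition scale : BinNums.N := nmul (nmul (nofn 1000) (nofn 1000)) (nmul (nofn 1024) (nofn 2048)).
Definition primes200 : seq nat := [seq p <- index_iota 0 200 | prime p].
Definition harmonic_floor : BinNums.N := floor_sum scale (fun=> nofn 1) nofn (iota 1 1024).
Definition basel_floor : BinNums.N :=
  floor_sum scale (fun=> nofn 1) (fun i => nmul (nofn i) (nofn i)) (iota 1 199).
Definition prime_floor : BinNums.N :=
  floor_sum scale nofn (fun p => nmul (nofn p.-1) (nofn p.+1)) primes200.
Definition succ_prod : BinNums.N := prodN succn primes200.
Definition pred_prod : BinNums.N := prodN predn primes200.
(* The logarithms of zeta(2) and of the ratios (p+1)/(p-1), p < 200, are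
   combined into the logarithm of a single number, which is 64/(1-z) with z
   between 0.309689 and 0.309695: 64 is a power of 2 and z is small enough for
   a fast logarithmic series.  The two other integers are the numerators of
   1-z. *)
Definition million : BinNums.N := npow (nofn 10) (nofn 6).
Definition z_hi : BinNums.N := nadd (nmul (nofn 309) (nofn 1000)) (nofn 695).
Definition z_hi_compl : BinNums.N := nadd (nmul (nofn 690) (nofn 1000)) (nofn 305).
Definition z_lo : BinNums.N := nadd (nmul (nofn 309) (nofn 1000)) (nofn 689).
Definition z_lo_compl : BinNums.N := nadd (nmul (nofn 690) (nofn 1000)) (nofn 311).
(** For zeta(2), 399 = 2*200 - 1 is the denominator of the upper bound of its
    tail at 200, and 199 the number of roundings. *)
Lemma check_upper_log :
  nleb (nmul (nadd (nmul (nadd basel_floor (nofn 199)) (nofn 399)) (nmul (nofn 2) scale)) (nmul succ_prod z_hi_compl))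
       (nmul (nmul (nofn 64) (nmul million pred_prod)) (nmul scale (nofn 399))).
Proof. by vm_compute. Qed.

Lemma check_lower_log :
  nleb (nmul (nmul (nofn 64) (nmul million pred_prod)) (nmul scale (nofn 200)))
       (nmul (nadd (nmul basel_floor (nofn 200)) scale) (nmul succ_prod z_lo_compl)).
Proof. by vm_compute. Qed.

Definition two21 : BinNums.N := nmul (nofn 1024) (nofn 2048).
Definition ten6 : BinNums.N := nmul (nofn 1000) (nofn 1000).

(** Twice the constant is 2 H - 2 log 1024 - 1/1024 + 2 Q - (6 log 2 -
    log(1-z)), up to the errors, with H the harmonic number and Q the sum of
    p/(p^2-1).  Hence the coefficient 26 = 20 + 6 of log 2; the integers 46 and
    31 are the accuracies of the two logarithms. *)
Lemma check_lower :
  nleb (nadd (nadd (nmul (nofn 26) (nadd (log_terms scale (nofn 1) (nofn 2) 45) (nofn 46))) (nadd (log_terms scale z_hi million 30) (nofn 31)))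
     (nmul (nofn 2) (nadd (nmul (nofn 9659) (nmul (nofn 50) two21)) (nadd (nmul (nofn 1024) ten6) ten6))))
    (nmul (nofn 2) (nadd harmonic_floor prime_floor)).
Proof. by vm_compute. Qed.

(** Here 1024 and 46 are the numbers of roundings in H and in the sum over the
    46 primes below 200, and 51 stands for the tail over the larger primes. *)
Lemma check_upper :
  nleb (nmul (nofn 2) (nadd (nadd harmonic_floor (nofn 1024)) (nadd (nadd prime_floor (nofn 46))
       (nadd ten6 (nmul (nofn 51) two21)))))
   (nadd (nadd (nmul (nofn 26) (log_terms scale (nofn 1) (nofn 2) 45)) (log_terms scale z_lo million 30))
     (nmul (nofn 2) (nadd (nmul (nofn 9661) (nmul (nofn 50) two21)) (nmul (nofn 1024) ten6)))).
Proof. by vm_compute. Qed.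

Lemma check_ln2 : log_check scale (nofn 1) (nofn 2) (nofn 1) 45.
Proof. by vm_compute. Qed.

Lemma check_z_hi : log_check scale z_hi million z_hi_compl 30.
Proof. by vm_compute. Qed.

Lemma check_z_lo : log_check scale z_lo million z_lo_compl 30.
Proof. by vm_compute. Qed.

Lemma size_primes200 : size primes200 = 46%N.
Proof. by vm_compute. Qed.

Lemma primes200_gt1 : {in primes200, forall p, (1 < p)%N}.
Proof. by move=> p; rewrite mem_filter => /andP[/prime_gt1]. Qed.

Lemma nltb_nofn (n : nat) : (0 < n)%N -> nltb nzero (nofn n).
Proof. by move=> n0; apply/BinNat.N.ltb_spec0; lia. Qed.

Lemma nltb_nmul (a b : BinNums.N) : nltb nzero a -> nltb nzero b -> nltb nzero (nmul a b).
Proof.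
move=> /BinNat.N.ltb_spec0 ha /BinNat.N.ltb_spec0 hb; apply/BinNat.N.ltb_spec0; nia.
Qed.

Lemma floor_sum_harmonic (R : realType) (S : BinNums.N) (n : nat) :
  let h := N2R (floor_sum S (fun=> nofn 1) nofn (iota 1 n)) : R in
  (h <= N2R S * harmonic_number n <= h + n%:R).
Proof.
have h : all (fun i => nltb nzero (nofn i)) (iota 1 n).
  by apply/allP => i; rewrite mem_iota => /andP[i1 _]; exact: nltb_nofn.
have := @floor_sum_bounds R S (fun=> nofn 1) nofn (iota 1 n) h; rewrite size_iota.
rewrite (eq_bigr (fun i : nat => (i%:R^-1 : R))) => [|i _].
  by rewrite /harmonic_number /index_iota subSS subn0.
by rewrite !N2R_of_nat div1r.
Qed.

Lemma floor_sum_basel (R : realType) (S : BinNums.N) (n : nat) :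
  let b := N2R (floor_sum S (fun=> nofn 1) (fun i => nmul (nofn i) (nofn i)) (iota 1 n)) : R in
  (b <= N2R S * (\sum_(0 <= i < n.+1) i%:R ^- 2) <= b + n%:R).
Proof.
have h : all (fun i => nltb nzero (nmul (nofn i) (nofn i))) (iota 1 n).
  by apply/allP => i; rewrite mem_iota => /andP[i1 _]; apply: nltb_nmul; exact: nltb_nofn.
have := @floor_sum_bounds R S (fun=> nofn 1) (fun i => nmul (nofn i) (nofn i)) (iota 1 n) h.
rewrite size_iota (eq_bigr (fun i : nat => (i%:R ^- 2 : R))) => [|i _].
  by rewrite [in X in _ -> X]big_ltn // expr0n invr0 add0r /index_iota subSS subn0.
by rewrite N2R_mul !N2R_of_nat div1r expr2.
Qed.

Lemma floor_sum_primes (R : realType) (S : BinNums.N) (l : seq nat) (m : nat) :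
  {in l, forall p, (1 < p)%N} -> size l = m ->
  let q := N2R (floor_sum S nofn (fun p => nmul (nofn p.-1) (nofn p.+1)) l) : R in
  (q <= N2R S * (\sum_(p <- l) p%:R / (p%:R ^+ 2 - 1)) <= q + m%:R).
Proof.
move=> l1 <-; have h : all (fun p => nltb nzero (nmul (nofn p.-1) (nofn p.+1))) l.
  apply/allP => p /l1 p1; apply: nltb_nmul; apply: nltb_nofn => //; lia.
have := @floor_sum_bounds R S nofn _ _ h.
rewrite big_seq (eq_bigr (fun p : nat => (p%:R / (p%:R ^+ 2 - 1) : R))) => [|p pp]; first by rewrite -big_seq.
have p1 := l1 p pp; case: p p1 {pp} => // p _.
rewrite N2R_mul !N2R_of_nat /= -natr1; congr (_ / _).
by rewrite -[p.+2%:R]natr1 -[p.+1%:R]natr1; ring.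
Qed.

(** The logarithms of all the ratios add up to that of one quotient of
    integers, so that no logarithm has to be evaluated prime by prime. *)
Lemma sum_artanh_gap_seq (R : realType) (l : seq nat) : {in l, forall p, (1 < p)%N} ->
  \sum_(p <- l) artanh_gap p =
  \sum_(p <- l) p%:R / (p%:R ^+ 2 - 1)
    - 2^-1 * (ln (N2R (prodN succn l)) - ln (N2R (prodN predn l))) :> R.
Proof.
move=> l1; rewrite !prodN_E.
have pos (f : nat -> nat) : (forall p, (1 < p)%N -> (0 < f p)%N) ->
    ln (\prod_(p <- l) (f p)%:R) = \sum_(p <- l) ln (f p)%:R :> R.
  move=> fp; rewrite -natr_prod big_seq ln_prod_nat; first by rewrite -big_seq.
  by move=> p /l1; exact: fp.
rewrite !pos //; last by case=> [|[|]].
rewrite -sumrB mulr_sumr -sumrB [LHS]big_seq [RHS]big_seq; apply: eq_bigr => p /l1.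
case: p => [//|[//|p]] _; rewrite /artanh_gap /=.
rewrite -ln_div ?posrE ?ltr0n // natr1.
by have -> : p.+1%:R = p.+2%:R - 1 :> R by rewrite -[p.+2%:R]natr1 addrK.
Qed.

Lemma harmonic_floor_bounds (R : realType) :
  N2R harmonic_floor <= N2R scale * (harmonic_number 1024 : R) <= N2R harmonic_floor + 1024.
Proof. exact: (@floor_sum_harmonic R scale 1024). Qed.

Lemma basel_floor_bounds (R : realType) :
  N2R basel_floor <= N2R scale * (\sum_(0 <= n < 200) n%:R ^- 2 : R) <= N2R basel_floor + 199.
Proof. exact: (@floor_sum_basel R scale 199). Qed.

Lemma prime_floor_bounds (R : realType) :
  N2R prime_floor <= N2R scale * (\sum_(p <- primes200) p%:R / (p%:R ^+ 2 - 1) : R) <=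
   N2R prime_floor + 46.
Proof. exact: (@floor_sum_primes R scale primes200 46 primes200_gt1 size_primes200). Qed.

Lemma sum_artanh_gap200 (R : realType) :
  \sum_(0 <= p < 200 | prime p) artanh_gap p =
  \sum_(p <- primes200) p%:R / (p%:R ^+ 2 - 1) - 2^-1 * (ln (N2R succ_prod) - ln (N2R pred_prod)) :> R.
Proof.
rewrite /succ_prod /pred_prod -(@sum_artanh_gap_seq R primes200 primes200_gt1).
by rewrite /primes200 big_filter.
Qed.

Lemma log_terms_ln2 (R : realType) (S : BinNums.N) (M : nat) :
  log_check S (nofn 1) (nofn 2) (nofn 1) M ->
  N2R (log_terms S (nofn 1) (nofn 2) M) <= N2R S * (ln 2 : R) <=
    N2R (log_terms S (nofn 1) (nofn 2) M) + M.+1%:R.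
Proof.
by move=> /(@log_terms_bounds R); rewrite !(N2R_of_nat _ 1) (N2R_of_nat _ 2) div1r lnV ?posrE // opprK.
Qed.

(** This and the three following lemmas restate the checks in R for arbitrary
    integers: with variables in place of the large closed terms, rewriting and
    unification do not evaluate them. *)
Lemma upper_log_check_real (R : realType) (S b P1 P0 m u : BinNums.N) :
  nleb (nmul (nadd (nmul (nadd b (nofn 199)) (nofn 399)) (nmul (nofn 2) S)) (nmul P1 u))
       (nmul (nmul (nofn 64) (nmul m P0)) (nmul S (nofn 399))) ->
  ((N2R b + 199) * 399 + 2 * N2R S) * (N2R P1 * N2R u) <= 64 * (N2R m * N2R P0) * (N2R S * 399) :> R.
Proof. by move=> /(@N2R_le R); rewrite !(N2R_mul, N2R_add, N2R_of_nat). Qed.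

Lemma lower_log_check_real (R : realType) (S b P1 P0 m l : BinNums.N) :
  nleb (nmul (nmul (nofn 64) (nmul m P0)) (nmul S (nofn 200)))
       (nmul (nadd (nmul b (nofn 200)) S) (nmul P1 l)) ->
  64 * (N2R m * N2R P0) * (N2R S * 200) <= (N2R b * 200 + N2R S) * (N2R P1 * N2R l) :> R.
Proof. by move=> /(@N2R_le R); rewrite !(N2R_mul, N2R_add, N2R_of_nat). Qed.

Lemma lower_check_real (R : realType) (h q l z k t : BinNums.N) :
  nleb (nadd (nadd (nmul (nofn 26) (nadd l (nofn 46))) (nadd z (nofn 31)))
     (nmul (nofn 2) (nadd (nmul (nofn 9659) (nmul (nofn 50) k)) (nadd (nmul (nofn 1024) t) t))))
    (nmul (nofn 2) (nadd h q)) ->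
  26 * (N2R l + 46) + (N2R z + 31) + 2 * (9659 * (50 * N2R k) + (1024 * N2R t + N2R t)) <=
    2 * (N2R h + N2R q) :> R.
Proof. by move=> /(@N2R_le R); rewrite !(N2R_mul, N2R_add, N2R_of_nat). Qed.

Lemma upper_check_real (R : realType) (h q l z k t : BinNums.N) :
  nleb (nmul (nofn 2) (nadd (nadd h (nofn 1024)) (nadd (nadd q (nofn 46))
       (nadd t (nmul (nofn 51) k)))))
   (nadd (nadd (nmul (nofn 26) l) z)
     (nmul (nofn 2) (nadd (nmul (nofn 9661) (nmul (nofn 50) k)) (nmul (nofn 1024) t)))) ->
  2 * (N2R h + 1024 + (N2R q + 46 + (N2R t + 51 * N2R k))) <=
  26 * N2R l + N2R z + 2 * (9661 * (50 * N2R k) + 1024 * N2R t) :> R.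
Proof. by move=> /(@N2R_le R); rewrite !(N2R_mul, N2R_add, N2R_of_nat). Qed.

(** From bounds on Z P1/P0, where Z is zeta(2), T the partial sum approximated
    by b/s, and P1/P0 the product of the (p+1)/(p-1), to bounds on its
    logarithm. *)
Lemma ln_window (R : realType) (s P1 P0 m u l b T Z : R) :
  0 < s -> 0 < P1 -> 0 < P0 -> 0 < m -> 0 < u -> 0 < l -> 0 < Z ->
  b <= s * T -> s * T <= b + 199 -> T + 200^-1 <= Z -> Z <= T + 2 / (2 * 200 - 1) ->
  ((b + 199) * 399 + 2 * s) * (P1 * u) <= 64 * (m * P0) * (s * 399) ->
  64 * (m * P0) * (s * 200) <= (b * 200 + s) * (P1 * l) ->
  6 * ln 2 - ln (l / m) <= ln Z + ln P1 - ln P0 <= 6 * ln 2 - ln (u / m).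
Proof.
move=> s0 P10 P00 m0 u0 l0 Z0 b1 b2 z1 z2 c1 c2.
have ln64 : 6 * ln 2 = ln 64 :> R.
  by rewrite mulr_natl -lnXn //; congr ln; ring.
rewrite ln64; apply/andP; split.
  have h : 64 * (m * P0) <= Z * (P1 * l).
    rewrite -(ler_pM2r (mulr_gt0 s0 (ltr0Sn R 199))); apply: le_trans c2 _.
    rewrite [leRHS](_ : _ = (Z * s * 200) * (P1 * l)); last by ring.
    rewrite ler_wpM2r ?mulr_ge0 ?(ltW P10) ?(ltW l0) //.
    have : (T + 200^-1) * s <= Z * s by rewrite ler_wpM2r // ltW.
    by rewrite mulrDl; lra.
  have : ln (64 * (m * P0)) <= ln (Z * (P1 * l)) by rewrite ler_ln ?posrE ?mulr_gt0.
  by rewrite !lnM ?lnV ?posrE ?mulr_gt0 ?invr_gt0 //; lra.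
have h : Z * (P1 * u) <= 64 * (m * P0).
  rewrite -(ler_pM2r (mulr_gt0 s0 (ltr0Sn R 398))); apply: le_trans c1.
  rewrite [leLHS](_ : _ = (Z * s * 399) * (P1 * u)); last by ring.
  rewrite ler_wpM2r ?mulr_ge0 ?(ltW P10) ?(ltW u0) //.
  have : Z * s <= (T + 2 / 399) * s.
    rewrite ler_wpM2r ?(ltW s0) //; apply: le_trans z2 _; rewrite lerD2l //.
    by rewrite (_ : 2 * 200 - 1 = 399) //; lra.
  by rewrite mulrDl; lra.
have : ln (Z * (P1 * u)) <= ln (64 * (m * P0)) by rewrite ler_ln ?posrE ?mulr_gt0.
by rewrite !lnM ?lnV ?posrE ?mulr_gt0 ?invr_gt0 //; lra.
Qed.

Lemma euler_factor_bounds (R : realType) (Z : R) : 0 < Z ->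
  (fun N => \sum_(0 <= n < N) n%:R ^- 2) @ \oo --> Z ->
  6 * ln 2 - ln (N2R z_lo_compl / N2R million) <= ln Z + ln (N2R succ_prod) - ln (N2R pred_prod)
    <= 6 * ln 2 - ln (N2R z_hi_compl / N2R million).
Proof.
move=> Z0 Zc; have [Z' [Zc' hZ]] := basel_bounds R.
rewrite -(cvgn_unique Zc Zc') in hZ; have /andP[z1 z2] := hZ 200%N isT.
have /andP[b1 b2] := basel_floor_bounds R.
have s0 : 0 < N2R scale :> R by apply: N2R_gt0; vm_compute.
have P10 : 0 < N2R succ_prod :> R by apply: N2R_gt0; vm_compute.
have P00 : 0 < N2R pred_prod :> R by apply: N2R_gt0; vm_compute.
have m0 : 0 < N2R million :> R by apply: N2R_gt0; vm_compute.
have u0 : 0 < N2R z_hi_compl :> R by apply: N2R_gt0; vm_compute.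
have l0 : 0 < N2R z_lo_compl :> R by apply: N2R_gt0; vm_compute.
have c1 := @upper_log_check_real R _ _ _ _ _ _ check_upper_log.
have c2 := @lower_log_check_real R _ _ _ _ _ _ check_lower_log.
exact: (ln_window s0 P10 P00 m0 u0 l0 Z0 b1 b2 z1 z2 c1 c2).
Qed.

Lemma cut200_tail_le (R : realType) : 2 / (200 - 1) ^+ 2 <= 51 / (1000 * 1000) :> R.
Proof. by rewrite ler_pdivrMr; [lra|apply: exprn_gt0; lra]. Qed.

(** The whole estimate in terms of real variables: L is log 2, ga Euler's
    constant, lZ the logarithm of zeta(2), and each capital H, Q, L is
    bracketed by the scaled integer of the same letter. *)
Lemma numeric_window (R : realType) (s h H q Q l L zu zl lu ll P1 P0 lZ ga D k t : R) :
  0 < s -> s = 1000 * 1000 * k -> s = 1024 * 2048 * t ->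
  0 <= D - (ga + (Q - 2^-1 * (P1 - P0)) - 2^-1 * lZ) ->
  D - (ga + (Q - 2^-1 * (P1 - P0)) - 2^-1 * lZ) <= 2 / (200 - 1) ^+ 2 ->
  6 * L - ll <= lZ + P1 - P0 -> lZ + P1 - P0 <= 6 * L - lu ->
  `|H - 10 * L - (2 * 1024)^-1 - ga| <= (2 * 1024 ^+ 2)^-1 ->
  h <= s * H -> s * H <= h + 1024 -> q <= s * Q -> s * Q <= q + 46 ->
  l <= s * L -> s * L <= l + 46 -> s * - lu <= zu + 31 -> zl <= s * - ll ->
  2 * (h + 1024 + (q + 46 + (t + 51 * k))) <= 26 * l + zl + 2 * (9661 * (50 * k) + 1024 * t) ->
  26 * (l + 46) + (zu + 31) + 2 * (9659 * (50 * k) + (1024 * t + t)) <= 2 * (h + q) ->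
  `|D - 4830 / 10 ^+ 4| <= 5 / 10 ^+ 5.
Proof.
move=> s0 sk st d1 d2 e1 e2 g h1 h2 q1 q2 l1 l2 u1 w1 c1 c2.
pose i1 : R := (2 * 1024)^-1; pose i2 : R := (2 * 1024 ^+ 2)^-1.
pose i3 : R := (1000 * 1000)^-1; pose i4 : R := (200 * 100)^-1.
have nz n : n.+1%:R != 0 :> R by rewrite pnatr_eq0.
have cancel a x : a != 0 -> a * x * a^-1 = x :> R by move=> a0; rewrite mulrC mulKf.
have e2048 : 2048 = 2 * 1024 :> R by rewrite -natrM.
have e1000 : 1000 = 200 * 5 :> R by rewrite -natrM.
have e1000' : 1000 = 20 * 50 :> R by rewrite -natrM.
have e100 : 100 = 5 * 20 :> R by rewrite -natrM.
have s1 : s * i1 = 1024 * t.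
  rewrite st /i1 e2048 [1024 * (2 * 1024)]mulrC -[_ * 1024 * t]mulrA.
  by apply: cancel; apply: mulf_neq0; exact: nz.
have s2 : s * i2 = t.
  rewrite st /i2 e2048 (_ : 1024 * (2 * 1024) = 2 * 1024 ^+ 2); last by rewrite expr2 mulrCA.
  by apply: cancel; apply: mulf_neq0; [exact: nz|apply: expf_neq0; exact: nz].
have s3 : s * i3 = k by rewrite sk /i3; apply: cancel; apply: mulf_neq0; exact: nz.
have s4 : s * i4 = 50 * k.
  rewrite sk /i4 {1}e1000 e1000' e100 -(cancel (200 * (5 * 20)) (50 * k)); last first.
    by apply: mulf_neq0; [|apply: mulf_neq0]; exact: nz.
  by congr (_ * _); rewrite !mulrA.
rewrite -/i1 -/i2 in g; move: g; rewrite ler_norml => /andP[g1 g2].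
have t2 : 2 / (200 - 1) ^+ 2 <= 51 * i3 := cut200_tail_le R.
(* 9659/20000 = 0.48295 and 9661/20000 = 0.48305 are the ends of the
   interval. *)
have low : 9659 * i4 <= D.
  have b : H - 10 * L - i1 - i2 + Q - 2^-1 * (6 * L - lu) <= D.
    by move: d1 e2 g2; clear; move: i1 i2 => *; lra.
  apply: le_trans b; rewrite -(ler_pM2l s0).
  rewrite [leLHS](_ : _ = 9659 * (s * i4)); last by ring.
  rewrite [leRHS](_ : _ = s * H - 10 * (s * L) - s * i1 - s * i2 + s * Q - 2^-1 * (6 * (s * L) + s * - lu)); last by ring.
  by rewrite s1 s2 s4; move: h1 q1 l2 u1 c2; clear; move: (s * H) (s * L) (s * Q) (s * - lu) => *; lra.
have up : D <= 9661 * i4.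
  have b : D <= H - 10 * L - i1 + i2 + Q - 2^-1 * (6 * L - ll) + 51 * i3.
    by move: d2 e1 g1 t2; clear; move: i1 i2 (51 * i3) (2 / (200 - 1) ^+ 2) => *; lra.
  apply: le_trans b _; rewrite -(ler_pM2l s0).
  rewrite [leRHS](_ : _ = 9661 * (s * i4)); last by ring.
  rewrite [leLHS](_ : _ = s * H - 10 * (s * L) - s * i1 + s * i2 + s * Q - 2^-1 * (6 * (s * L) + s * - ll) + 51 * (s * i3)); last by ring.
  by rewrite s1 s2 s3 s4; move: h2 q2 l1 w1 c1; clear; move: (s * H) (s * L) (s * Q) (s * - ll) => *; lra.
have n0 : (200 * 100) * i4 = 1 by rewrite /i4 mulfV // mulf_neq0.
have -> : 4830 / 10 ^+ 4 = 9660 * i4 :> R.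
  by rewrite /i4 (_ : 10 ^+ 4 = 100 * 100); [field|ring].
have -> : 5 / 10 ^+ 5 = i4 :> R.
  by rewrite /i4 (_ : 10 ^+ 5 = 5 * (200 * 100)) ?invfM; [field|ring].
by move: low up; clear; rewrite ler_norml; move: i4 => i low up; apply/andP; split; lra.
Qed.

Lemma Dbar2_1_numeric (R : realType) : `|Dbar2 R 1 - 4830 / 10 ^+ 4| <= 5 / 10 ^+ 5.
Proof.
have [Z [Zc hZ]] := basel_bounds R.
have Z0 : 0 < Z.
  have /andP[h _] := hZ 1%N isT; apply: lt_le_trans h.
  by rewrite big_nat1 expr0n invr0 add0r invr1.
have /andP[d1 d2] := @Dbar2_1_bounds R 200 Z isT Zc.
have /andP[e1 e2] := euler_factor_bounds Z0 Zc.
rewrite sum_artanh_gap200 in d1 d2.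
have g := @euler_gamma_dist R 1024 isT.
have lnE : ln 1024 = 10 * ln 2 :> R.
  by rewrite mulr_natl -lnXn //; congr ln; ring.
rewrite lnE in g.
have /andP[h1 h2] := harmonic_floor_bounds R.
have /andP[q1 q2] := prime_floor_bounds R.
have /andP[l1 l2] := log_terms_ln2 R check_ln2.
have /andP[_ u1] := log_terms_bounds R check_z_hi.
have /andP[w1 _] := log_terms_bounds R check_z_lo.
have s0 : 0 < N2R scale :> R by apply: N2R_gt0; vm_compute.
have := @lower_check_real R _ _ _ _ _ _ check_lower; have := @upper_check_real R _ _ _ _ _ _ check_upper.
have sk : N2R scale = 1000 * 1000 * N2R two21 :> R.
  by rewrite /scale /two21 !N2R_mul !N2R_of_nat.
have st : N2R scale = 1024 * 2048 * N2R ten6 :> R.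
  by rewrite /scale /ten6 !N2R_mul !N2R_of_nat mulrC.
move=> c1 c2.
exact: (numeric_window s0 sk st d1 d2 e1 e2 g h1 h2 q1 q2 l1 l2 u1 w1 c1 c2).
Qed.

(** * The corollary *)

Lemma eq_prime_sum (R : realType) (f g : nat -> R) :
  (forall p, prime p -> f p = g p) -> prime_sum f = prime_sum g.
Proof.
by move=> fg; congr (limn _); apply/funext => n; apply: eq_bigr => p pp; exact: fg.
Qed.

Lemma D_term1E (R : realType) (k p : nat) : prime p -> (0 < k)%N ->
  D_term 1 k p = p%:R / (p%:R ^+ k - 1) :> R.
Proof.
move=> pp k0; rewrite D_termE // /jump_series eulerian_poly1 mulr1 expr1; congr (_ * _).
have pk : 1 < p%:R ^+ k :> R by rewrite exprn_egt1 ?ltr1n ?prime_gt1 // -lt0n.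
by rewrite -invfM mulrBr mulr1 mulfV // gt_eqF // (lt_trans ltr01).
Qed.

Lemma D_term0E (R : realType) (k p : nat) : D_term 0 k p = (p%:R ^+ (k - 1))^-1 :> R.
Proof. by rewrite /D_term /eulerian_sum /= expr0 invr1 !mulr1. Qed.

Theorem corollary7 (R : realType) :
  (forall l : nat,
     [/\ cvgn (prime_partial_sum (@D2_term R l)),
         forall k : nat, (3 <= k)%N ->
           cvgn (prime_partial_sum (@D_term R l k))
       & gcd_sum_estimates (A_ell l) (Dbar2 R l) (Dbar R l)])
  /\ [/\ gcd_sum_estimates A_mult (Dbar2 R 1) (Dbar R 1),
         Dbar2 R 1 = euler_gamma R
           + prime_sum (fun p => ln (1 - p%:R^-1) + p%:R / (p%:R ^+ 2 - 1)),
         `|Dbar2 R 1 - 4830 / 10 ^+ 4| <= 5 / 10 ^+ 5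
       & forall k : nat, (3 <= k)%N ->
           Dbar R 1 k = prime_sum (fun p => p%:R / (p%:R ^+ k - 1))]
  /\ [/\ gcd_sum_estimates A_star (Dbar2 R 0) (Dbar R 0),
         Dbar2 R 0 = mertens R
       & forall k : nat, (3 <= k)%N ->
           Dbar R 0 k = prime_sum (fun p => (p%:R ^+ (k - 1))^-1)].
Proof.
split=> [l|]; last split.
- split; [|by move=> k; exact: D_term_cvg|exact: gcd_sum_estimates_A_ell].
  by apply/cvg_ex; eexists; exact: D2_term_partial_cvg.
- split; [| |exact: Dbar2_1_numeric|].
  + by rewrite -A_ell1; exact: gcd_sum_estimates_A_ell.
  + congr (_ + _); apply: eq_prime_sum => p pp.
    by rewrite /D2_term -(@D_term1E R 2).
  + by move=> k k3; apply: eq_prime_sum => p pp; rewrite D_term1E // (leq_trans _ k3).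
- split.
  + by rewrite -A_ell0; exact: gcd_sum_estimates_A_ell.
  + congr (_ + _); apply: eq_prime_sum => p pp; congr (_ + _).
    by rewrite -[RHS](@D_term0E R 2).
  + by move=> k _; apply: eq_prime_sum => p _; exact: D_term0E.
Qed.
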